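(* Let $X$ be a complex manifold of dimension $n\ge 2$, $U\subset X$ a domain, and $\rho:U\to\mathbb{R}$ a smooth, strictly plurisubharmonic Morse function. Let $t_0\in\mathbb{R}$ be such that $\Sigma_{t_0}=\{x\in U:\rho(x)=t_0\}$ is connected and compact, and assume that $\Sigma_{t_0}$ either contains no critical point of $\rho$ or contains exactly one critical point $c$ of $\rho$. Let $\mathcal{N}$ be a holomorphic line bundle on $U$ and let $\mathcal{H}$ be a logarithm of $\mathcal{N}$ on $U_{t_0}^{+}=\{x\in U:\rho(x)>t_0\}$. (i) If $n\ge3$, or $n=2$ and $\Sigma_{t_0}$ has no critical point of Morse index $2$, then $\mathcal{H}$ extends as a cohomology class to a neighborhood of $\Sigma_{t_0}$ and stays there to be a logarithm of $\mathcal{N}$. (ii) If $n=\mathrm{ind}\,\rho|_{c}=2$ and $\mathcal{H}$ does not extend to a neighborhood of $c$, then there exists a neighborhood $V$ of $c$ biholomorphic to $K^2$ such that, after identifying $V$ with $K^2$, $\mathcal{H}|_{K^2\cap U_{t_0}^{+}}$ extends to $D$ and as an element of $H^1(D,\mathcal{O})$ is equal to $\mathrm{j}(rA)$ for some $r\in\mathbb{Z}$, $r\neq0$.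
   Context: A logarithm of a holomorphic line bundle $\mathcal{N}$ on an open set $G$ is a cohomology class $\mathcal{H}\in H^1(G,\mathcal{O})$ such that $\exp(\mathcal{H})=\mathcal{N}|_{G}$ in $H^1(G,\mathcal{O}^* )$, where $\exp$ is the map of the exponential sequence, induced by $f\mapsto e^{2\pi i f}$. ''$\mathcal{H}$ extends to a neighborhood of $S$'' (with $S=\Sigma_{t_0}$ or $S=\{c\}$) means that there are an open neighborhood $B$ of $S$ in $U$ and a class in $H^1(U_{t_0}^{+}\cup B,\mathcal{O})$ whose restriction to $U_{t_0}^{+}$ is $\mathcal{H}$. $\mathrm{ind}\,\rho|_{c}$ is the Morse index of $\rho$ at $c$. With $z_j=x_j+iy_j$, $j=1,2$, the coordinates of $\mathbb{C}^2$, set $K^2=\{|x_j|<1,|y_j|<1,\ j=1,2\}$ and $D=K^2\setminus\{x_1=x_2=0\}$. Let $C=\{y_1=y_2=0,\ x_1^2+x_2^2=1/2\}$ be the generator of $H_1(D,\mathbb{Z})$, $A\in H^1(D,\mathbb{Z})$ the class with $\langle A,C\rangle=1$, and $\mathrm{j}:H^1(D,\mathbb{Z})\to H^1(D,\mathcal{O})$ the natural imbedding. *)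

(* Defs.v *)
From HB Require Import structures.
From mathcomp Require Import all_boot all_order all_algebra.
From mathcomp Require Import complex.
From mathcomp Require Import all_classical all_reals all_analysis.

Set Implicit Arguments.
Unset Strict Implicit.
Unset Printing Implicit Defensive.

Import Order.TTheory GRing.Theory Num.Theory numFieldNormedType.Exports.
Local Open Scope classical_set_scope.
Local Open Scope complex_scope.
Local Open Scope ring_scope.

(* Bundling R[i] as a numFieldType gives it, and row vectors over it, their
   normed topologies; [differentiable] between such spaces is then complex
   differentiability. *)
Definition Cx (R : realType) : numFieldType := R[i].
Definition Cn (R : realType) (n : nat) : normedModType (Cx R) := 'rV[Cx R]_n.

Definition cexp (R : realType) (z : Cx R) : Cx R :=
  (expR (complex.Re z) * cos (complex.Im z))
    +i* (expR (complex.Re z) * sin (complex.Im z)).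

Record chart (R : realType) (n : nat) (T : topologicalType) := Chart {
  cdom : set T;
  cmap : T -> Cn R n;
  cinv : Cn R n -> T;
  cdom_open : open cdom;
  crng_open : open (cmap @` cdom);
  cmap_cont : {within cdom, continuous cmap};
  cinv_cont : {within cmap @` cdom, continuous cinv};
  cmapK : forall x, cdom x -> cinv (cmap x) = x }.

(* A holomorphic atlas; the separation and countability axioms are added in
   [complexManifold]. *)
Record chartedSpace (R : realType) (n : nat) := ChartedSpace {
  cs_carrier :> topologicalType;
  atlas : set (chart R n cs_carrier);
  atlas_cover : forall x, exists2 a, atlas a & cdom a x;
  atlas_compat : forall a b x, atlas a -> atlas b -> cdom a x -> cdom b x ->
    differentiable (cmap b \o cinv a) (cmap a x) }.

Record complexManifold (R : realType) (n : nat) := ComplexManifold {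
  cm_space :> chartedSpace R n;
  cm_hausdorff : hausdorff_space cm_space;
  cm_countable : @second_countable cm_space }.

Section StandardSpace.
Variables (R : realType) (n : nat).

Fact Cn_rng_open : open ((id : Cn R n -> Cn R n) @` [set: Cn R n]).
Proof. by rewrite image_id; exact: openT. Qed.

Fact Cn_id_cont (A : set (Cn R n)) :
  {within A, continuous (id : Cn R n -> Cn R n)}.
Proof. by apply: continuous_subspaceT => x; exact: cvg_id. Qed.

Definition Cn_chart : chart R n (Cn R n) :=
  @Chart R n (Cn R n) setT id id openT Cn_rng_open
    (@Cn_id_cont _) (@Cn_id_cont _) (fun x _ => erefl x).

Fact Cn_cover (x : Cn R n) : exists2 a, [set Cn_chart] a & cdom a x.
Proof. by exists Cn_chart. Qed.

Fact Cn_compat (a b : chart R n (Cn R n)) (x : Cn R n) :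
  [set Cn_chart] a -> [set Cn_chart] b -> cdom a x -> cdom b x ->
  differentiable (cmap b \o cinv a) (cmap a x).
Proof. by move=> -> -> _ _; have [+ _] := is_diff_id x. Qed.

Definition CnSpace : chartedSpace R n := ChartedSpace Cn_cover Cn_compat.

End StandardSpace.

(* To be used on open sets W only. *)
Definition holomorphic (R : realType) (n : nat) (X : chartedSpace R n)
    (W : set X) (f : X -> Cx R) : Prop :=
  forall x a, W x -> atlas a -> cdom a x ->
    differentiable (f \o cinv a) (cmap a x).

Definition holomorphic_map (R : realType) (n m : nat)
    (X : chartedSpace R n) (Y : chartedSpace R m)
    (W : set X) (f : X -> Y) : Prop :=
  {within W, continuous f} /\
  forall x a b, W x -> atlas a -> cdom a x -> atlas b -> cdom b (f x) ->
    differentiable (cmap b \o f \o cinv a) (cmap a x).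

Definition biholomorphism (R : realType) (n m : nat)
    (X : chartedSpace R n) (Y : chartedSpace R m)
    (V : set X) (W : set Y) (f : X -> Y) (g : Y -> X) : Prop :=
  [/\ (forall x, V x -> W (f x) /\ g (f x) = x),
      (forall y, W y -> V (g y) /\ f (g y) = y),
      holomorphic_map V f & holomorphic_map W g].

Definition is_domain (T : topologicalType) (U : set T) : Prop :=
  [/\ open U, connected U & U !=set0].

Section RealCalculus.
Variables (R : realType) (n : nat).
Implicit Types (w z : Cn R n) (g : Cn R n -> R).

Definition along w g z : R -> R := fun s => g (z + (s%:C : Cx R) *: w).

Definition rderive w g : Cn R n -> R := fun z => 'D_1 (along w g z) 0.

(* C^infinity on the open set W: all iterated directional derivatives exist
   and are continuous. *)
Definition smooth_in (W : set (Cn R n)) g : Prop :=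
  forall (ws : seq (Cn R n)) z, W z ->
    let h := foldr rderive g ws in
    {for z, continuous h} /\ forall w, derivable (along w h z) 0 1.

Definition xdir (j : 'I_n) : Cn R n := delta_mx ord0 j.
Definition ydir (j : 'I_n) : Cn R n := ('i : Cx R) *: (delta_mx ord0 j : Cn R n).

(* d^2 g / dz_j d(conj z_k), with d/dz_j = (d/dx_j - i d/dy_j) / 2 and
   d/d(conj z_k) = (d/dx_k + i d/dy_k) / 2. *)
Definition levi_mx g z : 'M[Cx R]_n := \matrix_(j < n, k < n)
  (((rderive (xdir j) (rderive (xdir k) g) z
     + rderive (ydir j) (rderive (ydir k) g) z) / 4%:R)
   +i* ((rderive (xdir j) (rderive (ydir k) g) z
     - rderive (ydir j) (rderive (xdir k) g) z) / 4%:R) : Cx R).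

(* [0 < _] is the order of R[i]: the value is real and positive. *)
Definition levi_positive g z : Prop :=
  forall w : Cn R n, w != 0 ->
    0 < \sum_(j < n) \sum_(k < n)
          levi_mx g z j k * w ord0 j * conjc (w ord0 k) :> Cx R.

(* The real basis d/dx_1, ..., d/dx_n, d/dy_1, ..., d/dy_n. *)
Definition rdir (j : 'I_(n + n)) : Cn R n :=
  match fintype.split j with inl k => xdir k | inr k => ydir k end.

Definition hessian g z : 'M[R]_(n + n) :=
  \matrix_(j, k) rderive (rdir j) (rderive (rdir k) g) z.

Definition gradient_zero g z : Prop := forall w, rderive w g z = 0.

End RealCalculus.

Definition negative_on (R : realType) (m : nat) (S A : 'M[R]_m) : Prop :=
  forall v : 'rV[R]_m, (v <= A)%MS -> v != 0 ->
    (v *m S *m v^T) ord0 ord0 < 0.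

(* k is the largest dimension of a subspace (the row space of A) on which the
   quadratic form of S is negative definite. *)
Definition negative_index (R : realType) (m : nat) (S : 'M[R]_m) (k : nat) :
    Prop :=
  (exists2 A : 'M[R]_m, negative_on S A & \rank A = k) /\
  (forall A : 'M[R]_m, negative_on S A -> (\rank A <= k)%N).

Section FunctionsOnManifolds.
Variables (R : realType) (n : nat) (X : chartedSpace R n).
Implicit Types (U : set X) (rho : X -> R) (x : X).

Definition smooth_on U rho : Prop :=
  forall a, atlas a ->
    smooth_in (cmap a @` (cdom a `&` U)) (rho \o cinv a).

Definition strictly_psh_on U rho : Prop :=
  forall x a, U x -> atlas a -> cdom a x ->
    levi_positive (rho \o cinv a) (cmap a x).

Definition critical rho x : Prop :=
  forall a, atlas a -> cdom a x -> gradient_zero (rho \o cinv a) (cmap a x).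

Definition nondegenerate_at rho x : Prop :=
  forall a, atlas a -> cdom a x ->
    hessian (rho \o cinv a) (cmap a x) \in unitmx.

Definition morse_on U rho : Prop :=
  forall x, U x -> critical rho x -> nondegenerate_at rho x.

(* Meaningful at a critical point, where it does not depend on the chart. *)
Definition morse_index rho x (k : nat) : Prop :=
  forall a, atlas a -> cdom a x ->
    negative_index (hessian (rho \o cinv a) (cmap a x)) k.

Definition level U rho (t0 : R) : set X := [set x | U x /\ rho x = t0].
Definition superlevel U rho (t0 : R) : set X := [set x | U x /\ t0 < rho x].

End FunctionsOnManifolds.

(* Sheaves of abelian groups whose sections over an open set W are the
   functions satisfying [fsec W], with pointwise operation; only the values
   on W matter. *)
Record fsheaf (T : topologicalType) := FSheaf {
  fval : Type;
  fop : fval -> fval -> fval;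
  fneg : fval -> fval;
  fsec : set T -> set (T -> fval) }.
Arguments fop {T} f _ _ : rename.
Arguments fneg {T} f _ : rename.
Arguments fsec {T} f _ _ : rename.

Definition Osheaf (R : realType) (n : nat) (X : chartedSpace R n) : fsheaf X :=
  @FSheaf X (Cx R) +%R -%R (fun W f => holomorphic W f).

Definition Ostar (R : realType) (n : nat) (X : chartedSpace R n) : fsheaf X :=
  @FSheaf X (Cx R) *%R GRing.inv
    (fun W f => holomorphic W f /\ forall x, W x -> f x != 0).

Definition Zsheaf (T : topologicalType) : fsheaf T :=
  @FSheaf T int +%R -%R
    (fun W f => forall x, W x -> \forall y \near x, f y = f x).

(* A cover together with a function on each ordered pair of indices. *)
Record cochain (T A : Type) := Cochain {
  cidx : Type;
  ccov : cidx -> set T;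
  cval : cidx -> cidx -> T -> A }.
Arguments ccov {T A} c i _.
Arguments cval {T A} c i j _.

(* Elements of H^1(G, F) are represented by cocycles, ... *)
Definition H1 (T : topologicalType) (F : fsheaf T) (G : set T) :
    set (cochain T (fval F)) :=
  [set c | [/\ (forall i, open (ccov c i)),
     \bigcup_i ccov c i = G,
     (forall i j, fsec F (ccov c i `&` ccov c j) (cval c i j)) &
     (forall i j k x, ccov c i x -> ccov c j x -> ccov c k x ->
        fop F (cval c i j x) (cval c j k x) = cval c i k x)]].
Arguments H1 {T} F G _.

(* ... and two cocycles represent the same element when they differ by a
   coboundary h_j - h_k on some common refinement W of their covers. *)
Definition H1_eq (T : topologicalType) (F : fsheaf T) (G : set T)
    (c d : cochain T (fval F)) : Prop :=
  exists (J : Type) (W : J -> set T) (a : J -> cidx c) (b : J -> cidx d)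
      (h : J -> T -> fval F),
    [/\ (forall j, open (W j)),
        \bigcup_j W j = G,
        (forall j, W j `<=` ccov c (a j) `&` ccov d (b j)),
        (forall j, fsec F (W j) (h j)) &
        (forall j k x, W j x -> W k x ->
           cval c (a j) (a k) x =
           fop F (fop F (h j x) (cval d (b j) (b k) x)) (fneg F (h k x)))].
Arguments H1_eq {T} F G c d.

Definition map_cochain (T A B : Type) (f : A -> B) (c : cochain T A) :
    cochain T B :=
  @Cochain T B (cidx c) (ccov c) (fun i j x => f (cval c i j x)).

(* The pull-back by f : G -> S, where f is only relevant on G. *)
Definition pullback (S T A : Type) (f : T -> S) (G : set T)
    (c : cochain S A) : cochain T A :=
  @Cochain T A (cidx c) (fun i => G `&` f @^-1` ccov c i)
    (fun i j x => cval c i j (f x)).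

Definition res_class (T A : Type) (G : set T) (c : cochain T A) : cochain T A :=
  pullback id G c.

Definition exp_class (R : realType) (T : Type) :
    cochain T (Cx R) -> cochain T (Cx R) :=
  map_cochain (fun z : Cx R => cexp (((0 : R) +i* (2%:R * pi) : Cx R) * z)).

(* The map j induced by the inclusion of the constants Z in O. *)
Definition jmap (R : realType) (T : Type) : cochain T int -> cochain T (Cx R) :=
  map_cochain (fun m : int => m%:~R : Cx R).

Definition scale_class (T : Type) (r : int) : cochain T int -> cochain T int :=
  map_cochain (fun m : int => r * m).

(* A family of complex lines over U with local frames related by holomorphic
   transition functions; the complex structure of the total space is the one
   making these frames local trivialisations. *)
Record lineBundle (R : realType) (n : nat) (X : chartedSpace R n) (U : set X) :=
  LineBundle {
  fiber : X -> lmodType (Cx R);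
  lidx : Type;
  lcov : lidx -> set X;
  frame : lidx -> forall x, fiber x;
  trans : lidx -> lidx -> X -> Cx R;
  lcov_open : forall i, open (lcov i);
  lcov_cover : \bigcup_i lcov i = U;
  frame_basis : forall i x, lcov i x ->
    forall v : fiber x, exists! t : Cx R, v = t *: frame i x;
  trans_holo : forall i j, holomorphic (lcov i `&` lcov j) (trans i j);
  trans_frame : forall i j x, lcov i x -> lcov j x ->
    frame j x = trans i j x *: frame i x }.
Arguments lcov {R n X U} N i _ : rename.
Arguments trans {R n X U} N i j _ : rename.

Definition bundle_class (R : realType) (n : nat) (X : chartedSpace R n)
    (U : set X) (N : lineBundle U) : cochain X (Cx R) :=
  Cochain (lcov N) (trans N).

Definition is_logarithm (R : realType) (n : nat) (X : chartedSpace R n)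
    (U : set X) (N : lineBundle U) (G : set X) (H : cochain X (Cx R)) : Prop :=
  H1 (Osheaf X) G H /\
  H1_eq (Ostar X) G (exp_class H) (res_class G (bundle_class N)).

(* B is a neighbourhood of S in U, and the class H' on G `|` B extends the
   class H on G. *)
Definition is_extension (R : realType) (n : nat) (X : chartedSpace R n)
    (U G : set X) (H : cochain X (Cx R)) (S B : set X)
    (H' : cochain X (Cx R)) : Prop :=
  [/\ open B, S `<=` B, B `<=` U, H1 (Osheaf X) (G `|` B) H' &
      H1_eq (Osheaf X) G (res_class G H') H].

Definition K2 (R : realType) : set (CnSpace R 2) :=
  [set z : Cn R 2 | forall j : 'I_2,
     `|complex.Re (z ord0 j)| < 1 /\ `|complex.Im (z ord0 j)| < 1].

Definition Dset (R : realType) : set (CnSpace R 2) :=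
  @K2 R `\` [set z : Cn R 2 | forall j : 'I_2, complex.Re (z ord0 j) = 0].

(* The circle C, traversed once from the x_1-axis towards the x_2-axis. *)
Definition Cloop (R : realType) (t : R) : CnSpace R 2 :=
  (\row_(j < 2) (((if j == ord0 then cos (2%:R * pi * t)
                   else sin (2%:R * pi * t)) / Num.sqrt 2%:R)%:C : Cx R)
   : Cn R 2).

(* p = <c, g> for a loop g : [0, 1] -> T: cut [0, 1] at
   0 = s_0 <= ... <= s_(m+1) = 1 so that g maps [s_k, s_(k+1)] into the
   (i_k)-th set of the cover, i_(m+1) = i_0, and add up the values of c on
   passing from i_k to i_(k+1).  If c is written f_i - f_j with smooth
   real functions f_i, this is the integral over g of the closed form
   df_i = df_j. *)
Definition loop_pairing (R : realType) (T : topologicalType)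
    (c : cochain T int) (g : R -> T) (p : int) : Prop :=
  exists (m : nat) (s : nat -> R) (i : nat -> cidx c),
    [/\ s 0%N = 0 /\ s m.+1 = 1,
        (forall k, (k <= m)%N -> s k <= s k.+1),
        i m.+1 = i 0%N,
        (forall k t, (k <= m)%N -> s k <= t <= s k.+1 ->
           ccov c (i k) (g t)) &
        p = \sum_(0 <= k < m.+1) cval c (i k) (i k.+1) (g (s k.+1))].

(* Main.v *)
Require Import Defs.
Require Import Defs.
From HB Require Import structures.
From mathcomp Require Import all_boot all_order all_algebra.
From mathcomp Require Import complex.
From mathcomp Require Import all_classical all_reals all_analysis.
From mathcomp Require Import ring lra zify.

Set Implicit Arguments.
Unset Strict Implicit.
Unset Printing Implicit Defensive.

Import Order.TTheory GRing.Theory Num.Theory numFieldNormedType.Exports.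
Local Open Scope classical_set_scope.
Local Open Scope ring_scope.

(** A logarithm over an open set G is encoded by functions, in general
discontinuous, whose differences are holomorphic: choosing a member of a cover
for each point splits its cocycle ([logarithm_structure]), and such functions
give back a cocycle ([structure_cochain]). Over a set where the bundle has a
frame, a logarithm of the bundle is, modulo holomorphic functions, a fixed
logarithm of the coordinate of the frame plus integers
([log_integer_structure]). Two logarithms of one bundle therefore differ by
integer data, and whether H extends across a point of the level is a question
about the topology of G = {rho > t0} near this point.

If every point of the compact level has arbitrarily small neighbourhoods W for
which the part of W in G is nonempty and connected and has no cohomology with
integer coefficients in degree one, then H extends near each point of the
level, uniquely up to integers that vanish on G, and the local extensions can
be glued ([extend_to_neighborhood]).

Near a regular point of the level, G is a union of half lines in a direction
of increase of rho ([flow_box]). Near a critical point with k negative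
directions the function is concave along these and has a strict minimum along
the remaining 2n - k; hence G retracts to a punctured ball of dimension 2n - k
([saddle_local], [saddle]). Since the Levi form is positive, a space of
negative directions contains no complex line, so that k is at most n
([negative_rank]). The punctured ball has dimension at least 3, and is simply
connected ([saddle_H1]), if n is at least 3, or if n = 2 and k is at most 1.
This gives (i).

If n = k = 2, the punctured ball is a punctured disc, and an integer class is
determined by its jump around the puncture ([saddle_jump]). The plane of
negative directions is totally real, so in suitable complex coordinates it
becomes the plane x = 0 and its product with - i the plane y = 0
([saddle_chart]). In the box K^2 both D and the part of G are then saddles.
The class A has jump 1 since its value on C is 1 ([loop_pairing_jump]). If r
is the jump of the integers that describe H, these differ from r A by a trivial
class ([same_jump]), which means that H is the restriction of j(r A). If r
vanished, the integers of H would be trivial, and H would extend to a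
neighbourhood of c. This gives (ii). *)

(** * Integer structures and their monodromy *)

Lemma near_continuous (S T : topologicalType) (f : S -> T) x y (P : T -> Prop) :
  {for x, continuous f} -> f x = y ->
  (\forall w \near y, P w) -> \forall t \near x, P (f t).
Proof. by move=> fc <-; exact: fc. Qed.

Lemma near_open (T : topologicalType) (W : set T) x :
  open W -> W x -> \forall y \near x, W y.
Proof. by move=> oW Wx; exact: open_nbhs_nbhs. Qed.

Section IntegerStructures.
Variable T : topologicalType.
Implicit Types (x y : T) (f g h : T -> int) (m : T -> T -> int) (E : set T).

(** Equality modulo locally constant functions. *)
Definition same_germ x f g := \forall w \near x, f w - g w = f x - g x.

Definition locally_constant E f := forall x, E x -> \forall y \near x, f y = f x.

(** A class in H^1(E, Z), encoded by one function m x for each point x, of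
which only the germ at x modulo constants matters: choosing a member of a cover
at each point turns a cocycle into such a family, and the class vanishes when a
single function represents all the germs. *)
Definition int_structure E m :=
  forall x, E x -> \forall y \near x, same_germ y (m x) (m y).

Definition H0_trivial E :=
  forall f, locally_constant E f -> forall x y, E x -> E y -> f x = f y.

Definition H1_trivial E :=
  forall m, int_structure E m -> exists f, forall x, E x -> same_germ x f (m x).

Lemma same_germ_sym x f g : same_germ x f g -> same_germ x g f.
Proof. by apply: filterS => w fg; rewrite -opprB fg opprB. Qed.

Lemma same_germ_trans x f g h :
  same_germ x f g -> same_germ x g h -> same_germ x f h.
Proof.
apply: filterS2 => w fg gh.
by rewrite -[f w](subrK (g w)) fg -addrA gh; lia.
Qed.

Lemma same_germ_eql x f f' g :
  (\forall w \near x, f w = f' w) -> same_germ x f g -> same_germ x f' g.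
Proof.
by move=> ff; rewrite /same_germ (nbhs_singleton ff); apply: filterS2 ff => w ->.
Qed.

Lemma same_germ_addr x f k : same_germ x f (fun w => f w + k).
Proof. by apply: nearW => w; rewrite !opprD !addNKr. Qed.

Lemma locally_constant_sub E f g :
  (forall x, E x -> same_germ x f g) -> locally_constant E (fun x => f x - g x).
Proof. by move=> fg x /fg. Qed.

(** Mayer-Vietoris for two open sets with connected intersection: the two
trivialisations differ there by one constant, which can be absorbed. *)
Lemma H1_trivialU E1 E2 : open E1 -> open E2 ->
  E1 `&` E2 !=set0 -> H0_trivial (E1 `&` E2) ->
  H1_trivial E1 -> H1_trivial E2 -> H1_trivial (E1 `|` E2).
Proof.
move=> oE1 oE2 [p [p1 p2]] H0 H1 H2 m mE.
have [f1 f1P] : exists f, forall x, E1 x -> same_germ x f (m x).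
  by apply: H1 => x Ex; apply: mE; left.
have [f2 f2P] : exists f, forall x, E2 x -> same_germ x f (m x).
  by apply: H2 => x Ex; apply: mE; right.
have lc : locally_constant (E1 `&` E2) (fun x => f1 x - f2 x).
  apply: locally_constant_sub => x [x1 x2].
  exact: same_germ_trans (f1P _ x1) (same_germ_sym (f2P _ x2)).
pose k := f1 p - f2 p.
have fk x : E1 x -> E2 x -> f1 x = f2 x + k.
  by move=> x1 x2; rewrite /k (H0 _ lc p x)//; lia.
exists (fun x => if x \in E1 then f1 x else f2 x + k) => x Ex.
have [x1|x1] := pselect (E1 x).
  apply: same_germ_eql (f1P _ x1).
  by apply: filterS (near_open oE1 x1) => w w1; rewrite mem_set.
have x2 : E2 x by case: Ex.
have near2 : \forall w \near x, (if w \in E1 then f1 w else f2 w + k) = f2 w + k.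
  apply: filterS (near_open oE2 x2) => w w2.
  by case: ifPn => // /set_mem w1; exact: fk.
apply: filterS2 near2 (f2P _ x2) => w w2.
rewrite w2 memNset//; lia.
Qed.

End IntegerStructures.

(** The vanishing conditions only see the open set up to homeomorphism. *)
Section Transport.
Variables (S T : topologicalType) (E : set S) (E' : set T).
Variables (phi : S -> T) (psi : T -> S).
Hypotheses (phiE : forall x, E x -> E' (phi x)) (psiE : forall y, E' y -> E (psi y)).
Hypotheses (phiK : forall x, E x -> psi (phi x) = x) (oE : open E).
Hypotheses (phi_cont : forall x, E x -> {for x, continuous phi}).
Hypotheses (psi_cont : forall y, E' y -> {for y, continuous psi}).

Lemma H0_trivial_transport : H0_trivial E' -> H0_trivial E.
Proof.
move=> H0 f lcf x y Ex Ey.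
have := H0 (f \o psi) _ (phi x) (phi y) (phiE Ex) (phiE Ey).
rewrite /= !phiK//; apply=> z Ez.
exact: psi_cont Ez _ (lcf _ (psiE Ez)).
Qed.

Lemma H1_trivial_transport : open E' -> H1_trivial E' -> H1_trivial E.
Proof.
move=> oE' H1 m mE.
have [f fP] : exists f, forall z, E' z -> same_germ z f (m (psi z) \o psi).
  apply: (H1 (fun z => m (psi z) \o psi)) => z Ez.
  have near_psi : \forall y \near z, same_germ (psi y) (m (psi z)) (m (psi y)).
    exact: psi_cont Ez _ (mE _ (psiE Ez)).
  apply: filterS2 near_psi (near_open oE' Ez) => y my Ey.
  exact: psi_cont Ey _ my.
exists (f \o phi) => x Ex.
have fx : \forall w \near x, f (phi w) - m (psi (phi x)) (psi (phi w)) =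
    f (phi x) - m (psi (phi x)) (psi (phi x)).
  exact: phi_cont Ex _ (fP _ (phiE Ex)).
apply: filterS2 fx (near_open oE Ex) => w fw Ew.
by rewrite !phiK in fw.
Qed.

End Transport.

Section Contraction.
Variable R : realType.

(** The line is connected. *)
Lemma locally_constant_line (f : R -> int) :
  (forall s, \forall s' \near s, f s' = f s) -> forall a b, f a = f b.
Proof.
move=> lcf a b.
have op k : open [set s | f s = k].
  by rewrite openE => s /= <-; exact: lcf.
have opC k : open [set s | f s <> k].
  by rewrite openE => s /= sk; apply: filterS (lcf s) => s' /= ->.
have : connected [set: R] by apply/connected_intervalP.
move=> /(_ [set s | f s = f a]) cR.
suff : [set s | f s = f a] = setT by move=> /seteqP[_ /(_ b I)] /= ->.
apply: cR; first by exists a.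
- by exists [set s | f s = f a]; rewrite ?setTI.
- exists [set s | f s = f a]; rewrite ?setTI//.
  rewrite (_ : [set s | f s = f a] = ~` [set s | f s <> f a]).
    exact: open_closedC.
  by rewrite predeqE => s /=; split=> [->|/contrapT].
Qed.

(** The supremum of the set of all t with P t would be exceeded by d. *)
Lemma real_induction (P : R -> Prop) :
  (forall t t', t' <= t -> P t -> P t') -> P 0 ->
  (forall t0, 0 <= t0 -> exists2 d, 0 < d &
     forall t, 0 <= t -> t0 - d < t -> P t -> P (t0 + d)) ->
  forall t, P t.
Proof.
move=> Pdown P0 Pstep b; apply: contrapT => nPb.
have ubS : ubound [set t | P t] b.
  move=> t Pt; rewrite leNgt; apply/negP => bt.
  by apply: nPb; apply: Pdown Pt; exact: ltW.
have hS : has_sup [set t | P t] by split; [exists 0 | exists b].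
have t00 : 0 <= sup [set t | P t] := (ub_le_sup hS.2 P0).
have [d d0 step] := Pstep _ t00.
have [t Pt tlt] := sup_adherent d0 hS.
have : P (sup [set t | P t] + d).
  apply: (step (Num.max t 0)); rewrite ?le_max ?lexx ?orbT ?lt_max ?tlt//.
  by rewrite maxEle; case: ifP.
by move=> /(ub_le_sup hS.2); rewrite gerDl leNgt d0.
Qed.

Variable T : topologicalType.
Variables (E : set T) (p : T) (F : T * R -> T).
Hypothesis oE : open E.
Hypothesis FE : forall y s, E y -> E (F (y, s)).
Hypothesis F_cont : forall y s, E y -> {for (y, s), continuous F}.
Hypothesis F0 : forall y s, s <= 0 -> F (y, s) = p.
Hypothesis F1 : forall y, F (y, 1) = y.

Let line_cont y s : {for s, continuous (fun s => (y, s) : T * R)}.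
Proof. by apply: (cvg_pair (cvg_cst _) cvg_id). Qed.

Let slice_cont y s : {for y, continuous (fun y => (y, s) : T * R)}.
Proof. by apply: (cvg_pair cvg_id (cvg_cst _)). Qed.

Let near_box y s (P : T -> Prop) (Q : R -> Prop) :
  (\forall y' \near y, P y') -> (\forall s' \near s, Q s') ->
  \forall q \near ((y, s) : (T * R)%type), P q.1 /\ Q q.2.
Proof. by move=> Py Qs; exists (P, Q) => [|q []//]; split. Qed.

Let near_time y s (P : R -> Prop) :
  (\forall s' \near s, P s') -> \forall q \near ((y, s) : (T * R)%type), P q.2.
Proof.
by move=> Ps; exists (setT, P) => [|q []//]; split=> //=; exact: filterT.
Qed.

(** Monodromy along the tracks of the contraction: over a neighbourhood of one
track the pulled back structure is trivialised on longer and longer time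
intervals; trivialisations normalised at the common origin of all tracks are
unique along each track, hence fit together at time 1. *)
Lemma contraction_H1 : H1_trivial E.
Proof.
move=> m mE.
pose M (q q' : T * R) := m (F q) (F q').
have M_near q : E q.1 -> \forall q' \near q, same_germ q' (M q) (M q').
  case: q => y s /= Ey.
  have Fnear : \forall q \near (y, s), same_germ (F q) (m (F (y, s))) (m (F q)).
    exact: F_cont s Ey _ (mE _ (FE s Ey)).
  have Enear : \forall q' \near (y, s), E q'.1.
    by exists (E, setT) => [|q' []//]; split=> /=;
      [exact: open_nbhs_nbhs|exact: filterT].
  apply: filterS2 Enear Fnear => -[y' s'] /= Ey' my.
  exact: F_cont Ey' _ my.
(* Normalisation at time -1, where every track is still at p. *)
pose triv (V : set T) (mu : T * R -> int) (t : R) :=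
  (forall y s, V y -> s < t -> same_germ (y, s) mu (M (y, s))) /\
  (forall y, V y -> mu (y, -1) = 0).
have triv_uniq V V' mu mu' t y s : triv V mu t -> triv V' mu' t ->
    V y -> V' y -> s < t -> -1 <= s -> mu (y, s) = mu' (y, s).
  move=> [gmu mu0] [gmu' mu0'] Vy Vy' st.
  move=> s1.
  have := @locally_constant_line
    (fun r => mu (y, Num.min r s) - mu' (y, Num.min r s)) _ s (-1).
  rewrite minxx (min_idPl s1) mu0// mu0'// subrr => H.
  apply/eqP; rewrite -subr_eq0; apply/eqP; apply: H => r.
  have rt : Num.min r s < t by rewrite gt_min st orbT.
  have g := same_germ_trans (gmu _ _ Vy rt) (same_germ_sym (gmu' _ _ Vy' rt)).
  have mc : {for r, continuous (fun r => (y, Num.min r s) : T * R)}.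
    apply: (@continuous_comp _ _ _ (fun r => Num.min r s) (fun s => (y, s))).
      apply: (@continuous_min _ _ (fun r : R => r) (fun=> s)); first exact: cvg_id.
      exact: cvg_cst.
    exact: line_cont.
  exact: mc _ g.
pose ex (y0 : T) (t : R) := exists V mu, [/\ nbhs y0 V, V `<=` E & triv V mu t].
(* Time 2, so that time 1 is interior to the interval. *)
have ex_all y0 : E y0 -> ex y0 2.
  move=> Ey0; apply: (@real_induction (ex y0)).
  - move=> t t' t't [V [mu [nV VE [g mu0]]]]; exists V, mu; split=> //.
    by split=> // y s Vy st; apply: g => //; exact: lt_le_trans st t't.
  - exists E, (fun=> 0); split=> //; first exact: open_nbhs_nbhs.
    split=> // y s Ey s0; have : \forall q \near (y, s), q.2 < 0.
      exists (setT, [set s | s < 0]) => [|q []//].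
      by split=> /=; [exact: filterT|exact: lt_nbhsl].
    apply: filterS => -[y' s'] /= s'0.
    by rewrite /M F0 ?F0// ltW.
  - move=> t0 t00.
    have [[V0 J] /= [nV0 nJ] VJ] := M_near (y0, t0) Ey0.
    have /nbhs_ballP[d /= d0 dJ] := nJ.
    have {VJ}VJ y s : V0 y -> t0 - d < s -> s < t0 + d ->
        same_germ (y, s) (M (y0, t0)) (M (y, s)).
      move=> Vy s1 s2; apply: (VJ (y, s)); split=> //=; apply: dJ.
      by rewrite /ball /= ltr_distlC; apply/andP; split; lra.
    exists d => // t t0' td [V [mu [nV VE [g mu0]]]].
    have [c [c1 c2 c3 cd]] : 
        exists c, [/\ t0 - d < c, -1 < c, c < t & c < t0 + d].
      exists ((Num.max (t0 - d) (-1) + Num.min t (t0 + d)) / 2).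
      have : Num.max (t0 - d) (-1) < Num.min t (t0 + d).
        by rewrite gt_max !lt_min td /=; lra.
      have : Num.min t (t0 + d) <= t by rewrite ge_min lexx.
      have : Num.min t (t0 + d) <= t0 + d by rewrite ge_min lexx orbT.
      have : t0 - d <= Num.max (t0 - d) (-1) by rewrite le_max lexx.
      have : -1 <= Num.max (t0 - d) (-1) by rewrite le_max lexx orbT.
      by split; lra.
    pose k := mu (y0, c) - M (y0, t0) (y0, c).
    have gc : same_germ (y0, c) mu (M (y0, t0)).
      have y0V := nbhs_singleton nV; have y0V0 := nbhs_singleton nV0.
      apply: same_germ_trans (g _ _ y0V c3) (same_germ_sym (VJ _ _ y0V0 c1 cd)).
    have [[V1 J1] /= [nV1 nJ1] VJ1] := gc.
    exists (V `&` V0 `&` V1°).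
    exists (fun q => if q.2 <= c then mu q else M (y0, t0) q + k).
    have nV1' : nbhs y0 V1° by exact: nbhs_interior.
    split; [by apply: filterI => //; exact: filterI | by move=> y [[/VE]] |].
    split; last by move=> y [[Vy _] _] /=; rewrite ltW//; exact: mu0.
    move=> y s [[Vy V0y] V1y] s2.
    have [sc|cs] := ltP s c.
      apply: same_germ_eql (g _ _ Vy (lt_trans sc c3)).
      by apply: filterS (near_time y (lt_nbhsl sc)) => q /ltW ->.
    apply: same_germ_trans (VJ _ _ V0y (lt_le_trans c1 cs) s2).
    apply: (@same_germ_eql _ _ (fun q => M (y0, t0) q + k)); last first.
      exact: same_germ_sym (same_germ_addr _ _ _).
    have kE (q : T * R) : V1 q.1 -> J1 q.2 -> mu q = M (y0, t0) q + k.
      by move=> q1 q2; rewrite /k -(VJ1 q (conj q1 q2)) addrC subrK.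
    have [cs'|cs'] := ltP c s.
      apply: filterS (near_time y (lt_nbhsr cs')) => q /=; rewrite ltNge.
      by move=> /negbTE ->.
    have <- : c = s by apply/eqP; rewrite eq_le cs.
    apply: filterS (near_box V1y nJ1) => q [q1 q2].
    by case: ifP => // _; rewrite kE.
pose VM y0 (H : E y0) := projT1 (cid (ex_all y0 H)).
pose mu_of y0 (H : E y0) := projT1 (cid (projT2 (cid (ex_all y0 H)))).
have muP y0 (H : E y0) : [/\ nbhs y0 (VM y0 H), VM y0 H `<=` E &
    triv (VM y0 H) (mu_of y0 H) 2].
  exact: (projT2 (cid (projT2 (cid (ex_all y0 H))))).
exists (fun y => if pselect (E y) is left H then mu_of y H (y, 1) else 0) => y Ey.
have [nV VE tV] := muP y Ey.
have Vy := nbhs_singleton nV.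
have g : same_germ y (fun y' => mu_of y Ey (y', 1)) (m y).
  have g1 : @same_germ (T * R)%type (y, 1) (mu_of y Ey) (M (y, 1)).
    by apply: tV.1 => //; rewrite ltr1n.
  have : \forall z \near y, mu_of y Ey (z, 1) - M (y, 1) (z, 1) =
      mu_of y Ey (y, 1) - M (y, 1) (y, 1) by exact: slice_cont _ _ _ g1.
  by apply: filterS => z /=; rewrite /M !F1.
apply: same_germ_eql g.
apply: filterS nV => z Vz; case: pselect => [Ez|/(_ (VE _ Vz))//].
have [nVz _ tVz] := muP z Ez.
by apply: (triv_uniq _ _ _ _ _ z 1 tV tVz Vz (nbhs_singleton nVz)); lra.
Qed.

End Contraction.

(** * Contractions along segments *)

Lemma matrix_continuous (T K : topologicalType) m n (f : T -> 'M[K]_(m, n)) x :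
  (forall i j, {for x, continuous (fun t => f t i j)}) -> {for x, continuous f}.
Proof.
move=> fc A [P fP PA]; rewrite nbhs_filterE.
suff : \forall t \near x, forall i j, P i j (f t i j).
  by apply: filterS => t; exact: PA.
apply: filter_forall => i; apply: filter_forall => j.
exact: fc (fP i j).
Qed.

Lemma row_mx_continuous (T : topologicalType) (K : numFieldType) p k
    (f : T -> 'rV[K]_p) (g : T -> 'rV[K]_k) x :
  {for x, continuous f} -> {for x, continuous g} ->
  {for x, continuous (fun t => row_mx (f t) (g t))}.
Proof.
move=> fc gc; apply: matrix_continuous => i j.
rewrite (_ : (fun t => _) = fun t =>
    match fintype.split j with inl a => f t i a | inr b => g t i b end); last first.
  by apply/funext => t; rewrite mxE.
case: (fintype.split j) => a.
- exact: (continuous_comp fc (@coord_continuous _ _ _ i a (f x))).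
- exact: (continuous_comp gc (@coord_continuous _ _ _ i a (g x))).
Qed.

Lemma nbhs0_ball (R : realType) (V : normedModType R) (P : V -> Prop) :
  (\forall v \near 0, P v) -> exists2 d : R, 0 < d & forall v, `|v| < d -> P v.
Proof.
move=> /nbhs_ballP[d d0 dP]; exists d; first exact: d0.
by move=> v vd; apply: (dP v); rewrite -ball_normE /= sub0r normrN.
Qed.

Lemma mulmxr_cont (R : realType) p q (B : 'M[R]_(p, q)) :
  continuous (fun v : 'rV[R]_p => v *m B).
Proof.
move=> v; apply: matrix_continuous => i j.
rewrite (_ : (fun t => _) = \sum_(l < p)
  (fun t : 'rV[R]_p => t ord0 l * B l j)); last first.
  by apply/funext => t; rewrite mxE fct_sumE; apply: eq_bigr => l _; rewrite ord1.
elim/big_ind: _ => [|f f' fc fc'|l _].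
- exact: (@cst_continuous _ _ (0 : R)).
- exact: continuousD.
- apply: continuousM; last exact: cst_continuous.
  exact: coord_continuous.
Qed.

Section SegmentContraction.
Variables (R : realType) (V : normedModType R).
Implicit Types (E : set V) (x y p : V) (T : V -> V).

Let clamp (s : R) : R := Num.min 1 (Num.max 0 s).

Let clamp_ge0 s : 0 <= clamp s.
Proof. by rewrite /clamp le_min ler01 le_max lexx. Qed.

Let clamp_le1 s : clamp s <= 1.
Proof. by rewrite /clamp ge_min lexx. Qed.

Let clamp_le0 s : s <= 0 -> clamp s = 0.
Proof. by move=> s0; rewrite /clamp (max_idPl s0) (min_idPr ler01). Qed.

Let clamp_ge1 s : 1 <= s -> clamp s = 1.
Proof.
move=> s1; rewrite /clamp (max_idPr (le_trans ler01 s1)).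
by rewrite (min_idPl s1).
Qed.

Let clamp_cont : continuous clamp.
Proof.
move=> s; apply: (@continuous_min _ _ (fun=> 1) (fun s : R => Num.max 0 s)).
  exact: cvg_cst.
apply: (@continuous_max _ _ (fun=> 0) (fun s : R => s)); first exact: cvg_cst.
exact: cvg_id.
Qed.

Definition segment_in E x y := forall t : R, 0 <= t <= 1 -> E (x + t *: (y - x)).

Lemma locally_constant_segment E f x y :
  locally_constant E f -> segment_in E x y -> f x = f y.
Proof.
move=> lcf xy.
have := @locally_constant_line R (fun s => f (x + clamp s *: (y - x))) _ 0 1.
rewrite clamp_le0// clamp_ge1// scale0r addr0 scale1r subrKC; apply => s.
have Es : E (x + clamp s *: (y - x)) by apply: xy; rewrite clamp_ge0 clamp_le1.
have c : {for s, continuous (fun s => x + clamp s *: (y - x))}.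
  apply: continuousD; first exact: cvg_cst.
  by apply: continuousZr_tmp; exact: clamp_cont.
exact: c _ (lcf _ Es).
Qed.

Variables (E : set V) (T : V -> V) (p : V).
Hypothesis oE : open E.
Hypothesis T_cont : forall y, E y -> {for y, continuous T}.
Hypothesis ET : forall y, E y -> segment_in E (T y) y.
Hypothesis Ep : forall y, E y -> segment_in E p (T y).

(** In the first half of the unit interval p moves to T y, in the second half T
y moves to y. *)
Lemma segments_contraction_H1 : H1_trivial E.
Proof.
pose F (q : V * R) := p + clamp (2 * q.2) *: (T q.1 - p) +
  clamp (2 * q.2 - 1) *: (q.1 - T q.1).
apply: (@contraction_H1 R V E p F) => //.
- move=> y s Ey; rewrite /F /=.
  have [s1|s1] := leP (2 * s - 1) 0.
    by rewrite (clamp_le0 s1) scale0r addr0; apply: Ep; rewrite ?clamp_ge0 ?clamp_le1.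
  rewrite (@clamp_ge1 (2 * s)); last by lra.
  by rewrite scale1r subrKC; apply: ET; rewrite ?clamp_ge0 ?clamp_le1.
- move=> y s Ey.
  have c1 : {for (y, s), continuous (fun q : V * R => q.1)} by exact: cvg_fst.
  have c2 : {for (y, s), continuous (fun q : V * R => q.2)} by exact: cvg_snd.
  have cT : {for (y, s), continuous (fun q : V * R => T q.1)}.
    exact: continuous_comp c1 (T_cont Ey).
  have cs c : {for (y, s), continuous (fun q : V * R => clamp (2 * q.2 + c))}.
    apply: (@continuous_comp _ _ _ (fun q : V * R => 2 * q.2 + c) clamp).
      apply: continuousD; last exact: cvg_cst.
      by apply: continuousM => //; exact: cvg_cst.
    exact: clamp_cont.
  apply: continuousD; last by apply: continuousZ; [exact: cs|exact: continuousB].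
  apply: continuousD; first exact: cvg_cst.
  apply: continuousZ; last by apply: continuousB => //; exact: cvg_cst.
  rewrite (_ : (fun q => _) = fun q : V * R => clamp (2 * q.2 + 0)); first exact: cs.
  by apply/funext => q; rewrite addr0.
- move=> y s s0; rewrite /F /=.
  have -> : clamp (2 * s) = 0 by apply: clamp_le0; lra.
  have -> : clamp (2 * s - 1) = 0 by apply: clamp_le0; lra.
  by rewrite !scale0r !addr0.
- move=> y; rewrite /F /=.
  have -> : clamp (2 * 1) = 1 by apply: clamp_ge1; lra.
  have -> : clamp (2 * 1 - 1) = 1 by apply: clamp_ge1; lra.
  by rewrite !scale1r subrKC subrKC.
Qed.

Lemma segments_contraction_H0 : H0_trivial E.
Proof.
move=> f lcf.
suff fp y : E y -> f y = f p by move=> x y /fp -> /fp ->.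
move=> Ey; rewrite -(locally_constant_segment lcf (ET Ey)).
by rewrite (locally_constant_segment lcf (Ep Ey)).
Qed.

End SegmentContraction.

(** * Topology of saddles *)

Lemma convex_norm (R : realType) (V : normedModType R) (r : R) (u w : V) (t : R) :
  0 <= t <= 1 -> `|u| < r -> `|w| < r -> `|u + t *: (w - u)| < r.
Proof.
move=> /andP[t0 t1] ur wr.
rewrite scalerBr addrCA -[X in X - _]scale1r -scalerBl.
apply: le_lt_trans (ler_normD _ _) _; rewrite !normrZ.
rewrite (ger0_norm t0) (@ger0_norm _ (1 - t)) ?subr_ge0//.
apply: (@le_lt_trans _ _ (Num.max `|u| `|w|)); last by rewrite gt_max ur wr.
have hu : `|u| <= Num.max `|u| `|w| by rewrite le_max lexx.
have hw : `|w| <= Num.max `|u| `|w| by rewrite le_max lexx orbT.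
have := ler_wpM2l t0 hw; have := ler_wpM2l (_ : 0 <= 1 - t) hu.
by rewrite subr_ge0 => /(_ t1); lra.
Qed.

Lemma rV_norm_leP (R : realType) n (u : 'rV[R]_n) (e : R) : 0 <= e ->
  `|u| <= e <-> forall j, `|u ord0 j| <= e.
Proof.
move=> e0; rewrite /Num.norm /= mx_normrE; split=> [/bigmax_leP[_ ue] j|ue].
  exact: (ue (ord0, j)).
by apply/bigmax_leP; split=> // -[i j] _; rewrite ord1; exact: ue.
Qed.

Lemma rV_norm_ltP (R : realType) n (u : 'rV[R]_n) (e : R) : 0 < e ->
  `|u| < e <-> forall j, `|u ord0 j| < e.
Proof.
move=> e0; rewrite /Num.norm /= mx_normrE; split=> [/bigmax_ltP[_ ue] j|ue].
  exact: (ue (ord0, j)).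
by apply/bigmax_ltP; split=> // -[i j] _; rewrite ord1; exact: ue.
Qed.

Section Saddle.
Variables (R : realType) (p k : nat) (r : R) (E : set 'rV[R]_(p + k)).
Implicit Types (x y : 'rV[R]_(p + k)) (u w th : 'rV[R]_p).

(** The shape of the part of a ball where a function exceeds its value at a
nondegenerate critical point, the coordinates being u = lsubmx x in the
positive directions and v = rsubmx x in the negative ones: it retracts along v
onto the punctured ball v = 0. *)
Definition saddle :=
  [/\ 0 < r, open E, forall x, E x -> lsubmx x != 0 /\ `|lsubmx x| < r,
      forall x (t : R), E x -> 0 <= t <= 1 ->
        E (row_mx (lsubmx x) (t *: rsubmx x)) &
      forall u, u != 0 -> `|u| < r -> E (row_mx u 0)].

(** For a unit vector th, the half line of the u that are multiples of - th is
removed. *)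
Definition slit th : set 'rV[R]_(p + k) :=
  E `&` [set x | lsubmx x + `|lsubmx x| *: th != 0].

Hypothesis sE : saddle.

Let flat x : 'rV[R]_(p + k) := row_mx (lsubmx x) 0.

Let flat_cont : continuous flat.
Proof.
move=> x; apply: (@row_mx_continuous _ _ _ _ lsubmx (fun=> 0)).
  exact: continuous_lsubmx.
exact: cst_continuous.
Qed.

Let to_flat x (t : R) :
  flat x + t *: (x - flat x) = row_mx (lsubmx x) (t *: rsubmx x).
Proof.
have -> : x - flat x = row_mx 0 (rsubmx x).
  by rewrite -{1}[x]hsubmxK /flat opp_row_mx add_row_mx subrr oppr0 addr0.
by rewrite scale_row_mx add_row_mx scaler0 addr0 add0r.
Qed.

Let flat_segment u w (t : R) :
  row_mx u 0 + t *: (row_mx w 0 - row_mx u 0) =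
  row_mx (u + t *: (w - u)) 0 :> 'rV[R]_(p + k).
Proof.
by rewrite opp_row_mx add_row_mx scale_row_mx add_row_mx oppr0 addr0 scaler0 addr0.
Qed.

Lemma flat_in_saddle x : E x -> segment_in E (flat x) x.
Proof. by case: sE => _ _ _ Et _ Ex t t01; rewrite to_flat; exact: Et. Qed.

Lemma slit_open th : open (slit th).
Proof.
case: sE => _ oE _ _ _; apply: openI => //.
rewrite (_ : [set x | _] = (fun x => lsubmx x + `|lsubmx x| *: th) @^-1` [set~ 0]).
  apply: open_comp; last by apply/closed_openC/accessible_closed_set1/hausdorff_accessible/norm_hausdorff.
  move=> x _; apply: continuousD; first exact: continuous_lsubmx.
  apply: continuousZr_tmp.
  exact: (continuous_comp (@continuous_lsubmx _ _ _ _ x) (@norm_continuous _ _ _)).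
by apply/seteqP; split=> x /= /eqP.
Qed.

(** A slit saddle is contractible: once v is brought to 0, the removed half
line is not met by the segments from a point of the opposite half line to the
points outside it. *)
Lemma slit_segments th (c := (r / 2) *: th) : `|th| = 1 ->
  (forall x, slit th x -> segment_in (slit th) (flat x) x) /\
  (forall x, slit th x -> segment_in (slit th) (row_mx c 0) (flat x)).
Proof.
move=> th1; case: sE => r0 oE Eu Et E0; split=> x [Ex xth] t t01.
  by split; [exact: flat_in_saddle | rewrite to_flat /= row_mxKl].
rewrite flat_segment; set u := _ + _.
have [t0 t1] := andP t01.
have uth : u + `|u| *: th != 0.
  apply: contra_neq xth => uth.
  have e : t *: lsubmx x = - (`|u| + (1 - t) * (r / 2)) *: th.
    have : t *: lsubmx x = u - (1 - t) *: c.
      apply/esym/eqP; rewrite subr_eq /u scalerBr scalerBl scale1r.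
      by rewrite addrCA.
    move: uth => /eqP; rewrite addr_eq0 => /eqP ueq ->; rewrite {1}ueq.
    by rewrite /c scalerA scaleNr scalerDl opprD.
  set q := _ + _ in e.
  have q0 : 0 <= q by rewrite addr_ge0// mulr_ge0 ?subr_ge0// divr_ge0// ltW.
  have tn : t * `|lsubmx x| = q.
    have : `|t *: lsubmx x| = q by rewrite e normrZ th1 mulr1 normrN ger0_norm.
    by rewrite normrZ (ger0_norm t0).
  have t_neq0 : t != 0.
    apply: contra_neqN (lt0r_neq0 r0) => /eqP tz; rewrite tz mul0r in tn.
    have : 0 <= `|u| by []. 
    move: tn; rewrite /q tz subr0 mul1r => *; lra.
  apply: (scalerI t_neq0); rewrite scaler0 scalerDr e scalerA tn.
  by rewrite scaleNr addNr.
split; last by rewrite /= row_mxKl.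
apply: E0; first by apply: contra_neq uth => ->; rewrite normr0 scale0r addr0.
apply: convex_norm => //; last by have [] := Eu _ Ex.
rewrite normrZ th1 mulr1 ger0_norm ?divr_ge0 ?ltW//; lra.
Qed.

Lemma slit_H1 th : `|th| = 1 -> H1_trivial (slit th).
Proof.
move=> /slit_segments[s1 s2].
by apply: segments_contraction_H1 s1 s2; [exact: slit_open | move=> y _; exact: flat_cont].
Qed.

Lemma slit_H0 th : `|th| = 1 -> H0_trivial (slit th).
Proof. by move=> /slit_segments[s1 s2]; apply: segments_contraction_H0 s1 s2. Qed.

Lemma slit_cover th : `|th| = 1 -> slit th `|` slit (- th) = E.
Proof.
move=> th1; case: sE => r0 oE Eu Et E0.
apply/seteqP; split=> x; first by case=> -[].
move=> Ex; have [x0 _] := Eu _ Ex.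
have [xth|xth] := eqVneq (lsubmx x + `|lsubmx x| *: th) 0; last by left.
right; split=> //=; apply: contra_neq x0; rewrite scalerN => xth'.
have : (lsubmx x + `|lsubmx x| *: th) + (lsubmx x - `|lsubmx x| *: th) = 0.
  by rewrite xth xth' addr0.
rewrite addrACA subrr addr0 -mulr2n -scaler_nat => /eqP.
by rewrite scaler_eq0 pnatr_eq0 => /eqP.
Qed.

Lemma slit_inter th x : `|th| = 1 ->
  (slit th `&` slit (- th)) x <-> E x /\ ~~ (lsubmx x <= th)%MS.
Proof.
move=> th1; split=> [[[Ex x1] [_ x2]]|[Ex xth]].
  split=> //; apply/negP => /sub_rVP[a xa]; move: x1 x2 => /=.
  rewrite xa normrZ th1 mulr1 scalerN.
  have [a0|a0] := leP 0 a => x1 x2.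
    by move: x2; rewrite ger0_norm// subrr eqxx.
  by move: x1; rewrite ltr0_norm// scaleNr subrr eqxx.
split; split=> //=; apply: contra xth.
  by rewrite addr_eq0 -scaleNr => /eqP ->; apply: scalemx_sub.
by rewrite scalerN subr_eq0 => /eqP ->; apply: scalemx_sub.
Qed.

(** Both points are first brought to v = 0, where they are joined by a segment.
*)
Lemma saddle_segment f (B : set 'rV[R]_(p + k)) x y :
  locally_constant B f -> E x -> E y ->
  (forall x (t : R), E x -> 0 <= t <= 1 ->
     B x -> B (row_mx (lsubmx x) (t *: rsubmx x))) ->
  B x -> B y ->
  (forall t : R, 0 <= t <= 1 ->
     B (row_mx (lsubmx x + t *: (lsubmx y - lsubmx x)) 0)) ->
  f x = f y.
Proof.
move=> lcf Ex Ey Bt Bx By Bxy.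
have flatE z : E z -> B z -> f (flat z) = f z.
  move=> Ez Bz; apply: locally_constant_segment lcf _ => t t01.
  by rewrite to_flat; exact: Bt.
rewrite -(flatE x)// -(flatE y)//.
by apply: locally_constant_segment lcf _ => t t01; rewrite flat_segment; exact: Bxy.
Qed.

End Saddle.

Section SimplyConnectedSaddle.
Variables (R : realType) (p k : nat) (r : R) (E : set 'rV[R]_(p + k)).
Hypotheses (sE : saddle r E) (p3 : (3 <= p)%N).

Let outside (m : nat) (A : 'M[R]_(m, p)) : (m < p)%N ->
  exists2 w : 'rV[R]_p, ~~ (w <= A)%MS & `|w| < r.
Proof.
move=> mp; have [w wA] : exists w : 'rV[R]_p, ~~ (w <= A)%MS.
  apply: contrapT => /forallNP allA.
  have : (1%:M <= A)%MS.
    by apply/row_subP => i; apply: contrapT => /negP; exact: allA.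
  move=> /mxrankS; rewrite mxrank1 => pA.
  by have := leq_trans pA (rank_leq_row A); rewrite leqNgt mp.
have r0 : 0 < r by case: sE.
have w0 : 0 < `|w| by rewrite normr_gt0; apply: contraNneq wA => ->; exact: sub0mx.
have c0 : 0 < r / 2 / `|w| by rewrite !divr_gt0.
exists ((r / 2 / `|w|) *: w); first by rewrite eqmx_scale// gt_eqF.
by rewrite normrZ gtr0_norm// divfK ?gt_eqF//; lra.
Qed.

Variable th : 'rV[R]_p.
Hypothesis th1 : `|th| = 1.

Let I := slit E th `&` slit E (- th).

Let IE x : I x <-> E x /\ ~~ (lsubmx x <= th)%MS.
Proof. exact: slit_inter. Qed.

(** A line does not separate a space of dimension at least three: two points
off the line are joined through a third one in general position. *)
Let I_H0 : H0_trivial I.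
Proof.
have [r0 oE Eu Et E0] := sE.
move=> f lcf.
have step x y : I x -> I y -> ~~ (lsubmx y <= col_mx th (lsubmx x))%MS ->
    f x = f y.
  move=> Ix Iy xy; have [Ex xth] := (IE x).1 Ix; have [Ey yth] := (IE y).1 Iy.
  apply: (saddle_segment lcf Ex Ey) => //.
    move=> z t Ez t01 /IE[_ zth]; apply/IE; split; first exact: Et.
    by rewrite row_mxKl.
  move=> t t01; set u := _ + _.
  have uth : ~~ (u <= th)%MS.
    have [t0|t0] := eqVneq t 0; first by rewrite /u t0 scale0r addr0.
    apply: contra xy => uth.
    rewrite -(eqmx_scale _ t0).
    have -> : t *: lsubmx y = u - (1 - t) *: lsubmx x.
      apply/esym/eqP; rewrite subr_eq /u scalerBr scalerBl scale1r.
      by rewrite addrCA.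
    have th_le : (th <= col_mx th (lsubmx x))%MS by rewrite -addsmxE addsmxSl.
    have x_le : (lsubmx x <= col_mx th (lsubmx x))%MS by rewrite -addsmxE addsmxSr.
    by rewrite addmx_sub ?(submx_trans uth)// -scaleNr scalemx_sub.
  apply/IE; rewrite row_mxKl; split=> //; apply: E0.
    by apply: contraNneq uth => ->; exact: sub0mx.
  by have := @convex_norm R _ r (lsubmx x) (lsubmx y) t t01 (Eu _ Ex).2 (Eu _ Ey).2.
move=> x y Ix Iy; have [Ex xth] := (IE x).1 Ix; have [Ey yth] := (IE y).1 Iy.
have [yx|] := boolP (lsubmx y <= col_mx th (lsubmx x))%MS; last exact: step.
have [w wx wr] := outside (col_mx th (lsubmx x)) p3.
have wth : ~~ (w <= th)%MS.
  by apply: contra wx => /submx_trans; apply; rewrite -addsmxE addsmxSl.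
have Iw : I (row_mx w 0).
  apply/IE; rewrite row_mxKl; split=> //; apply: E0 => //.
  by apply: contraNneq wth => ->; exact: sub0mx.
rewrite (step x (row_mx w 0))// ?row_mxKl// -(step y (row_mx w 0)) ?row_mxKl//.
apply: contra wx => /submx_trans; apply.
by rewrite -addsmxE addsmx_sub yx andbT -addsmxE addsmxSl.
Qed.

(** The saddle is the union of two contractible slit saddles with connected
intersection. *)
Lemma saddle_H1 : H1_trivial E.
Proof.
rewrite -(slit_cover sE th1); apply: (H1_trivialU _ _ _ I_H0).
- exact: (slit_open sE).
- exact: (slit_open sE).
- have [w wth wr] := outside th (ltnW p3).
  exists (row_mx w 0); apply/IE; rewrite row_mxKl; split=> //.
  case: sE => _ _ _ _; apply=> //.
  by apply: contraNneq wth => ->; exact: sub0mx.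
- exact: (slit_H1 sE th1).
- by apply: (slit_H1 sE); rewrite normrN.
Qed.

Lemma saddle_H0 : H0_trivial E.
Proof.
move=> f lcf.
have [w wth wr] := outside th (ltnW p3).
have Iw : I (row_mx w 0).
  apply/IE; rewrite row_mxKl; split=> //.
  case: sE => _ _ _ _; apply=> //.
  by apply: contraNneq wth => ->; exact: sub0mx.
suff fw x : E x -> f x = f (row_mx w 0) by move=> x y /fw -> /fw ->.
rewrite -(slit_cover sE th1) => -[xs|xs].
  by apply: (slit_H0 sE th1) => //; [move=> z [/lcf] | case: Iw].
have th1' : `|- th| = 1 by rewrite normrN.
by apply: (slit_H0 sE th1') => //; [move=> z [/lcf] | case: Iw].
Qed.

End SimplyConnectedSaddle.

Lemma unit_vector (R : realType) p : (0 < p)%N -> exists th : 'rV[R]_p, `|th| = 1.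
Proof.
case: p => // p _; pose v : 'rV[R]_p.+1 := const_mx 1.
have v0 : `|v| != 0.
  rewrite normr_eq0; apply/eqP => /rowP /(_ ord0).
  by rewrite !mxE => /eqP; rewrite oner_eq0.
by exists (`|v|^-1 *: v); rewrite normrZ normfV normr_id mulVf.
Qed.

Section PuncturedPlaneSaddle.
Variables (R : realType) (k : nat) (r : R) (E : set 'rV[R]_(2 + k)).
Hypothesis sE : saddle r E.

Definition e1 : 'rV[R]_2 := delta_mx ord0 ord0.

Lemma norm_e1 : `|e1| = 1.
Proof.
apply/eqP; rewrite eq_le; apply/andP; split.
  by apply/rV_norm_leP => // j; rewrite !mxE; case: (_ && _); rewrite ?normr1 ?normr0.
have /rV_norm_leP := lexx `|e1|.
by move=> /(_ (normr_ge0 _) ord0); rewrite !mxE normr1.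
Qed.

Definition height (x : 'rV[R]_(2 + k)) : R := lsubmx x ord0 ord_max.

Lemma sub_e1 (u : 'rV[R]_2) : (u <= e1)%MS = (u ord0 ord_max == 0).
Proof.
apply/idP/eqP => [/sub_rVP[a ->]|u0]; first by rewrite !mxE mulr0.
apply/sub_rVP; exists (u ord0 ord0); apply/rowP => -[[|[|//]] i]; rewrite !mxE.
  by rewrite mulr1; congr (u _ _); exact: val_inj.
by rewrite mulr0 -u0; congr (u _ _); exact: val_inj.
Qed.

(** The part v = 0 of either side of the hyperplane is a convex half ball. *)
Lemma half_saddle_H0 (s : R) : H0_trivial (E `&` [set x | 0 < s * height x]).
Proof.
have [r0 oE Eu Et E0] := sE.
move=> f lcf x y [Ex x0] [Ey y0].
apply: (saddle_segment lcf Ex Ey) => //.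
  move=> z t Ez t01 [_ z0]; split; first exact: Et.
  by rewrite /height /= row_mxKl.
move=> t t01; set u := _ + _.
have u0 : 0 < s * u ord0 ord_max.
  have coordE (v w : 'rV[R]_2) i :
      (v + t *: (w - v)) ord0 i = (1 - t) * v ord0 i + t * w ord0 i.
    by rewrite !mxE; ring.
  rewrite /u coordE mulrDr mulrCA [s * (t * _)]mulrCA.
  have /andP[t0 t1] := t01.
  have [->|t_neq0] := eqVneq t 0; first by rewrite subr0 mul1r mul0r addr0.
  apply: ltr_wpDl; first by rewrite mulr_ge0 ?subr_ge0// ltW.
  by apply: mulr_gt0 => //; rewrite lt0r t_neq0.
split; last by rewrite /height /= row_mxKl.
apply: E0.
  by apply: contraTneq u0 => ->; rewrite mxE mulr0 ltxx.
exact: (@convex_norm R _ r (lsubmx x) (lsubmx y) t t01 (Eu _ Ex).2 (Eu _ Ey).2).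
Qed.

(** The monodromy of an integer structure around the plane u = 0. *)
Definition has_jump (E : set 'rV[R]_(2 + k)) m (j : int) := exists f g,
  [/\ forall x, slit E e1 x -> same_germ x f (m x),
      forall x, slit E (- e1) x -> same_germ x g (m x),
      forall x, E x -> 0 < height x -> f x = g x + j &
      forall x, E x -> height x < 0 -> f x = g x].

(** The trivialisations on the two slit saddles differ by one constant on each
of the two halves of their intersection; one of the two constants can be
absorbed, and the other one becomes the monodromy. *)
Lemma saddle_jump m : int_structure E m -> exists j, has_jump E m j.
Proof.
move=> mE.
have mE1 th : int_structure (slit E th) m by move=> x [/mE].
have [f fP] := slit_H1 sE norm_e1 (mE1 _).
have [g gP] := slit_H1 sE (etrans (normrN _) norm_e1) (mE1 _).
have inI x : E x -> height x != 0 -> (slit E e1 `&` slit E (- e1)) x.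
  by move=> Ex x0; apply/(slit_inter _ _ norm_e1); rewrite sub_e1.
have lc : locally_constant (slit E e1 `&` slit E (- e1)) (fun x => f x - g x).
  apply: locally_constant_sub => x [/fP xf /gP xg].
  exact: same_germ_trans xf (same_germ_sym xg).
have half s : exists c, forall x, E x -> 0 < s * height x -> f x - g x = c.
  have [[y [Ey y0]]|nE] := pselect (exists x, E x /\ 0 < s * height x); last first.
    by exists 0 => x Ex x0; exfalso; apply: nE; exists x.
  exists (f y - g y) => x Ex x0; apply: (@half_saddle_H0 s (fun x => f x - g x)) => //.
  move=> z [Ez z0]; apply: lc; apply: inI => //.
  by apply: contraTneq z0 => ->; rewrite mulr0 ltxx.
have [a aP] := half 1; have [b bP] := half (-1).
exists (a - b), f, (fun x => g x + b); split=> //.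
- move=> x /gP; apply: same_germ_trans.
  exact: (same_germ_sym (same_germ_addr _ _ _)).
- by move=> x Ex x0; rewrite -(aP x) ?mul1r//; lia.
- by move=> x Ex x0; rewrite -(bP x) ?mulN1r ?oppr_gt0//; lia.
Qed.

Lemma has_jump_sub E' m j : E `<=` E' -> has_jump E' m j -> has_jump E m j.
Proof.
move=> EE' [f [g [fP gP fg_gt fg_lt]]]; exists f, g; split=> x.
- by move=> [/EE' Ex xe]; apply: fP.
- by move=> [/EE' Ex xe]; apply: gP.
- by move=> /EE'; exact: fg_gt.
- by move=> /EE'; exact: fg_lt.
Qed.

(** After subtraction of j times m' the trivialisations on the two slit saddles
agree. *)
Lemma same_jump m m' j : has_jump E m j -> has_jump E m' 1 ->
  exists h, forall x, E x -> same_germ x h (fun w => m x w - j * m' x w).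
Proof.
move=> [f [g [fP gP fg_gt fg_lt]]] [f' [g' [fP' gP' fg_gt' fg_lt']]].
have germB x a b a' b' : same_germ x a b -> same_germ x a' b' ->
    same_germ x (fun w => a w - j * a' w) (fun w => b w - j * b' w).
  apply: filterS2 => w ab ab'.
  have -> : a w - j * a' w - (b w - j * b' w) = (a w - b w) - j * (a' w - b' w).
    by ring.
  by rewrite ab ab'; ring.
have fg x : (slit E e1 `&` slit E (- e1)) x -> f x - j * f' x = g x - j * g' x.
  move=> /(slit_inter _ _ norm_e1)[Ex]; rewrite sub_e1 -/(height x) => x0.
  have [xn|xp|x00] := ltgtP (height x) 0; last by rewrite x00 eqxx in x0.
    by rewrite fg_lt// fg_lt'.
  by rewrite fg_gt// fg_gt'//; ring.
exists (fun x => if x \in slit E e1 then f x - j * f' x else g x - j * g' x) => x Ex.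
have near_slit th : slit E th x -> \forall w \near x, slit E th w.
  by move=> xs; apply: open_nbhs_nbhs; split=> //; exact: (slit_open sE).
have : (slit E e1 `|` slit E (- e1)) x by rewrite (slit_cover sE norm_e1).
case=> xs.
  have := germB _ _ _ _ _ _ (fP _ xs) (fP' _ xs); apply: same_germ_eql.
  apply: filterS (near_slit e1 xs) => w ws.
  by rewrite mem_set.
have := germB _ _ _ _ _ _ (gP _ xs) (gP' _ xs); apply: same_germ_eql.
apply: filterS (near_slit (- e1) xs) => w ws.
by case: ifPn => // /set_mem we; rewrite fg.
Qed.

End PuncturedPlaneSaddle.

Local Open Scope complex_scope.

(** * The complex exponential *)

Section ComplexTopology.
Variable R : realType.
Implicit Types (z w : Cx R) (a b : R).

Lemma norm_real a : `|(a%:C : Cx R)| = `|a|%:C.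
Proof. by rewrite normc_def /= expr0n addr0 sqrtr_sqr. Qed.

Lemma Re_le_norm z : `|complex.Re z|%:C <= `|z| :> Cx R.
Proof. exact: normc_ge_Re. Qed.

Lemma norm_i : `|'i : Cx R| = 1.
Proof. by rewrite normc_def /= expr0n expr1n add0r sqrtr1. Qed.

Lemma Im_le_norm z : `|complex.Im z|%:C <= `|z| :> Cx R.
Proof.
have -> : complex.Im z = - complex.Re (z * 'i) by rewrite ReiNIm opprK.
by rewrite normrN (le_trans (Re_le_norm _))// normrM norm_i mulr1.
Qed.

Lemma norm_le_ReIm z :
  `|z| <= (`|complex.Re z| + `|complex.Im z|)%:C :> Cx R.
Proof.
rewrite {1}[z]complexE rmorphD /= (le_trans (ler_normD _ _))//.
by rewrite normrM norm_i mul1r !norm_real.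
Qed.

Lemma gt0_complexE z : 0 < z -> exists2 a, 0 < a & z = a%:C.
Proof.
by case: z => a b; rewrite ltcE /= => /andP[/eqP-> a0]; exists a.
Qed.

Lemma nbhs_complexP z (A : set (Cx R)) :
  nbhs z A <-> exists2 e : R, 0 < e & forall w, `|z - w| < e%:C -> A w.
Proof.
split=> [/nbhs_ballP[e /gt0_complexE[a a0 ->] eA]|[e e0 eA]].
  by exists a => // w zw; exact: eA.
by apply/nbhs_ballP; exists (e%:C : Cx R) => [|w]; [rewrite /= ltcR|exact: eA].
Qed.

Lemma Re_continuous : continuous (fun z => complex.Re z).
Proof.
move=> z A /nbhs_ballP[e /= e0 eA]; apply/nbhs_complexP; exists e => // w zw.
apply: eA; rewrite /ball /= -raddfB -(ltcR (`|_| : R)).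
exact: le_lt_trans (Re_le_norm _) zw.
Qed.

Lemma Im_continuous : continuous (fun z => complex.Im z).
Proof.
move=> z A /nbhs_ballP[e /= e0 eA]; apply/nbhs_complexP; exists e => // w zw.
apply: eA; rewrite /ball /= -raddfB -(ltcR (`|_| : R)).
exact: le_lt_trans (Im_le_norm _) zw.
Qed.

Lemma complex_continuous (T : topologicalType) (f g : T -> R) x :
  {for x, continuous f} -> {for x, continuous g} ->
  {for x, continuous (fun t => f t +i* g t : Cx R)}.
Proof.
move=> fc gc A /nbhs_complexP[e e0 eA].
have e20 : 0 < e / 2 by rewrite divr_gt0.
have fn : \forall t \near x, `|f x - f t| < e / 2.
  by have /cvgrPdist_lt := fc; apply.
have gn : \forall t \near x, `|g x - g t| < e / 2.
  by have /cvgrPdist_lt := gc; apply.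
apply: filterS2 fn gn => t ft gt; apply: eA.
apply: le_lt_trans (norm_le_ReIm _) _.
by rewrite ltcR /=; lra.
Qed.

Lemma real_complex_continuous : continuous (fun a => a%:C : Cx R).
Proof.
move=> a; apply: (@complex_continuous _ (fun a => a) (fun=> 0)).
  exact: cvg_id.
exact: cst_continuous.
Qed.

End ComplexTopology.

Section ComplexExponential.
Variable R : realType.
Implicit Types (z w : Cx R) (a b : R).

Lemma cexpD z w : cexp (z + w) = cexp z * cexp w.
Proof.
case: z => a b; case: w => c d; rewrite /cexp /=.
rewrite expRD cosD sinD; congr (_ +i* _); ring.
Qed.

Lemma cexp0 : cexp (0 : Cx R) = 1.
Proof. by rewrite /cexp /= expR0 cos0 sin0 mulr1 mulr0. Qed.

Lemma cexp_neq0 z : cexp z != 0.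
Proof.
apply/eqP => z0; have := cexpD z (- z).
by rewrite subrr cexp0 z0 mul0r => /eqP; rewrite oner_eq0.
Qed.

Lemma cexpN z : cexp (- z) = (cexp z)^-1.
Proof.
apply: (mulIf (cexp_neq0 z)).
by rewrite -cexpD addNr cexp0 mulVf// cexp_neq0.
Qed.

Lemma cexp_eq1 z : cexp z = 1 -> complex.Re z = 0 /\ cos (complex.Im z) = 1.
Proof.
case: z => a b; rewrite /cexp /= => -[ea sa].
have ea2 : expR a ^+ 2 = 1.
  have s0 : expR a ^+ 2 * sin b ^+ 2 = 0 by rewrite -exprMn sa expr0n.
  have c1 : expR a ^+ 2 * cos b ^+ 2 = 1 by rewrite -exprMn ea expr1n.
  by rewrite -[LHS]mulr1 -[X in _ * X](cos2Dsin2 b) mulrDr s0 c1 addr0.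
have a0 : expR a = 1.
  move/eqP: ea2; rewrite sqrf_eq1 => /orP[/eqP//|/eqP e].
  by have := expR_gt0 a; rewrite e; lra.
split; last by rewrite a0 mul1r in ea.
by apply: expR_inj; rewrite a0 expR0.
Qed.

(** The cosine is injective on [0, pi]. *)
Lemma cexp_small_eq1 z : cexp z = 1 -> `|z| < 1 -> z = 0.
Proof.
move=> /cexp_eq1[z0 cz] zn.
have zi : `|complex.Im z| < 1.
  by rewrite -ltcR; exact: le_lt_trans (Im_le_norm z) zn.
suff : `|complex.Im z| = 0.
  by move=> /normr0_eq0; case: z z0 {cz zn zi} => a b /= -> ->.
have pi1 : 1 <= pi :> R by have := pi_ge2 R; lra.
apply: (@cos_inj R); rewrite ?in_itv /= ?normr_ge0 ?lexx ?pi_ge0//.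
  by rewrite (le_trans (ltW zi)).
by rewrite cos_norm cz cos0.
Qed.

(** The first order expansion, in the form in which those of the three real
functions that make up the complex exponential are combined. *)
Lemma is_derive_bound (f : R -> R) (d : R) : is_derive (0 : R) (1 : R) f d ->
  forall e : R, 0 < e -> \forall h \near (0 : R), `|f h - f 0 - h * d| <= e * `|h|.
Proof.
move=> [df <-] e e0.
have /cvgrPdist_le/(_ e e0) : (fun h => h^-1 *: (f (h *: 1 + 0) - f 0)) @ 0^'
  --> 'D_1 f 0 by exact: df.
rewrite near_withinE => fe; near=> h.
have [->|h0] := eqVneq h 0; first by rewrite subrr mul0r subrr !normr0 mulr0.
have : h != 0 -> `|'D_1 f 0 - h^-1 *: (f (h *: 1 + 0) - f 0)| <= e.
  by near: h; exact: fe.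
move=> /(_ h0); rewrite addr0 /GRing.scale /= mulr1 => fh.
set D := 'D_1 f 0 in fh *.
have -> : f h - f 0 - h * D = - ((D - h^-1 * (f h - f 0)) * h) by field.
by rewrite normrN normrM ler_wpM2r.
Unshelve. all: by end_near. Qed.

(** The complex derivative of the exponential at the origin is 1. *)
Lemma cexp_bound e : 0 < e ->
  \forall z \near (0 : Cx R), `|cexp z - 1 - z| <= e%:C * `|z|.
Proof.
(* The contributions estimated below add up to at most 11 d times the norm. *)
move=> e0; pose d := Num.min (e / 11) 1.
have d0 : 0 < d by rewrite lt_min divr_gt0//= ltr01.
have de : d <= e / 11 by rewrite ge_min lexx.
have d1 : d <= 1 by rewrite ge_min lexx orbT.
have He : \forall a \near (0 : R), `|expR a - 1 - a| <= d * `|a|.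
  have H := is_derive_expR (0 : R); rewrite expR0 in H.
  by apply: filterS (is_derive_bound H d0) => a; rewrite expR0 mulr1.
have Hc : \forall b \near (0 : R), `|cos b - 1| <= d * `|b|.
  have H := is_derive_cos (0 : R); rewrite sin0 oppr0 in H.
  by apply: filterS (is_derive_bound H d0) => b; rewrite cos0 mulr0 subr0.
have Hs : \forall b \near (0 : R), `|sin b - b| <= d * `|b|.
  have H := is_derive_sin (0 : R); rewrite cos0 in H.
  by apply: filterS (is_derive_bound H d0) => b; rewrite sin0 subr0 mulr1.
have H1 : \forall a \near (0 : R), `|a| <= d.
  apply: filterS (nbhsx_ballx (0 : R) d d0) => a; rewrite /ball /= sub0r normrN.
  exact: ltW.
have nearRe (P : set R) : (\forall a \near (0 : R), P a) ->
    \forall z \near (0 : Cx R), P (complex.Re z).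
  by move=> Pa; exact: (@Re_continuous R 0 P Pa).
have nearIm (P : set R) : (\forall a \near (0 : R), P a) ->
    \forall z \near (0 : Cx R), P (complex.Im z).
  by move=> Pa; exact: (@Im_continuous R 0 P Pa).
near=> z.
have a1 : `|expR (complex.Re z) - 1 - complex.Re z| <= d * `|complex.Re z|.
  by near: z; exact: (nearRe (fun a => `|expR a - 1 - a| <= d * `|a|) He).
have a2 : `|complex.Re z| <= d.
  by near: z; exact: (nearRe (fun a => `|a| <= d) H1).
have b1 : `|cos (complex.Im z) - 1| <= d * `|complex.Im z|.
  by near: z; exact: (nearIm (fun b => `|cos b - 1| <= d * `|b|) Hc).
have b2 : `|sin (complex.Im z) - complex.Im z| <= d * `|complex.Im z|.
  by near: z; exact: (nearIm (fun b => `|sin b - b| <= d * `|b|) Hs).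
have nR := Re_le_norm z; have nI := Im_le_norm z.
have [n nE] : exists n, `|z| = n%:C by eexists; exact: normc_def.
rewrite nE !lecR in nR nI *.
apply: le_trans (norm_le_ReIm _) _; rewrite -rmorphM lecR.
rewrite !raddfB /=.
set a := complex.Re z in a1 a2 nR *; set b := complex.Im z in b1 b2 nI *.
set ea := expR a in a1 *; set ca := cos b in b1 *; set sb := sin b in b2 *.
have ea4 : `|ea| <= 4.
  have -> : ea = (ea - 1 - a) + a + 1 by ring.
  rewrite (le_trans (ler_normD _ _))// (le_trans (lerD (ler_normD _ _) (lexx _)))// normr1.
  have : d * `|a| <= 1 * 1 by apply: ler_pM => //; [exact: ltW|exact: le_trans a2 d1].
  lra.
have t1 : `|ea * ca - 1 - a| <= d * `|a| + 4 * (d * `|b|).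
  have -> : ea * ca - 1 - a = (ea - 1 - a) + ea * (ca - 1) by ring.
  rewrite (le_trans (ler_normD _ _))// lerD// normrM.
  by rewrite ler_pM.
have t2 : `|ea * sb - 0 - b| <= 4 * (d * `|b|) + `|ea - 1| * `|b|.
  have -> : ea * sb - 0 - b = ea * (sb - b) + (ea - 1) * b by ring.
  by rewrite (le_trans (ler_normD _ _))// !normrM lerD// ler_pM.
have t3 : `|ea - 1| <= 2 * d.
  have -> : ea - 1 = (ea - 1 - a) + a by ring.
  rewrite (le_trans (ler_normD _ _))//.
  have : d * `|a| <= d * 1 by apply: ler_pM => //; [exact: ltW|exact: le_trans a2 d1].
  lra.
have t4 : `|ea - 1| * `|b| <= 2 * d * `|b| by rewrite ler_wpM2r.
have nn : 0 <= n by apply: le_trans nR.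
have da : d * `|a| <= d * n by rewrite ler_wpM2l// ltW.
have db : d * `|b| <= d * n by rewrite ler_wpM2l// ltW.
have dn : 11 * (d * n) <= e * n.
  by rewrite mulrA ler_wpM2r//; lra.
have N0 : 0 <= d * n by rewrite mulr_ge0// ltW.
lra.
Unshelve. all: by end_near. Qed.

End ComplexExponential.

(** * Complex logarithms *)

Lemma differentiable_near (K : numFieldType) (V W : normedModType K)
    (f g : V -> W) x :
  (\forall y \near x, f y = g y) -> differentiable g x -> differentiable f x.
Proof.
move=> fg dg; have fgx := nbhs_singleton fg.
have fg0 : \forall h \near (0 : V), (f \o shift x) h = (g \o shift x) h.
  have c : {for (0 : V), continuous (shift x : V -> V)}.
    by apply: continuousD; [exact: cvg_id|exact: cst_continuous].
  by apply: (near_continuous c _ fg); rewrite /shift /= add0r.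
have dfE : f \o shift x = cst (f x) + 'd g x +o_ (0 : V) id.
  apply/eqaddoP => e e0; have /eqaddoP/(_ e e0) := diff_locally dg.
  by rewrite fgx; apply: filterS2 fg0 => h /= fgh; rewrite !fctE /= fgh.
have dc : continuous ('d g x) by exact: diff_continuous.
by apply/diff_locallyP; rewrite (diff_unique dc dfE).
Qed.

Section ComplexLogarithm.
Variable R : realType.
Implicit Types (z w : Cx R) (a b : R).

(** The principal branch, used on the right half plane only. *)
Definition cln w : Cx R :=
  ln (Num.sqrt (complex.Re w ^+ 2 + complex.Im w ^+ 2)) +i*
  atan (complex.Im w / complex.Re w).

Lemma cln1 : cln 1 = 0.
Proof. by rewrite /cln /= expr0n expr1n addr0 sqrtr1 ln1 mul0r atan0. Qed.

Lemma cexp_cln w : 0 < complex.Re w -> cexp (cln w) = w.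
Proof.
case: w => a b /= a0; rewrite /cexp /cln /=.
have n0 : 0 < a ^+ 2 + b ^+ 2 by rewrite ltr_wpDr ?sqr_ge0 ?exprn_gt0.
rewrite lnK ?posrE ?sqrtr_gt0//.
have sE : Num.sqrt (a ^+ 2 + b ^+ 2) = a * Num.sqrt (1 + (b / a) ^+ 2).
  have -> : a ^+ 2 + b ^+ 2 = a ^+ 2 * (1 + (b / a) ^+ 2).
    by field; rewrite gt_eqF.
  by rewrite sqrtrM ?sqr_ge0// sqrtr_sqr gtr0_norm.
have s0 : Num.sqrt (1 + (b / a) ^+ 2) != 0.
  by rewrite gt_eqF// sqrtr_gt0 ltr_wpDr ?sqr_ge0.
have c0 : cos (atan (b / a)) != 0 by rewrite cos_atan invr_eq0.
have -> : sin (atan (b / a)) = b / a * cos (atan (b / a)).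
  by rewrite -{2}(atanK (b / a)) /tan divfK.
rewrite cos_atan sE; set S := Num.sqrt _ in s0 *.
by congr (_ +i* _); field; rewrite ?s0 ?gt_eqF.
Qed.

Lemma cln_continuous w : 0 < complex.Re w -> {for w, continuous cln}.
Proof.
move=> w0; have ReC := @Re_continuous R w; have ImC := @Im_continuous R w.
apply: complex_continuous; last first.
  apply: (@continuous_comp _ _ _ (fun w : Cx R => complex.Im w / complex.Re w) atan).
    apply: continuousM => //; apply: continuousV => //.
    by rewrite gt_eqF.
  exact: continuous_atan.
apply: (@continuous_comp _ _ _
  (fun w : Cx R => Num.sqrt (complex.Re w ^+ 2 + complex.Im w ^+ 2)) (@ln R)).
  apply: (@continuous_comp _ _ _
    (fun w : Cx R => complex.Re w ^+ 2 + complex.Im w ^+ 2) Num.sqrt).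
    by apply: continuousD; apply: continuousM.
  exact: sqrt_continuous.
apply: continuous_ln; rewrite sqrtr_gt0 ltr_wpDr ?sqr_ge0 ?exprn_gt0//.
Qed.

(** With h = cln w the expansion of the exponential at the origin compares w -
1 with h; this gives derivative 1 to its inverse. *)
Lemma cln_differentiable1 : differentiable cln (1 : Cx R).
Proof.
apply/derivable1_diffP; apply/cvg_ex; exists 1.
have pos1 : \forall w \near (1 : Cx R), 0 < complex.Re w.
  exact: (@Re_continuous R 1 _ (lt_nbhsr (ltr01 : 0 < complex.Re (1 : Cx R)))).
apply/cvgrPdist_le => e /gt0_complexE[a a0 ->].
pose d := Num.min (a / 2) (1 / 2).
have d0 : 0 < d by rewrite lt_min !divr_gt0.
have da : d <= a / 2 by rewrite ge_min lexx.
have d1 : d <= 1 / 2 by rewrite ge_min lexx orbT.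
have sh : {for (0 : Cx R), continuous (fun h : Cx R => h *: 1 + 1 : Cx R)}.
  apply: continuousD; last exact: cst_continuous.
  by apply: continuousM; [exact: cvg_id|exact: cst_continuous].
have sh0 : (0 : Cx R) *: 1 + 1 = 1 :> Cx R by rewrite scale0r add0r.
have n1 : \forall h \near (0 : Cx R), 0 < complex.Re (h *: 1 + 1 : Cx R).
  exact: near_continuous sh sh0 pos1.
have n2 : \forall h \near (0 : Cx R),
    `|cexp (cln (h *: 1 + 1)) - 1 - cln (h *: 1 + 1)| <=
    d%:C * `|cln (h *: 1 + 1)|.
  apply: (near_continuous (P := fun w => `|cexp (cln w) - 1 - cln w| <=
    d%:C * `|cln w|) sh sh0).
  have c1 : {for (1 : Cx R), continuous cln} by apply: cln_continuous; exact: ltr01.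
  exact: (near_continuous c1 cln1 (cexp_bound d0)).
rewrite near_withinE; apply: filterS2 n1 n2 => h h0 hd hn0.
rewrite cexp_cln// in hd; rewrite cln1 subr0.
set L := cln _ in hd *.
have {}hd : `|h - L| <= d%:C * `|L|.
  by move: hd; rewrite /GRing.scale /= mulr1 addrK.
have [l lE] : exists l, `|L| = l%:C by eexists; exact: normc_def.
have [k kE] : exists k, `|h| = k%:C by eexists; exact: normc_def.
have k0 : 0 < k by rewrite -ltcR -kE normr_gt0.
have hL : `|L| <= `|h| + `|h - L|.
  have LE : L = h - (h - L) by ring.
  by have := ler_normB h (h - L); rewrite -LE.
have [m mE] : exists m, `|h - L| = m%:C by eexists; exact: normc_def.
have md : m <= d * l by rewrite -lecR rmorphM /= -mE -lE.
have lk : l <= k + m by rewrite -lecR rmorphD /= -mE -lE -kE.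
have l0 : 0 <= l by rewrite -lecR -lE normr_ge0.
have l2 : l <= 2 * k.
  have : d * l <= 1 / 2 * l by rewrite ler_wpM2r.
  lra.
have -> : 1 - h^-1 *: L = h^-1 * (h - L) by rewrite mulrBr mulVf.
rewrite normrM normfV kE mE -fmorphV -rmorphM lecR.
rewrite mulrC ler_pdivrMr//.
have : d * l <= d * (2 * k) by rewrite ler_wpM2l// ltW.
have : d * (2 * k) <= a / 2 * (2 * k) by rewrite ler_wpM2r// mulr_ge0// ltW.
lra.
Qed.

Definition twopii : Cx R := (0 : R) +i* (2%:R * pi).
Definition expi z : Cx R := cexp (twopii * z).

Lemma twopii_neq0 : twopii != 0.
Proof.
rewrite eq_complex /= eqxx /= mulf_neq0 ?pnatr_eq0//.
by rewrite gt_eqF// pi_gt0.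
Qed.

Lemma expiD z w : expi (z + w) = expi z * expi w.
Proof. by rewrite /expi mulrDr cexpD. Qed.

Lemma expi0 : expi 0 = 1.
Proof. by rewrite /expi mulr0 cexp0. Qed.

Lemma expiN z : expi (- z) = (expi z)^-1.
Proof. by rewrite /expi mulrN cexpN. Qed.

Lemma expiB z w : expi (z - w) = expi z / expi w.
Proof. by rewrite expiD expiN. Qed.

Lemma expi_neq0 z : expi z != 0.
Proof. exact: cexp_neq0. Qed.

Lemma expi_real a : expi (a%:C) = cos (2 * pi * a) +i* sin (2 * pi * a).
Proof. by rewrite /expi /cexp /= !mul0r !mulr0 subr0 expR0 !mul1r add0r. Qed.

Lemma expi_int (k : int) : expi (k%:~R) = 1.
Proof.
have e1 : expi 1 = 1.
  have -> : 1 = (1 : R)%:C :> Cx R by [].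
  have s2 : sin (pi *+ 2) = 0 :> R by rewrite -[pi *+ 2]add0r sinD2pi sin0.
  by rewrite expi_real mulr1 mulr_natl cos2pi s2.
have en (n : nat) : expi n%:R = 1.
  by elim: n => [|n IHn]; rewrite ?expi0// -natr1 expiD IHn e1 mulr1.
by case: k => n; [exact: en | rewrite NegzE mulrNz expiN en invr1].
Qed.

Lemma expi_eq1 z : expi z = 1 -> exists k : int, z = k%:~R.
Proof.
case: z => a b /cexp_eq1[] /=; rewrite mul0r sub0r => /eqP.
rewrite oppr_eq0 mulf_eq0 [_ == 0]gt_eqF ?mulr_gt0 ?pi_gt0//= => /eqP ->.
rewrite mul0r add0r => ca.
pose k := Num.floor a; pose f := a - k%:~R.
have f0 : 0 <= f by rewrite subr_ge0 floor_le_tmp.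
have f1 : f < 1 by rewrite ltrBlDr addrC -intrD1 floorD1_gt.
have cf : cos (2 * pi * f) = 1.
  have : complex.Re (expi (a%:C - k%:~R)) = 1.
    by rewrite expiB expi_int divr1 expi_real.
  by rewrite -[k%:~R]/(k%:~R : Cx R) -(rmorph_int (real_complex R)) -rmorphB expi_real.
have p0 := pi_gt0 R.
have inj g : 0 <= g -> g <= 1 / 2 -> cos (2 * pi * g) = 1 -> g = 0.
  move=> g0 g1 cg; have : cos (2 * pi * g) = cos 0 by rewrite cg cos0.
  have hp : 2 * pi * g <= pi.
    have : 0 <= pi * (1 / 2 - g) by rewrite mulr_ge0 ?pi_ge0 ?subr_ge0.
    lra.
  have gp : 0 <= 2 * pi * g by rewrite !mulr_ge0 ?pi_ge0.
  move=> /cos_inj; rewrite !in_itv /= lexx pi_ge0 hp gp => /(_ isT isT) /eqP.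
  by rewrite mulf_eq0 [2 * pi == 0]gt_eqF ?mulr_gt0 ?pi_gt0//= => /eqP.
have f_eq0 : f = 0.
  have [h|h] := leP f (1 / 2); first exact: inj.
  have : 1 - f = 0.
    apply: inj; try lra.
    have -> : 2 * pi * (1 - f) = - (2 * pi * f) + pi *+ 2 by rewrite mulr2n; ring.
    by rewrite cosD2pi cosN.
  lra.
exists k; rewrite -(rmorph_int (real_complex R)).
by congr (_ +i* _); apply/eqP; rewrite -subr_eq0 -/f f_eq0.
Qed.

(** Quarter turns bring every nonzero number to the right half plane. *)
Lemma expi_surj w : w != 0 -> exists z, expi z = w.
Proof.
have half w' : 0 < complex.Re w' -> exists z, expi z = w'.
  move=> /cexp_cln w'E; exists (twopii^-1 * cln w').
  by rewrite /expi mulrA mulfV ?twopii_neq0// mul1r.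
have e4 : expi ((1 / 4)%:C) = 'i.
  rewrite expi_real (_ : 2 * pi * (1 / 4) = pi / 2); last by field.
  by rewrite cos_pihalf sin_pihalf.
have turn w' : (exists z, expi z = w' * 'i) -> exists z, expi z = w'.
  move=> [z zE]; exists (z - (1 / 4)%:C).
  by rewrite expiB e4 zE mulfK// eq_complex /= oner_eq0 andbF.
case: w => a b; rewrite eq_complex /= negb_and => ab.
have [a0|a0|a0] := ltrgtP a 0; last 1 first.
- rewrite a0 eqxx /= in ab; have [b0|b0|b0] := ltrgtP b 0; last by rewrite b0 eqxx in ab.
    by apply: (turn); apply: half; rewrite /= a0 mul0r mulr1 sub0r oppr_gt0.
  by apply: (turn); apply: (turn); apply: (turn); apply: half; rewrite /= a0; lra.
- by apply: (turn); apply: (turn); apply: half; rewrite /=; lra.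
- exact: half.
Qed.

(** Near x the continuous logarithm f is f x plus the fixed branch of the
logarithm of the quotient of exponentials, which is close to 1: the difference
is continuous and takes values in a discrete set. *)
Lemma log_differentiable (V : normedModType (Cx R)) (f : V -> Cx R) x :
  {for x, continuous f} -> differentiable (expi \o f) x -> differentiable f x.
Proof.
move=> fc dF; set F := expi \o f in dF.
have F0 : F x != 0 by exact: expi_neq0.
pose q (y : V) := (F x)^-1 *: (F y : Cx R).
have dq : differentiable (q : V -> Cx R) x by exact: differentiableZ.
have q1 : q x = 1 by rewrite /q /GRing.scale /= mulVf.
have dL : differentiable (cln \o q) x.
  have d1 : differentiable cln (q x) by rewrite q1; exact: cln_differentiable1.
  exact: (differentiable_comp dq d1).
have dg : differentiable ((twopii^-1 *: (cln \o q)) + cst (f x)) x.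
  by apply: differentiableD; [exact: differentiableZ|exact: differentiable_cst].
have fE : \forall y \near x, f y = ((twopii^-1 *: (cln \o q)) + cst (f x)) y.
  have p0 : \forall y \near x, 0 < complex.Re (q y).
    have qc := differentiable_continuous dq.
    apply: (near_continuous qc q1 (P := fun w => 0 < complex.Re w)).
    exact: (@Re_continuous R 1 _ (lt_nbhsr (ltr01 : 0 < complex.Re (1 : Cx R)))).
  have cL : {for x, continuous (cln \o q)} by exact: differentiable_continuous dL.
  have cf : {for x, continuous (fun y => twopii * (f y - f x))}.
    apply: continuousM; first exact: cst_continuous.
    by apply: continuousB; [exact: fc|exact: cst_continuous].
  have c := continuousB cf cL.
  have small : \forall y \near x, `|twopii * (f y - f x) - cln (q y)| < 1.
    have n1 : \forall w \near (0 : Cx R), `|w| < 1.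
      by apply/nbhs_complexP; exists 1 => // w; rewrite sub0r normrN.
    have cx : ((fun y => twopii * (f y - f x)) - (cln \o q)) x = 0.
      by rewrite !fctE /= q1 cln1 subrr mulr0 subr0.
    exact: (near_continuous c cx n1).
  apply: filterS2 p0 small => y py sy.
  rewrite /GRing.add /= /GRing.scale /= -[RHS]/(twopii^-1 * cln (q y) + f x).
  have : twopii * (f y - f x) - cln (q y) = 0.
    apply: cexp_small_eq1 sy; rewrite cexpD cexpN cexp_cln//.
    rewrite -[cexp (twopii * _)]/(expi _) expiB /q /GRing.scale /=.
    by rewrite mulrC -[expi (f y)]/(F y) -[expi (f x)]/(F x) [F y / _]mulrC mulVf// mulf_neq0 ?invr_eq0// expi_neq0.
  move=> /eqP; rewrite subr_eq0 => /eqP <-.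
  by rewrite mulrA mulVf ?twopii_neq0// mul1r subrK.
exact: differentiable_near fE dg.
Qed.

End ComplexLogarithm.

(** * Germs of holomorphic functions *)

Section LocalLogarithm.
Variables (R : realType) (T : topologicalType).

(** Division by the value at x brings the nearby values to the right half
plane. *)
Lemma local_log (phi : T -> Cx R) x : phi x != 0 -> {for x, continuous phi} ->
  exists S : T -> Cx R, \forall y \near x, expi (S y) = phi y /\
    ({for y, continuous phi} -> {for y, continuous S}).
Proof.
move=> phi0 phic; have [s0 s0E] := expi_surj phi0.
pose q y := phi y / phi x.
have qc y : {for y, continuous phi} -> {for y, continuous q}.
  by move=> c; apply: continuousM; [exact: c|exact: cst_continuous].
have qx : q x = 1 by rewrite /q divff.
have pos : \forall y \near x, 0 < complex.Re (q y).
  have n1 : \forall w \near (1 : Cx R), 0 < complex.Re w.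
    exact: (@Re_continuous R 1 _ (lt_nbhsr (ltr01 : 0 < complex.Re (1 : Cx R)))).
  exact: (near_continuous (qc x phic) qx n1).
exists (fun y => s0 + (twopii R)^-1 * cln (q y)).
apply: filterS pos => y y0; split.
  rewrite expiD s0E /expi mulrA mulfV ?twopii_neq0// mul1r cexp_cln//.
  by rewrite /q mulrC divfK.
move=> c; apply: continuousD; first exact: cst_continuous.
apply: continuousM; first exact: cst_continuous.
exact: (continuous_comp (qc _ c) (cln_continuous y0)).
Qed.

Lemma int_continuous (k : T -> int) x :
  {for x, continuous (fun y => (k y)%:~R : Cx R)} -> \forall y \near x, k y = k x.
Proof.
move=> kc; have : \forall w \near ((k x)%:~R : Cx R), `|(k x)%:~R - w| < 1.
  by apply/nbhs_complexP; exists 1.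
move=> /(near_continuous kc erefl); apply: filterS => y.
rewrite -rmorphB /= -(rmorph_int (real_complex R)) norm_real ltcR -intr_norm.
by rewrite ltrz1 => ky; apply/eqP; rewrite eq_sym -subr_eq0 -normr_eq0; lia.
Qed.

End LocalLogarithm.

Section HolomorphicGerms.
Variables (R : realType) (n : nat) (X : chartedSpace R n).
Implicit Types (f g : X -> Cx R) (x y : X) (a : chart R n X).

Lemma cmap_continuous a x : cdom a x -> {for x, continuous (cmap a)}.
Proof.
move=> ax; have := @cmap_cont _ _ _ a; rewrite (continuous_open_subspace _ (@cdom_open _ _ _ a)).
by apply; rewrite inE.
Qed.

Lemma cinv_continuous a z : (cmap a @` cdom a) z -> {for z, continuous (cinv a)}.
Proof.
move=> az; have := @cinv_cont _ _ _ a.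
by rewrite (continuous_open_subspace _ (@crng_open _ _ _ a)); apply; rewrite inE.
Qed.

Lemma cinv_continuous_at a x : cdom a x -> {for cmap a x, continuous (cinv a)}.
Proof. by move=> ax; apply: cinv_continuous; exists x. Qed.

Lemma near_cdom a x : cdom a x -> \forall y \near x, cdom a y.
Proof. by apply: near_open; exact: cdom_open. Qed.

Definition holomorphic_at f x := forall a, atlas a -> cdom a x ->
  differentiable (f \o cinv a) (cmap a x).

Definition hol_germ f x := \forall y \near x, holomorphic_at f y.

Lemma holomorphicE (W : set X) f : open W ->
  holomorphic W f <-> forall x, W x -> hol_germ f x.
Proof.
move=> oW; split=> [fW x Wx|fW x a Wx].
  by apply: filterS (near_open oW Wx) => y Wy a; exact: fW.
exact: (nbhs_singleton (fW _ Wx)).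
Qed.

Lemma holomorphic_at_near f g x :
  (\forall y \near x, f y = g y) -> holomorphic_at g x -> holomorphic_at f x.
Proof.
move=> fg gx a aA ax; apply: differentiable_near (gx a aA ax).
exact: (near_continuous (cinv_continuous_at ax) (cmapK ax) fg).
Qed.

Lemma holomorphic_at_continuous f x : holomorphic_at f x -> {for x, continuous f}.
Proof.
move=> fx; have [a aA ax] := atlas_cover x.
have fc := differentiable_continuous (fx a aA ax).
have c : {for x, continuous ((f \o cinv a) \o cmap a)}.
  exact: (continuous_comp (cmap_continuous ax) fc).
have e : ((f \o cinv a) \o cmap a) x = f x by rewrite /= cmapK.
move=> B fB; have cB := near_continuous c e fB.
by apply: filterS2 (near_cdom ax) cB => y ay /=; rewrite cmapK.
Qed.

Lemma hol_germ_near f g x :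
  (\forall y \near x, f y = g y) -> hol_germ g x -> hol_germ f x.
Proof.
by move=> /near_join; apply: filterS2 => y; exact: holomorphic_at_near.
Qed.

Lemma near_hol_germ f x : hol_germ f x -> \forall y \near x, hol_germ f y.
Proof. exact: near_join. Qed.

Lemma hol_germ_continuous f x : hol_germ f x -> {for x, continuous f}.
Proof. by move=> /nbhs_singleton; exact: holomorphic_at_continuous. Qed.

Lemma hol_germ_cst (c : Cx R) x : hol_germ (fun=> c) x.
Proof. by apply: nearW => y a _ _; exact: differentiable_cst. Qed.

Lemma hol_germD f g x :
  hol_germ f x -> hol_germ g x -> hol_germ (fun y => f y + g y) x.
Proof.
apply: filterS2 => y fy gy a aA ay.
exact: (differentiableD (fy a aA ay) (gy a aA ay)).
Qed.

Lemma hol_germN f x : hol_germ f x -> hol_germ (fun y => - f y) x.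
Proof. by apply: filterS => y fy a aA ay; exact: (differentiableN (fy a aA ay)). Qed.

Lemma hol_germB f g x :
  hol_germ f x -> hol_germ g x -> hol_germ (fun y => f y - g y) x.
Proof. by move=> fx gx; apply: hol_germD => //; exact: hol_germN. Qed.

Lemma hol_germM f g x :
  hol_germ f x -> hol_germ g x -> hol_germ (fun y => f y * g y) x.
Proof.
apply: filterS2 => y fy gy a aA ay.
exact: (differentiableM (fy a aA ay) (gy a aA ay)).
Qed.

Lemma hol_germV f x : f x != 0 -> hol_germ f x -> hol_germ (fun y => (f y)^-1) x.
Proof.
move=> fx0 fx; have n0 : \forall y \near x, f y != 0.
  apply: (near_continuous (hol_germ_continuous fx) erefl (P := fun w => w != 0)).
  apply/nbhs_complexP; have [k kE] : exists k, `|f x| = k%:C.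
    by eexists; exact: normc_def.
  exists k => [|w]; first by rewrite -ltcR -kE normr_gt0.
  by rewrite -kE => h; apply: contraTneq h => ->; rewrite subr0 ltxx.
apply: filterS2 n0 fx => y y0 fy a aA ay.
have fy0 : (f \o cinv a) (cmap a y) != 0 by rewrite /= cmapK.
exact: (differentiableV (fy a aA ay) fy0).
Qed.

Lemma hol_germ_log f x : (\forall y \near x, {for y, continuous f}) ->
  hol_germ (fun y => expi (f y)) x -> hol_germ f x.
Proof.
apply: filterS2 => y fc ef a aA ay; apply: log_differentiable; last exact: ef.
apply: (continuous_comp (cinv_continuous_at ay)); rewrite cmapK//.
Qed.

(** The continuous local logarithm is holomorphic because its exponential is.
*)
Lemma hol_local_log f x : f x != 0 -> hol_germ f x ->
  exists2 S, hol_germ S x & \forall y \near x, expi (S y) = f y.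
Proof.
move=> f0 fx; have [S SP] := local_log f0 (hol_germ_continuous fx).
exists S; last by apply: filterS SP => y [].
apply: hol_germ_log.
  apply: filterS2 SP fx => y [_ Sc] fy; apply: Sc.
  exact: holomorphic_at_continuous.
by apply: hol_germ_near fx; apply: filterS SP => y [].
Qed.

Lemma hol_germ_int (k : X -> int) x :
  hol_germ (fun y => (k y)%:~R) x -> \forall y \near x, k y = k x.
Proof. by move=> /hol_germ_continuous; exact: int_continuous. Qed.

(** Equality in the quotient of the sheaf of all functions by O. *)
Definition hol_eq x f g := hol_germ (fun y => f y - g y) x.

Lemma hol_eq_refl x f : hol_eq x f f.
Proof.
by apply: hol_germ_near (hol_germ_cst 0 x); apply: nearW => y; rewrite subrr.
Qed.

Lemma hol_eq_sym x f g : hol_eq x f g -> hol_eq x g f.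
Proof.
move=> /hol_germN; apply: hol_germ_near; apply: nearW => y.
by rewrite opprB.
Qed.

Lemma hol_eq_trans x f g h : hol_eq x f g -> hol_eq x g h -> hol_eq x f h.
Proof.
move=> fg gh; apply: hol_germ_near (hol_germD fg gh).
by apply: nearW => y; rewrite addrA subrK.
Qed.

Lemma near_hol_eq x f g : hol_eq x f g -> \forall y \near x, hol_eq y f g.
Proof. exact: near_hol_germ. Qed.

End HolomorphicGerms.

(** * Gluing over compact sets *)

Section CompactInduction.
Variable T : topologicalType.
Implicit Types (K A B : set T) (P : set T -> Prop).

(** Otherwise the complements of the sets with the property would generate a
proper filter on K without cluster point. *)
Lemma compact_local_property K P : compact K ->
  (forall A B, A `<=` B -> P B -> P A) -> P set0 ->
  (forall A B, P A -> P B -> P (A `|` B)) ->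
  (forall x, K x -> exists2 V, nbhs x V & P V) -> P K.
Proof.
move=> cK Psub P0 PU Ploc.
pose F := [set A | exists2 B, P B & K `\` B `<=` A].
have FF : Filter F.
  split; first by exists set0.
  - move=> A A' [B PB BA] [B' PB' BA']; exists (B `|` B'); first exact: PU.
    by move=> x [Kx /not_orP[Bx B'x]]; split; [exact: BA|exact: BA'].
  - by move=> A A' AA' [B PB BA]; exists B => //; exact: subset_trans AA'.
have [[B PB KB]|F0] := pselect (F set0).
  apply: Psub PB => x Kx; apply: contrapT => Bx; exact: (KB x).
have PF : ProperFilter F by split.
have [x [Kx clx]] : K `&` cluster F !=set0.
  by apply: cK; exists set0 => // x [].
have [V nV PV] := Ploc x Kx.
have [] := clx (K `\` V) V _ nV; first by exists V.
by move=> y [[]].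
Qed.

Hypothesis hT : hausdorff_space T.

Let separated_by A B := exists OA OB,
  [/\ open OA, open OB, A `<=` OA, B `<=` OB & forall z, OA z -> ~ OB z].

Let separated_sym A B : separated_by A B -> separated_by B A.
Proof.
by move=> [W [W' [oO oO' AO BO' OO']]]; exists W', W; split=> // z zO' /OO'.
Qed.

Let separatedU A B B' :
  separated_by A B -> separated_by A B' -> separated_by A (B `|` B').
Proof.
move=> [W [W' [oO oO' AO BO' OO']]] [Q [Q' [oQ oQ' AQ BQ' QQ']]].
exists (W `&` Q), (W' `|` Q'); split; [exact: openI|exact: openU| | |].
- by move=> x Ax; split; [exact: AO|exact: AQ].
- by move=> x [/BO'|/BQ']; [left|right].
- by move=> z [zO zQ] [/(OO' z zO)|/(QQ' z zQ)].
Qed.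

Let separated_sub A B B' : B `<=` B' -> separated_by A B' -> separated_by A B.
Proof.
move=> BB [W [W' [oO oO' AO BO' OO']]]; exists W, W'; split=> //.
exact: subset_trans BO'.
Qed.

Let separated0 A : separated_by A set0.
Proof.
exists setT, set0; split; [exact: openT|exact: open0|by []|by []|].
by move=> z _ [].
Qed.

Lemma separate_compacts A B : compact A -> compact B ->
  (forall x, A x -> ~ B x) -> separated_by A B.
Proof.
move=> cA cB AB; apply: separated_sym.
apply: (compact_local_property (P := separated_by B) cA) => //.
- by move=> A1 A2; exact: separated_sub.
- by move=> A1 A2; exact: separatedU.
move=> x Ax.
have [W [W' [oO oO' Ox BO' OO']]] : separated_by [set x] B.
  apply: (compact_local_property (P := separated_by [set x]) cB) => //.
  - by move=> A1 A2; exact: separated_sub.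
  - by move=> A1 A2; exact: separatedU.
  move=> y By; have xy : x != y by apply/eqP => xy; apply: (AB x) => //; rewrite xy.
  have := hT; rewrite open_hausdorff => /(_ x y xy)[[W W'] /= [xO yO']].
  move=> [oO oO' /eqP OO']; exists W'.
    by apply: open_nbhs_nbhs; split=> //; exact: set_mem.
  exists W, W'; split=> //; [by move=> _ ->; exact: set_mem|move=> z zO zO'].
  by have : (W `&` W') z by []; rewrite OO'.
exists W; first by apply: open_nbhs_nbhs; split=> //; exact: Ox.
by apply: separated_sym; exists W, W'; split.
Qed.

(** The parts of A and B outside W are disjoint compact sets, which have
disjoint neighbourhoods. *)
Lemma shrink_neighborhoods A B OA OB W : compact A -> compact B ->
  open OA -> open OB -> open W -> A `<=` OA -> B `<=` OB -> A `&` B `<=` W ->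
  exists OA' OB', [/\ open OA', open OB', A `<=` OA' /\ OA' `<=` OA,
    B `<=` OB' /\ OB' `<=` OB & OA' `&` OB' `<=` W].
Proof.
move=> cA cB oOA oOB oO AO BO ABO.
have cD C : compact C -> compact (C `\` W).
  by move=> cC; apply: compact_closedI => //; exact: open_closedC.
have [D [D' [oD oD' AD BD DD]]] : separated_by (A `\` W) (B `\` W).
  apply: separate_compacts; [exact: cD|exact: cD|].
  by move=> x [Ax Ox] [Bx _]; exact/Ox/ABO.
exists (OA `&` (D `|` W)), (OB `&` (D' `|` W)); split.
- by apply: openI => //; exact: openU.
- by apply: openI => //; exact: openU.
- split=> [x Ax|x []//]; split; first exact: AO.
  by have [|Ox] := pselect (W x); [right|left; exact: AD].
- split=> [x Bx|x []//]; split; first exact: BO.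
  by have [|Ox] := pselect (W x); [right|left; exact: BD].
- by move=> x [[_ [xD|//]] [_ [xD'|//]]]; case: (DD x).
Qed.

(** The local property is used on closed neighbourhoods, so that the pieces to
be united are compact. *)
Lemma compact_induction K P : compact K ->
  (forall A B, A `<=` B -> P B -> P A) -> P set0 ->
  (forall A B, compact A -> compact B -> A `<=` K -> B `<=` K ->
     P A -> P B -> P (A `|` B)) ->
  (forall x, K x -> exists2 V, nbhs x V & P (K `&` V)) -> P K.
Proof.
move=> cK Psub P0 PU Ploc.
suff : P (K `&` closure K) by apply: Psub => x Kx; split=> //; exact: subset_closure.
have cI A : compact (K `&` closure A).
  by apply: compact_closedI => //; exact: closed_closure.
apply: (compact_local_property (P := fun A => P (K `&` closure A)) cK).
- by move=> A B AB; apply: Psub => x [Kx xA]; split=> //; exact: closureS xA.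
- by rewrite closure0 setI0.
- move=> A B PA PB; rewrite closureU setIUr.
  by apply: PU PA PB; [exact: cI|exact: cI|move=> x []|move=> x []].
move=> x Kx; have [V nV PV] := Ploc x Kx.
have cKV : compact (K `\` V°).
  by apply: compact_closedI => //; apply: open_closedC; exact: open_interior.
have [W [W' [oO oO' xO VO' OO']]] : separated_by [set x] (K `\` V°).
  apply: separate_compacts => //; first exact: compact_set1.
  by move=> _ -> [_]; apply; exact: nV.
exists W; first by apply: open_nbhs_nbhs; split=> //; exact: xO.
apply: Psub PV => y [Ky yO]; split=> //; apply: contrapT => Vy.
have yO' : W' y by apply: VO'; split=> // /interior_subset.
have [z [zO zO']] := yO W' (near_open oO' yO').
exact: OO' zO zO'.
Qed.

End CompactInduction.

(** * Logarithms of a line bundle *)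

Section Logarithms.
Variables (R : realType) (n : nat) (X : chartedSpace R n) (U : set X).
Variable N : lineBundle U.
Implicit Types (x y : X) (f g : X -> Cx R) (l : lidx N).

Lemma trans_mul i j k x : lcov N i x -> lcov N j x -> lcov N k x ->
  trans N i k x = trans N i j x * trans N j k x.
Proof.
move=> ix jx kx; have [t [_ tu]] := frame_basis ix (frame k x).
rewrite -(tu _ (trans_frame ix kx)); apply: tu.
by rewrite (trans_frame jx kx) (trans_frame ix jx) scalerA mulrC.
Qed.

Lemma trans_refl i x : lcov N i x -> trans N i i x = 1.
Proof.
move=> ix; have [t [_ tu]] := frame_basis ix (frame i x).
rewrite -(tu _ (trans_frame ix ix)); apply: tu.
by rewrite scale1r.
Qed.

Lemma trans_neq0 i j x : lcov N i x -> lcov N j x -> trans N i j x != 0.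
Proof.
move=> ix jx; apply/eqP => t0; have := trans_mul ix jx ix.
by rewrite trans_refl// t0 mul0r => /eqP; rewrite oner_eq0.
Qed.

(** The bundle trivialised set-theoretically: its holomorphic structure is then
recorded by the coordinates of the local frames in a discontinuous global
frame. *)
Definition set_frames (gam : lidx N -> X -> Cx R) :=
  (forall l x, lcov N l x -> gam l x != 0) /\
  (forall l k x, lcov N l x -> lcov N k x -> trans N l k x = gam l x / gam k x).

Variable gam : lidx N -> X -> Cx R.
Hypothesis gamP : set_frames gam.

(** In the discontinuous frame, e^(2 pi i f) is near x a nowhere vanishing
holomorphic section of the bundle. *)
Definition log_section f x :=
  forall l, lcov N l x -> hol_germ (fun y => expi (f y) / gam l y) x.

(** A class in H^1(Z, O) with an identification of its exponential with the
bundle, encoded by one function F x for each point x: the functions are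
arbitrary, only their differences are holomorphic. *)
Definition log_structure (Z : set X) (F : X -> X -> Cx R) := forall x, Z x ->
  log_section (F x) x /\ \forall y \near x, hol_eq y (F x) (F y).

Let gam_neq0 l x : lcov N l x -> gam l x != 0.
Proof. exact: gamP.1. Qed.

Lemma near_lcov l x : lcov N l x -> \forall y \near x, lcov N l y.
Proof. by apply: near_open; exact: lcov_open. Qed.

Lemma gam_ratio_hol l k x : lcov N l x -> lcov N k x ->
  hol_germ (fun y => gam l y / gam k y) x.
Proof.
move=> lx kx; have oI : open (lcov N l `&` lcov N k).
  by apply: openI; exact: lcov_open.
have tx : hol_germ (trans N l k) x.
  exact: ((holomorphicE _ oI).1 (@trans_holo _ _ _ _ N l k) x (conj lx kx)).
apply: hol_germ_near tx; apply: filterS2 (near_lcov lx) (near_lcov kx) => y ly ky.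
by rewrite gamP.2.
Qed.

Lemma log_section_one f x l : lcov N l x ->
  hol_germ (fun y => expi (f y) / gam l y) x -> log_section f x.
Proof.
move=> lx fx k kx; apply: hol_germ_near (hol_germM fx (gam_ratio_hol lx kx)).
apply: filterS (near_lcov lx) => y ly.
by rewrite mulrA mulfVK ?gam_neq0.
Qed.

Lemma log_section_ratio f g x : U x -> log_section f x -> log_section g x ->
  hol_germ (fun y => expi (f y - g y)) x.
Proof.
rewrite -(lcov_cover N) => -[l _ lx] /(_ l lx) fx /(_ l lx) gx.
have q0 : expi (g x) / gam l x != 0.
  by rewrite mulf_neq0 ?invr_eq0 ?expi_neq0 ?gam_neq0.
apply: hol_germ_near (hol_germM fx (hol_germV q0 gx)).
apply: filterS (near_lcov lx) => y ly.
have e0 := expi_neq0 (g y); have g0 := gam_neq0 ly.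
by rewrite expiB; field; rewrite e0 g0.
Qed.

Lemma log_section_int f (k : X -> int) x :
  log_section f x -> log_section (fun y => f y + (k y)%:~R) x.
Proof.
move=> fx l lx; apply: hol_germ_near (fx l lx).
by apply: nearW => y; rewrite expiD expi_int mulr1.
Qed.

Lemma near_log_section f x : U x -> log_section f x ->
  \forall y \near x, log_section f y.
Proof.
rewrite -(lcov_cover N) => -[l _ lx] /(_ l lx) fx.
by apply: filterS2 (near_lcov lx) (near_hol_germ fx) => y; exact: log_section_one.
Qed.

Variables (G : set X) (F0 : X -> X -> Cx R).
Hypotheses (oG : open G) (F0P : log_structure G F0).

(** Over W the bundle has a frame; if lg is a logarithm of its coordinate,
every logarithm of the bundle is, modulo holomorphic functions, lg plus a
function with integer values. *)
Lemma log_integer_structure l (W : set X) : open W -> W `<=` lcov N l ->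
  exists (lg : X -> Cx R) (m : X -> X -> int),
  [/\ forall y, W y -> expi (lg y) = gam l y,
     forall x, (W `&` G) x -> hol_eq x (fun y => lg y + (m x y)%:~R) (F0 x) &
     int_structure (W `&` G) m].
Proof.
move=> oW Wl.
have [lg lgP] : {lg : X -> Cx R & forall y, W y -> expi (lg y) = gam l y}.
  apply: (choice (P := fun y z => W y -> expi z = gam l y)) => y.
  have [Wy|nWy] := pselect (W y); last by exists 0.
  by have [z zE] := expi_surj (gam_neq0 (Wl _ Wy)); exists z.
have [m mP] : {m : X -> X -> int & forall x, (W `&` G) x ->
    hol_eq x (fun y => lg y + (m x y)%:~R) (F0 x)}.
  apply: (choice (P := fun x (k : X -> int) => (W `&` G) x ->
    hol_eq x (fun y => lg y + (k y)%:~R) (F0 x))) => x.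
  have [[Wx Gx]|nWG] := pselect ((W `&` G) x); last by exists (fun=> 0).
  have lx := Wl _ Wx; have Fx := (F0P Gx).1 l lx.
  have q0 : expi (F0 x x) / gam l x != 0.
    by rewrite mulf_neq0 ?invr_eq0 ?expi_neq0 ?gam_neq0.
  have [S hS SE] := hol_local_log q0 Fx.
  have kex : \forall y \near x, exists k : int, F0 x y - S y = lg y + k%:~R.
    apply: filterS2 SE (near_open oW Wx) => y Sy Wy.
    have /expi_eq1[k kE] : expi (F0 x y - S y - lg y) = 1.
      have g0 := gam_neq0 (Wl _ Wy); have e0 := expi_neq0 (F0 x y).
      by rewrite !expiB Sy lgP//; field; rewrite e0 g0.
    by exists k; rewrite -kE subrKC.
  have [k kP] : {k : X -> int & forall y,
      (exists k : int, F0 x y - S y = lg y + k%:~R) ->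
      F0 x y - S y = lg y + (k y)%:~R}.
    apply: (choice (P := fun y k => (exists k : int, F0 x y - S y = lg y + k%:~R) ->
      F0 x y - S y = lg y + k%:~R)) => y.
    by have [[k ky]|nk] := pselect (exists k : int, F0 x y - S y = lg y + k%:~R);
      [exists k|exists 0].
  exists k => _; apply: hol_germ_near (hol_germN hS).
  by apply: filterS kex => y /kP <-; rewrite addrAC subrr add0r.
have mS : int_structure (W `&` G) m.
  move=> x [Wx Gx].
  have WGx : (W `&` G) x by [].
  apply: filterS3 (filterI (near_open oW Wx) (near_open oG Gx)) (F0P Gx).2
    (near_hol_eq (mP _ WGx)) => y WGy Fxy mxy.
  have : hol_eq y (fun z => lg z + (m x z)%:~R) (fun z => lg z + (m y z)%:~R).
    exact: hol_eq_trans mxy (hol_eq_trans Fxy (hol_eq_sym (mP _ WGy))).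
  move=> h; apply: (@hol_germ_int _ _ _ (fun z => m x z - m y z)).
  apply: hol_germ_near h; apply: nearW => z.
  by rewrite rmorphB /= opprD addrACA subrr add0r.
by exists lg, m.
Qed.

(** Both lg and the integers k are defined on all of W, whereas the condition
on k only concerns G. *)
Lemma extend_over_trivialised l (W : set X) lg m k : open W -> W `<=` lcov N l ->
  (forall y, W y -> expi (lg y) = gam l y) ->
  (forall x, (W `&` G) x -> hol_eq x (fun y => lg y + (m x y)%:~R) (F0 x)) ->
  (forall x, (W `&` G) x -> same_germ x k (m x)) ->
  (forall y, W y -> log_section (fun y => lg y + (k y)%:~R) y) /\
  (forall y, W y -> G y -> hol_eq y (fun y => lg y + (k y)%:~R) (F0 y)).
Proof.
move=> oW Wl lgP mP kP.
split=> y Wy.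
  apply: (log_section_one (Wl _ Wy)).
  apply: hol_germ_near (hol_germ_cst 1 y).
  apply: filterS (near_open oW Wy) => z Wz.
  by rewrite expiD lgP// expi_int mulr1 divff// gam_neq0//; exact: Wl.
move=> Gy; have WGy : (W `&` G) y by [].
apply: hol_eq_trans (mP y WGy).
apply: hol_germ_near (hol_germ_cst ((k y)%:~R - (m y y)%:~R) y).
apply: filterS (kP y WGy) => z kz.
by rewrite opprD addrACA subrr add0r -!rmorphB /= kz.
Qed.

Lemma extend_over_trivial l (W : set X) : open W -> W `<=` lcov N l ->
  H1_trivial (W `&` G) -> exists f, (forall y, W y -> log_section f y) /\
    (forall y, W y -> G y -> hol_eq y f (F0 y)).
Proof.
move=> oW Wl H1; have [lg [m [lgP mP mS]]] := log_integer_structure oW Wl.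
have [k kP] := H1 m mS; exists (fun y => lg y + (k y)%:~R).
exact: (extend_over_trivialised oW Wl lgP mP kP).
Qed.

End Logarithms.

(** * Extension of logarithms across a compact set *)

(** The topological condition under which logarithms over G extend across x. *)
Definition locally_simply_connected_at (T : topologicalType) (G : set T) (x : T) :=
  forall V, nbhs x V -> exists W, [/\ open W, W x, W `<=` V &
    [/\ (W `&` G) !=set0, H0_trivial (W `&` G) & H1_trivial (W `&` G)]].

Section Extension.
Variables (R : realType) (n : nat) (X : chartedSpace R n) (U : set X).
Variables (N : lineBundle U) (gam : lidx N -> X -> Cx R).
Hypothesis gamP : set_frames gam.
Variables (G S : set X) (F0 : X -> X -> Cx R).
Hypotheses (hX : hausdorff_space X) (oG : open G) (GU : G `<=` U).
Hypotheses (F0P : log_structure gam G F0) (cS : compact S) (SU : S `<=` U).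
Hypothesis S_good : forall x, S x -> locally_simply_connected_at G x.
Implicit Types (x y z : X) (f g : X -> Cx R) (B K : set X) (F : X -> X -> Cx R).
Local Notation shift_int f m := (fun w => f w + (m w)%:~R).

Definition log_extension B F := [/\ open B, B `<=` U,
  log_structure gam (G `|` B) F & forall x, G x -> hol_eq x (F x) (F0 x)].

Lemma log_extension_over W f : open W -> W `<=` U ->
  (forall y, W y -> log_section gam f y) ->
  (forall y, W y -> G y -> hol_eq y f (F0 y)) ->
  log_extension W (fun x => if x \in W then f else F0 x).
Proof.
move=> oW WU fN fF0; split=> //; last first.
  by move=> x Gx; case: ifPn => [/set_mem Wx|_]; [exact: fF0|exact: hol_eq_refl].
move=> x Zx; have [Wx|Wx] := pselect (W x).
  rewrite mem_set//; split; first exact: fN.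
  by apply: filterS (near_open oW Wx) => y Wy; rewrite mem_set//; exact: hol_eq_refl.
have Gx : G x by case: Zx.
rewrite memNset//; have [s c] := F0P Gx; split=> //.
apply: filterS2 c (near_open oG Gx) => y cy Gy.
case: ifPn => // /set_mem Wy.
exact: hol_eq_trans cy (hol_eq_sym (fF0 _ Wy Gy)).
Qed.

(** On a small neighbourhood of a point of S, two logarithms that agree on G
differ by a holomorphic function and one with integer values; the latter is
constant on the connected part in G, hence can be made to vanish there. *)
Lemma extension_unique_at B1 F1 B2 F2 z : log_extension B1 F1 ->
  log_extension B2 F2 -> S z -> B1 z -> B2 z ->
  exists V (m : X -> int), [/\ open V, V z, V `<=` B1 `&` B2,
    forall y, G y -> m y = 0 &
    forall y, V y -> hol_eq y (shift_int (F1 y) m) (F2 y)].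
Proof.
move=> [oB1 B1U F1P F1G] [oB2 B2U F2P F2G] Sz B1z B2z.
have Uz := B1U _ B1z.
have [s1 c1] := F1P z (or_intror B1z); have [s2 c2] := F2P z (or_intror B2z).
have [L hL LE] := hol_local_log (expi_neq0 _) (log_section_ratio gamP Uz s2 s1).
have near_all : \forall y \near z, [/\ B1 y, B2 y, hol_germ L y,
    expi (L y) = expi (F2 z y - F1 z y) & hol_eq y (F1 z) (F1 y) /\ hol_eq y (F2 z) (F2 y)].
  have h1 : \forall y \near z, B1 y /\ B2 y.
    by apply: filterI; exact: near_open.
  have h2 : \forall y \near z, hol_germ L y /\ expi (L y) = expi (F2 z y - F1 z y).
    by apply: filterI => //; exact: near_hol_germ.
  have h3 : \forall y \near z, hol_eq y (F1 z) (F1 y) /\ hol_eq y (F2 z) (F2 y).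
    exact: filterI.
  by apply: filterS3 h1 h2 h3 => y [y1 y2] [y3 y4] y5; split.
have [W [oW Wz WV [[p [Wp Gp]] H0 _]]] := S_good Sz near_all.
have kex y : W y -> exists k : int, F2 z y - F1 z y - L y = k%:~R.
  move=> /WV[_ _ _ e _]; apply: expi_eq1.
  by rewrite expiB e divff// expi_neq0.
have [k kP] : {k : X -> int & forall y, W y -> F2 z y - F1 z y - L y = (k y)%:~R}.
  apply: (choice (P := fun y k => W y -> F2 z y - F1 z y - L y = k%:~R)) => y.
  have [Wy|nWy] := pselect (W y); last by exists 0.
  by have [k ky] := kex y Wy; exists k.
have klc : locally_constant (W `&` G) k.
  move=> y [Wy Gy]; have [B1y B2y Ly _ [e1 e2]] := WV _ Wy.
  apply: (@hol_germ_int R n X).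
  have e : hol_eq y (F2 z) (F1 z).
    apply: hol_eq_trans e2 (hol_eq_trans (F2G _ Gy) _).
    exact: hol_eq_trans (hol_eq_sym (F1G _ Gy)) (hol_eq_sym e1).
  apply: hol_germ_near (hol_germB e Ly).
  by apply: filterS (near_open oW Wy) => w Ww; rewrite -kP.
exists W, (fun y => if y \in W then k y - k p else 0); split=> //.
- by move=> y /WV[].
- move=> y Gy; case: ifPn => // /set_mem Wy.
  by rewrite (H0 _ klc y p)// subrr.
move=> y Wy; have [B1y B2y Ly _ [e1 e2]] := WV _ Wy.
have d1 := hol_germB (hol_germN e1) (hol_germN e2).
have d2 := hol_germN (hol_germD Ly (hol_germ_cst (k p)%:~R y)).
apply: hol_germ_near (hol_germD d1 d2).
apply: filterS (near_open oW Wy) => w Ww.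
rewrite mem_set// rmorphB /= -kP//; ring.
Qed.

(** Where both are defined, two choices of the integers differ by a locally
constant function that vanishes on G, and G is dense near S. *)
Lemma extension_unique B1 F1 B2 F2 K : log_extension B1 F1 ->
  log_extension B2 F2 -> compact K -> K `<=` S -> K `<=` B1 -> K `<=` B2 ->
  exists V (m : X -> int), [/\ open V, K `<=` V, V `<=` B1 `&` B2,
    forall y, G y -> m y = 0 &
    forall y, V y -> hol_eq y (shift_int (F1 y) m) (F2 y)].
Proof.
move=> E1 E2 cK KS K1 K2.
apply: (compact_induction hX (P := fun A => exists V (m : X -> int),
  [/\ open V, A `<=` V, V `<=` B1 `&` B2, forall y, G y -> m y = 0 &
    forall y, V y -> hol_eq y (shift_int (F1 y) m) (F2 y)]) cK).
- move=> A B AB [V [m [oV BV VB m0 mP]]]; exists V, m; split=> //.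
  exact: subset_trans BV.
- by exists set0, (fun=> 0); split=> //; exact: open0.
- move=> A B cA cB AK BK [V1 [m1 [oV1 AV V1B m10 m1P]]] [V2 [m2 [oV2 BV V2B m20 m2P]]].
  pose Q := [set y | m1 y = m2 y]°.
  have AB_Q : A `&` B `<=` V1 `&` V2 `&` Q.
    move=> y [Ay By]; have V1y := AV _ Ay; have V2y := BV _ By.
    split=> //.
    have mlc : \forall w \near y, m1 w - m2 w = m1 y - m2 y.
      apply: (@hol_germ_int R n X (fun w => m1 w - m2 w) y).
      apply: hol_germ_near (hol_germB (m1P _ V1y) (m2P _ V2y)).
      by apply: nearW => w; rewrite rmorphB /=; ring.
    have [W [oW Wy WV [[p [Wp Gp]] _ _]]] := S_good (KS _ (AK _ Ay)) mlc.
    have e0 : m1 y - m2 y = 0 by rewrite -(WV _ Wp) m10// m20// subrr.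
    rewrite /Q /interior; apply: filterS mlc => w; rewrite e0 => /eqP.
    by rewrite subr_eq0 => /eqP.
  have oQ : open (V1 `&` V2 `&` Q).
    by do 2?apply: openI => //; exact: open_interior.
  have [A' [B' [oA' oB' [AA' A'V] [BB' B'V] A'B']]] :=
    shrink_neighborhoods hX cA cB oV1 oV2 oQ AV BV AB_Q.
  exists (A' `|` B'), (fun y => if y \in A' then m1 y else m2 y); split.
  + exact: openU.
  + by move=> y [/AA'|/BB']; [left|right].
  + by move=> y [/A'V/V1B|/B'V/V2B].
  + by move=> y Gy; case: ifP => _; [exact: m10|exact: m20].
  move=> y yAB; have [A'y|A'y] := pselect (A' y).
    apply: hol_germ_near (m1P _ (A'V _ A'y)).
    by apply: filterS (near_open oA' A'y) => w A'w; rewrite mem_set.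
  have B'y : B' y by case: yAB.
  apply: hol_germ_near (m2P _ (B'V _ B'y)).
  apply: filterS (near_open oB' B'y) => w B'w.
  by case: ifPn => // /set_mem A'w; have [_ /interior_subset /= ->] := A'B' _ (conj A'w B'w).
- move=> z Kz; have [V [m [oV Vz VB m0 mP]]] :=
    extension_unique_at E1 E2 (KS _ Kz) (K1 _ Kz) (K2 _ Kz).
  exists V; first exact: near_open.
  by exists V, m; split=> // y [].
Qed.

(** Extensions near two pieces of S differ, near the intersection of the
pieces, by integers that vanish on G. These integers are arbitrary functions,
so they can be added to the first extension on a whole neighbourhood of its
piece, which makes the two fit together. *)
Theorem extend_to_neighborhood : exists B F, S `<=` B /\ log_extension B F.
Proof.
apply: (compact_induction hX (P := fun A => exists B F, A `<=` B /\ log_extension B F) cS).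
- move=> A A' AA' [B [F [AB BF]]]; exists B, F; split=> //.
  exact: subset_trans AB.
- exists set0, F0; split=> //; split=> //; first exact: open0.
    by rewrite setU0.
  by move=> x Gx; exact: hol_eq_refl.
- move=> A1 A2 cA1 cA2 A1S A2S [B1 [F1 [A1B1 E1]]] [B2 [F2 [A2B2 E2]]].
  have cA : compact (A1 `&` A2).
    by apply: compact_closedI => //; exact: compact_closed.
  have [V [m [oV AV VB m0 mP]]] : exists V (m : X -> int),
      [/\ open V, A1 `&` A2 `<=` V, V `<=` B1 `&` B2, forall y, G y -> m y = 0 &
      forall y, V y -> hol_eq y (shift_int (F1 y) m) (F2 y)].
    apply: extension_unique => //; first by move=> y [/A1S].
      by move=> y [/A1B1].
    by move=> y [_ /A2B2].
  have [oB1 B1U F1P F1G] := E1; have [oB2 B2U F2P F2G] := E2.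
  have [C1 [C2 [oC1 oC2 [AC1 CB1] [AC2 CB2] C12]]] :=
    shrink_neighborhoods hX cA1 cA2 oB1 oB2 oV A1B1 A2B2 AV.
  have G_shift y : G y -> hol_eq y (shift_int (F1 y) m) (F1 y).
    move=> Gy; apply: hol_germ_near (hol_germ_cst 0 y).
    by apply: filterS (near_open oG Gy) => w Gw; rewrite m0// addr0 subrr.
  exists (C1 `|` C2), (fun x => if x \in G `|` C1 then shift_int (F1 x) m else F2 x).
  split; first by move=> y [/AC1|/AC2]; [left|right].
  split; first exact: openU.
  + by move=> y [/CB1/B1U|/CB2/B2U].
  + move=> x Zx; have [GC1x|GC1x] := pselect ((G `|` C1) x).
      rewrite mem_set//.
      have GB1x : (G `|` B1) x by case: GC1x => [|/CB1]; [left|right].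
      have [s c] := F1P x GB1x; split; first exact: log_section_int.
      apply: filterS2 c (near_open (openU oG oC1) GC1x) => y cy GC1y.
      rewrite mem_set//; apply: hol_germ_near cy.
      by apply: nearW => w; ring.
    have C2x : C2 x by case: Zx => [Gx|[C1x|//]]; exfalso; apply: GC1x; [left|right].
    rewrite memNset//.
    have [s c] := F2P x (or_intror (CB2 _ C2x)); split=> //.
    apply: filterS2 c (near_open oC2 C2x) => y cy C2y.
    case: ifPn => // /set_mem[Gy|C1y]; apply: hol_eq_trans cy _; apply: hol_eq_sym.
      apply: hol_eq_trans (G_shift _ Gy) (hol_eq_trans (F1G _ Gy) _).
      exact: hol_eq_sym (F2G _ Gy).
    exact/mP/C12.
  + move=> x Gx; rewrite mem_set; last by left.
    exact: hol_eq_trans (G_shift _ Gx) (F1G _ Gx).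
- move=> z Sz.
  have := SU Sz; rewrite -(lcov_cover N) => -[l _ lz].
  have [W [oW Wz Wl [_ _ H1]]] := S_good Sz (near_lcov lz).
  have [f [fN fF0]] := extend_over_trivial gamP oG F0P oW Wl H1.
  exists W; first exact: near_open.
  exists W, (fun x => if x \in W then f else F0 x).
  split; first by move=> y [].
  apply: log_extension_over => // y /Wl ly.
  by rewrite -(lcov_cover N); exists l.
Qed.

End Extension.

(** * Logarithms and cocycles *)

Section Cochains.
Variables (R : realType) (n : nat) (X : chartedSpace R n) (U : set X).
Variable N : lineBundle U.
Implicit Types (x y : X) (H : cochain X (Cx R)).

Let lcov_of x : U x -> exists l, lcov N l x.
Proof. by rewrite -{1}(lcov_cover N) => -[l _ lx]; exists l. Qed.

(** A choice of one index of the common refinement for each point splits the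
cocycles of the class and of the bundle by arbitrary functions, compatibly with
the exponential. *)
Lemma logarithm_structure (G : set X) H : open G -> G `<=` U ->
  is_logarithm N G H ->
  exists (gam : lidx N -> X -> Cx R) (f : cidx H -> X -> Cx R) (F : X -> X -> Cx R),
  [/\ set_frames gam, log_structure gam G F,
      (forall i x, ccov H i x -> hol_eq x (f i) (F x)) &
      (forall i j x, ccov H i x -> ccov H j x -> cval H i j x = f i x - f j x)].
Proof.
move=> oG GU [[/= oH covH holH mulH] [J [W [a [b [h [oW covW WH hW hE]]]]]]].
have [k kP] : {k : X -> option J & forall x,
    if k x is Some j then W j x else ~ G x}.
  apply: (choice (P := fun x k => if k is Some j then W j x else ~ G x)) => x.
  have [Gx|nG] := pselect (G x); last by exists None.
  by move: Gx; rewrite -covW => -[j _ Wj]; exists (Some j).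
have [u uP] : {u : X -> option (lidx N) & forall x,
    if u x is Some l then lcov N l x else ~ U x}.
  apply: (choice (P := fun x k => if k is Some l then lcov N l x else ~ U x)) => x.
  have [Ux|nU] := pselect (U x); last by exists None.
  by have [l lx] := lcov_of Ux; exists (Some l).
have WG j x : W j x -> G x by move=> Wj; rewrite -covW; exists j.
have Wb j x : W j x -> lcov N (b j) x by move=> /WH[_ []].
have h0 j x : W j x -> h j x != 0 by case: (hW j) => _; apply.
have lU l x : lcov N l x -> U x by move=> lx; rewrite -(lcov_cover N); exists l.
pose gam l x := if k x is Some j then trans N l (b j) x / h j x
  else if u x is Some m then trans N l m x else 1.
pose f i y := if k y is Some j then cval H i (a j) y else 0.
pose F x := if k x is Some j then f (a j) else fun=> 0.
have gamP : set_frames gam.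
  split=> [l x lx|l m x lx mx]; rewrite /gam; move: (kP x) (uP x).
    case: (k x) => [j Wj _|_]; last first.
      case: (u x) => [m mx|/(_ (lU _ _ lx))//]; exact: trans_neq0.
    by rewrite mulf_neq0 ?invr_eq0 ?h0//; exact: trans_neq0 lx (Wb _ _ Wj).
  case: (k x) => [j Wj _|_].
    rewrite (trans_mul lx mx (Wb _ _ Wj)).
    have t0 := trans_neq0 mx (Wb _ _ Wj); have hj := h0 _ _ Wj.
    by field; rewrite t0 hj.
  case: (u x) => [p px|/(_ (lU _ _ lx))//].
  by rewrite (trans_mul lx mx px) mulfK// trans_neq0.
have fE i j x : ccov H i x -> ccov H j x -> cval H i j x = f i x - f j x.
  move=> ix jx; rewrite /f; move: (kP x); case: (k x) => [p Wp|nG].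
    have px : ccov H (a p) x by have [] := WH _ _ Wp.
    by rewrite -(mulH i j (a p) x ix jx px) addrK.
  by case: nG; rewrite -covH; exists i.
have f_eq i j x : ccov H i x -> ccov H j x -> hol_eq x (f i) (f j).
  move=> ix jx; have oij : open (ccov H i `&` ccov H j) by exact: openI.
  have hij := (holomorphicE _ oij).1 (holH i j) x (conj ix jx).
  apply: hol_germ_near hij; apply: filterS2 (near_open (oH i) ix) (near_open (oH j) jx) => y iy jy.
  by rewrite fE.
have fF i x : ccov H i x -> hol_eq x (f i) (F x).
  move=> ix; rewrite /F; move: (kP x); case: (k x) => [p Wp|nG].
    by apply: f_eq => //; have [] := WH _ _ Wp.
  by case: nG; rewrite -covH; exists i.
exists gam, f, F; split=> // x Gx.
have [j kx Wj] : exists2 j, k x = Some j & W j x.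
  by move: (kP x); case: (k x) => [j|//]; exists j.
have near_W := near_open (oW j) Wj.
have FxE : F x = f (a j) by rewrite /F kx.
split; last first.
  apply: filterS near_W => y Wy; rewrite FxE; apply: fF.
  by have [] := WH _ _ Wy.
apply: (log_section_one gamP (Wb _ _ Wj)).
have hj : hol_germ (h j) x.
  exact: ((holomorphicE _ (oW j)).1 (hW j).1 x Wj).
apply: hol_germ_near hj; apply: filterS near_W => y Wy.
rewrite FxE /f /gam; move: (kP y); case: (k y) => [p Wp|/(_ (WG _ _ Wy))//].
have hE' : expi (cval H (a j) (a p) y) =
  h j y * trans N (b j) (b p) y * (h p y)^-1 := hE j p y Wy Wp.
rewrite hE'; have t0 := trans_neq0 (Wb _ _ Wy) (Wb _ _ Wp).
by have hp := h0 _ _ Wp; field; rewrite t0 hp.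
Qed.

Variable gam : lidx N -> X -> Cx R.
Hypothesis gamP : set_frames gam.

(** The indices of the cover have to live in a small type, which the points of
the space do not provide; a countable basis of the topology does. *)
Lemma countable_subcover (Z : set X) (Q : (X -> Cx R) -> X -> Prop) :
  @second_countable X ->
  (forall x, Z x -> exists g, \forall y \near x, Z y /\ Q g y) ->
  exists (W : nat -> set X) (g : nat -> X -> Cx R),
    [/\ forall i, open (W i), \bigcup_i W i = Z & forall i y, W i y -> Q (g i) y].
Proof.
move=> [B /countable_injP[e einj] [Bo Bx]] ZQ.
pose good (V : set X) g := V `<=` [set y | Z y /\ Q g y].
have [w wP] : {w : nat -> set X * (X -> Cx R) & forall i, [/\ open (w i).1,
    good (w i).1 (w i).2 &
    forall V g, B V -> e V = i -> good V g -> (w i).1 = V]}.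
  apply: (choice (P := fun i w => [/\ open w.1, good w.1 w.2 &
    forall V g, B V -> e V = i -> good V g -> w.1 = V])) => i.
  have [[V [g [BV eV gV]]]|no] := pselect (exists V g, [/\ B V, e V = i & good V g]).
    exists (V, g); split=> //=; first exact: Bo.
    by move=> V' g' BV' eV' _; apply: einj; rewrite ?inE// eV.
  exists (set0, fun=> 0); split=> //=; first exact: open0.
  by move=> V g BV eV gV; exfalso; apply: no; exists V, g.
exists (fun i => (w i).1), (fun i => (w i).2); split=> [i| |i y].
- by have [] := wP i.
- apply/seteqP; split=> y; first by move=> [i _ wy]; have [_ /(_ _ wy)[]] := wP i.
  move=> /ZQ[g gy]; have [V [BV Vy] Vg] := Bx y _ gy.
  exists (e V) => //; have [_ _ /(_ V g BV erefl Vg)] := wP (e V).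
  by move=> /= ->.
- by move=> wy; have [_ /(_ _ wy)[]] := wP i.
Qed.

(** Functions that represent the structure on the members of an open cover have
holomorphic differences; these form the cocycle. *)
Lemma structure_cochain (Z : set X) (F : X -> X -> Cx R) :
  @second_countable X -> open Z -> Z `<=` U ->
  log_structure gam Z F -> exists H, is_logarithm N Z H /\
  forall (G : set X) (H0 : cochain X (Cx R)) (f : cidx H0 -> X -> Cx R),
    open G -> G `<=` Z -> H1 (Osheaf X) G H0 ->
    (forall i j x, ccov H0 i x -> ccov H0 j x -> cval H0 i j x = f i x - f j x) ->
    (forall i x, ccov H0 i x -> hol_eq x (f i) (F x)) ->
    H1_eq (Osheaf X) G (res_class G H) H0.
Proof.
move=> scX oZ ZU FP.
pose Q g y := hol_eq y g (F y) /\ log_section gam g y.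
have ZQ x : Z x -> exists g, \forall y \near x, Z y /\ Q g y.
  move=> Zx; have [s c] := FP x Zx; exists (F x).
  apply: filterI; first exact: near_open.
  by apply: filterI => //; apply: (near_log_section gamP) => //; exact: ZU.
have [W [g [oW covW Wg]]] := countable_subcover scX ZQ.
have WZ i : W i `<=` Z by move=> y Wy; rewrite -covW; exists i.
pose H : cochain X (Cx R) := Cochain W (fun i j z => g i z - g j z).
exists H; split; first split.
- split; [exact: oW|exact: covW|move=> i j|move=> i j k z _ _ _]; last first.
    by rewrite /= addrA subrK.
  apply/holomorphicE; first by apply: openI; exact: oW.
  move=> z [iz jz]; have [ig _] := Wg _ _ iz; have [jg _] := Wg _ _ jz.
  exact: hol_eq_trans ig (hol_eq_sym jg).
- pose V (il : nat * lidx N) := W il.1 `&` lcov N il.2.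
  have oV il : open (V il) by apply: openI => //; exact: lcov_open.
  exists (nat * lidx N)%type, V, fst, snd, (fun il y => expi (g il.1 y) / gam il.2 y).
  split; [exact: oV| | | |].
  + apply/seteqP; split=> y; first by move=> [[i l] _ [/WZ]].
    move=> Zy; have [l ly] := lcov_of (ZU _ Zy).
    by have := Zy; rewrite -covW => -[i _ iy]; exists (i, l).
  + by move=> [i l] y [/= iy ly]; split=> //; split=> //; exact: WZ iy.
  + move=> [i l]; split=> /=; last first.
      by move=> y [_ /= ly]; rewrite mulf_neq0 ?invr_eq0 ?expi_neq0// gamP.1.
    by apply/holomorphicE; [exact: oV|move=> y [/= iy ly]; exact: (Wg _ _ iy).2].
  + move=> [i l] [j m] z [/= iz lz] [/= jz mz].
    rewrite -[cexp _]/(expi (g i z - g j z)) expiB gamP.2//.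
    have gl := gamP.1 l z lz; have gm := gamP.1 m z mz.
    by have e0 := expi_neq0 (g j z); field; rewrite gl gm e0.
- move=> G H0 f oG GZ [oH0 covH0 holH0 mulH0] H0E fF.
  pose V (ik : nat * cidx H0) := W ik.1 `&` ccov H0 ik.2 `&` G.
  have oV ik : open (V ik) by apply: openI => //; apply: openI.
  exists (nat * cidx H0)%type, V, fst, snd, (fun ik y => g ik.1 y - f ik.2 y).
  split; [exact: oV| | | |].
  + apply/seteqP; split=> y; first by move=> [[i k] _ [_]].
    move=> Gy; have := Gy; rewrite -covH0 => -[k _ ky].
    by have := GZ _ Gy; rewrite -covW => -[i _ iy]; exists (i, k).
  + by move=> [i k] y [[/= iy ky] Gy].
  + move=> [i k]; apply/holomorphicE; [exact: oV|move=> y [[/= iy ky] _]].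
    exact: hol_eq_trans (Wg _ _ iy).1 (hol_eq_sym (fF _ _ ky)).
  + move=> [i k] [j p] z [[/= iz kz] _] [[/= jz pz] _].
    by rewrite H0E//; ring.
Qed.

End Cochains.

(** * Directional derivatives *)

Lemma mean_value (R : realType) (f df : R -> R) (s : R) :
  (forall r : R, `|r| <= `|s| -> is_derive r 1 f (df r)) ->
  exists2 r : R, `|r| <= `|s| & f s - f 0 = s * df r.
Proof.
move=> fd.
have fc (r : R) : `|r| <= `|s| -> {for r, continuous f}.
  by move=> /fd[/derivable1_diffP/differentiable_continuous].
have [s0|s0|->] := ltrgtP s 0; last by exists 0; rewrite ?normr0// subrr mul0r.
- have itv (r : R) : r \in `]s, 0[ -> `|r| <= `|s|.
    by rewrite in_itv /= => /andP[a b]; rewrite !ltr0_norm// lerN2 ltW.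
  have [|r rs E] := @MVT R f df s 0 s0 (fun r rs => fd r (itv r rs)).
    apply: continuous_in_subspaceT => r; rewrite inE /= in_itv /= => /andP[a b].
    by apply: fc; rewrite ler0_norm// (ltr0_norm s0) lerN2.
  exists r; first exact: itv.
  by rewrite -opprB E sub0r mulrN opprK mulrC.
- have itv (r : R) : r \in `]0, s[ -> `|r| <= `|s|.
    by rewrite in_itv /= => /andP[a b]; rewrite !gtr0_norm// ltW.
  have [|r rs E] := @MVT R f df 0 s s0 (fun r rs => fd r (itv r rs)).
    apply: continuous_in_subspaceT => r; rewrite inE /= in_itv /= => /andP[a b].
    by apply: fc; rewrite ger0_norm// (gtr0_norm s0).
  exists r; first exact: itv.
  by rewrite E subr0 mulrC.
Qed.

Section Estimates.
Variable R : realType.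
Implicit Types a b c e : R.

Let close_sum a b c a' b' c' e : `|a - a'| < e / 3 -> `|b - b'| < e / 3 ->
  `|c - c'| < e / 3 -> a' = b' + c' -> `|a - (b + c)| <= e.
Proof.
rewrite !ltr_norml ler_norml => /andP[? ?] /andP[? ?] /andP[? ?] ?.
by apply/andP; split; lra.
Qed.

Let close_common a b c e : `|a - c| < e / 2 -> `|b - c| < e / 2 -> `|a - b| <= e.
Proof.
rewrite !ltr_norml ler_norml => /andP[? ?] /andP[? ?].
by apply/andP; split; lra.
Qed.

Let second_difference a b c e : a - b - c + e = a - c - (b - e).
Proof. by ring. Qed.

Section DirectionalCalculus.
Variables (n : nat).
Implicit Types (w v z : Cn R n) (g h : Cn R n -> R) (O : set (Cn R n)) (s r : R).

Lemma scale_line_continuous w : continuous (fun s => (s%:C : Cx R) *: w).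
Proof.
move=> s.
apply: (@continuous_comp _ _ _ (fun s : R => s%:C : Cx R) (fun c : Cx R => c *: w)).
  exact: real_complex_continuous.
exact: scalel_continuous.
Qed.

Lemma line_continuous z w : continuous (fun s => z + (s%:C : Cx R) *: w).
Proof.
move=> s; apply: (@continuousD _ (Cn R n) _ (cst z) (fun s => (s%:C : Cx R) *: w)).
  exact: cst_continuous.
exact: scale_line_continuous.
Qed.

Lemma near_plane z v w (P : Cn R n -> Prop) : (\forall y \near z, P y) ->
  exists2 d, 0 < d & forall r s, `|r| < d -> `|s| < d ->
    P (z + (r%:C : Cx R) *: v + (s%:C : Cx R) *: w).
Proof.
move=> zP.
have c : {for (0, 0), continuous (fun q : R * R =>
    z + (q.1%:C : Cx R) *: v + (q.2%:C : Cx R) *: w)}.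
  apply: (@continuousD _ (Cn R n) _
    (fun q : R * R => z + (q.1%:C : Cx R) *: v) (fun q => (q.2%:C : Cx R) *: w)).
  - apply: (@continuous_comp _ _ _ (fun q : R * R => q.1)
      (fun s => z + (s%:C : Cx R) *: v)); first exact: cvg_fst.
    exact: line_continuous.
  - apply: (@continuous_comp _ _ _ (fun q : R * R => q.2)
      (fun s => (s%:C : Cx R) *: w)); first exact: cvg_snd.
    exact: scale_line_continuous.
have c0 : z + ((0, 0) : R * R).1%:C *: v + ((0, 0) : R * R).2%:C *: w = z.
  by rewrite /= !scale0r !addr0.
have [[A B] /= [nA nB] AB] := near_continuous c c0 zP.
move: nA nB => /nbhs_ballP[d1 /= d10 d1A] /nbhs_ballP[d2 /= d20 d2B].
exists (Num.min d1 d2) => [|r s]; first by rewrite lt_min d10.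
rewrite !lt_min => /andP[r1 _] /andP[_ s2]; apply: (AB (r, s)); split=> /=.
  by apply: d1A; rewrite /ball /= sub0r normrN.
by apply: d2B; rewrite /ball /= sub0r normrN.
Qed.

Lemma along_shift w g z s r :
  along w g z (s + r) = along w g (z + (s%:C : Cx R) *: w) r.
Proof. by rewrite /along rmorphD /= scalerDl addrA. Qed.

Section Smooth.
Variables (O : set (Cn R n)) (oO : open O).

Lemma smooth_rderive w g : smooth_in O g -> smooth_in O (rderive w g).
Proof. by move=> sg ws z Oz; have := sg (rcons ws w) z Oz; rewrite foldr_rcons. Qed.

Lemma smooth_continuous g z : smooth_in O g -> O z -> {for z, continuous g}.
Proof. by move=> sg Oz; have [] := sg [::] z Oz. Qed.

Lemma along_is_derive w g z s : smooth_in O g -> O (z + (s%:C : Cx R) *: w) ->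
  is_derive s 1 (along w g z) (rderive w g (z + (s%:C : Cx R) *: w)).
Proof.
move=> sg Oz; have [_ /(_ w) dg] := sg [::] _ Oz.
set z1 := z + _ in dg *.
have e : along w g z = along w g z1 \o (fun r => r - s).
  by apply/funext => r; rewrite /= -along_shift subrKC.
have H : is_derive (s - s) 1 (along w g z1) (rderive w g z1).
  by rewrite subrr; split.
have Hs : is_derive s 1 (fun r => r - s) (1 - 0).
  exact: is_deriveB.
have := @is_derive1_comp R (along w g z1) (fun r => r - s) s _ _ H Hs.
by rewrite e subr0 mulr1.
Qed.

Lemma mvt_along w g z s : smooth_in O g ->
  (forall r, `|r| <= `|s| -> O (z + (r%:C : Cx R) *: w)) ->
  exists2 r, `|r| <= `|s| &
    g (z + (s%:C : Cx R) *: w) - g z = s * rderive w g (z + (r%:C : Cx R) *: w).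
Proof.
move=> sg Os.
have [r rs E] := mean_value (fun r rs => along_is_derive sg (Os r rs)).
by exists r => //; rewrite -E /along scale0r addr0.
Qed.

(** The increment in the direction v + w is the sum of the increments along two
sides of a small triangle. *)
Lemma rderiveD v w g z : smooth_in O g -> O z ->
  rderive (v + w) g z = rderive v g z + rderive w g z.
Proof.
move=> sg Oz; apply/eqP; rewrite -subr_eq0 -normr_le0; apply/ler_addgt0Pr => e e0.
have e30 : 0 < e / 3 by rewrite divr_gt0.
have near_d u : \forall y \near z, `|rderive u g z - rderive u g y| < e / 3.
  have /cvgrPdist_lt := smooth_continuous (smooth_rderive u sg) Oz.
  exact.
have near_O := near_open oO Oz.
have [d d0 dP] := near_plane v w
  (filterI near_O (filterI (near_d (v + w)) (filterI (near_d v) (near_d w)))).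
pose s := d / 2; have s0 : 0 < s by rewrite divr_gt0.
have sd r : `|r| <= `|s| -> `|r| < d.
  by move=> rs; apply: le_lt_trans rs _; rewrite gtr0_norm// /s; lra.
have P r t : `|r| <= `|s| -> `|t| <= `|s| -> _ := fun rs ts => dP r t (sd r rs) (sd t ts).
have zr r : z + (r%:C : Cx R) *: (v + w) = z + (r%:C : Cx R) *: v + (r%:C : Cx R) *: w.
  by rewrite scalerDr addrA.
have n0 : `|0 : R| <= `|s| by rewrite normr0.
have z0 r : z + (r%:C : Cx R) *: v = z + (r%:C : Cx R) *: v + ((0 : R)%:C : Cx R) *: w.
  by rewrite scale0r addr0.
have [r1 r1s E1] : exists2 r, `|r| <= `|s| & _ :=
  @mvt_along (v + w) g z s sg (fun r rs => eq_ind_r O (P r r rs rs).1 (zr r)).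
have [r2 r2s E2] := @mvt_along w g (z + (s%:C : Cx R) *: v) s sg
  (fun r rs => (P s r (lexx _) rs).1).
have [r3 r3s E3] := @mvt_along v g z s sg
  (fun r rs => eq_ind_r O (P r 0 rs n0).1 (z0 r)).
have E : rderive (v + w) g (z + (r1%:C : Cx R) *: (v + w)) =
  rderive w g (z + (s%:C : Cx R) *: v + (r2%:C : Cx R) *: w) +
  rderive v g (z + (r3%:C : Cx R) *: v).
  apply: (mulfI (lt0r_neq0 s0)); rewrite mulrDr -E1 -E2 -E3 zr.
  by rewrite addrA subrK.
have [_ [D1 _]] := P _ _ r1s r1s; rewrite -zr in D1.
have [_ [_ [_ D2]]] := P _ _ (lexx `|s|) r2s.
have [_ [_ [D3 _]]] := P _ _ r3s n0; rewrite -z0 in D3.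
by rewrite add0r; exact: close_sum D1 D3 D2 (etrans E (addrC _ _)).
Qed.

Lemma rderiveZ (c : R) w g z : smooth_in O g -> O z ->
  rderive ((c%:C : Cx R) *: w) g z = c * rderive w g z.
Proof.
move=> sg Oz.
have e : along ((c%:C : Cx R) *: w) g z = along w g z \o (fun r => r * c).
  by apply/funext => r; rewrite /along /= scalerA -rmorphM.
have z0 : z + ((0 * c)%:C : Cx R) *: w = z by rewrite mul0r scale0r addr0.
have Oz0 : O (z + ((0 * c)%:C : Cx R) *: w) by rewrite z0.
have H := along_is_derive sg Oz0; rewrite z0 in H.
have Hc : is_derive (0 : R) 1 (fun r => r * c) c.
  have := @is_deriveM R R (@id R) (cst c) 0 1 _ _ (is_derive_id _ _) (is_derive_cst _ _ _).
  by rewrite scaler0 add0r /GRing.scale /= mulr1.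
have [_ D] := @is_derive1_comp R (along w g z) (fun r => r * c) 0 _ _ H Hc.
by rewrite {1}/rderive e; exact: etrans D (mulrC _ _).
Qed.

(** The difference of order two over a small parallelogram equals, up to the
square of its size, either mixed derivative at some nearby point. *)
Lemma schwarz v w g z : smooth_in O g -> O z ->
  rderive v (rderive w g) z = rderive w (rderive v g) z.
Proof.
move=> sg Oz.
have half v' w' e : 0 < e -> exists2 d, 0 < d & forall s, 0 < s -> s < d ->
    exists2 D, `|rderive v' (rderive w' g) z - D| < e &
      g (z + (s%:C : Cx R) *: v' + (s%:C : Cx R) *: w') -
      g (z + (s%:C : Cx R) *: v') - g (z + (s%:C : Cx R) *: w') + g z = s * (s * D).
  move=> e0.
  have near_d : \forall y \near z,
      `|rderive v' (rderive w' g) z - rderive v' (rderive w' g) y| < e.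
    have /cvgrPdist_lt := smooth_continuous
      (smooth_rderive v' (smooth_rderive w' sg)) Oz.
    exact.
  have near_O := near_open oO Oz.
  have [d d0 dP] := near_plane v' w' (filterI near_O near_d).
  exists d => // s s0 sd.
  have ss : `|s| = s by rewrite gtr0_norm.
  have P r t : `|r| <= `|s| -> `|t| <= `|s| -> _ :=
    fun rs ts => dP r t (le_lt_trans rs (eq_ind_r (fun x => x < d) sd ss))
      (le_lt_trans ts (eq_ind_r (fun x => x < d) sd ss)).
  pose f r := along w' g (z + (s%:C : Cx R) *: v') r - along w' g z r.
  have n0 : `|0 : R| <= `|s| by rewrite normr0.
  have Pw r : `|r| <= `|s| -> O (z + (r%:C : Cx R) *: w').
    by move=> rs; have [+ _] := P 0 r n0 rs; rewrite scale0r addr0.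
  have Pvw r : `|r| <= `|s| -> O (z + (s%:C : Cx R) *: v' + (r%:C : Cx R) *: w').
    by move=> rs; have [+ _] := P s r (lexx _) rs.
  have fd (r : R) : `|r| <= `|s| -> is_derive r 1 f
     (rderive w' g (z + (s%:C : Cx R) *: v' + (r%:C : Cx R) *: w') -
      rderive w' g (z + (r%:C : Cx R) *: w')).
    move=> rs; apply: is_deriveB; apply: along_is_derive => //.
      exact: Pvw.
    exact: Pw.
  have [r rs E] := mean_value fd.
  have [t ts E'] := @mvt_along v' (rderive w' g) (z + (r%:C : Cx R) *: w') s
    (smooth_rderive w' sg)
    (fun t ts => eq_ind_r O (P t r ts rs).1 (addrAC _ _ _)).
  exists (rderive v' (rderive w' g) (z + (r%:C : Cx R) *: w' + (t%:C : Cx R) *: v')).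
    by have [_] := P t r ts rs; rewrite addrAC.
  have zc : z + (s%:C : Cx R) *: v' + (r%:C : Cx R) *: w' =
      z + (r%:C : Cx R) *: w' + (s%:C : Cx R) *: v' by rewrite addrAC.
  rewrite zc E' in E; rewrite -E /f /along scale0r !addr0.
  exact: second_difference.
apply/eqP; rewrite -subr_eq0 -normr_le0; apply/ler_addgt0Pr => e e0.
have e20 : 0 < e / 2 by rewrite divr_gt0.
have [d1 d10 P1] := half v w _ e20; have [d2 d20 P2] := half w v _ e20.
pose s := Num.min d1 d2 / 2.
have m0 : 0 < Num.min d1 d2 by rewrite lt_min d10.
have m1 : Num.min d1 d2 <= d1 by rewrite ge_min lexx.
have m2 : Num.min d1 d2 <= d2 by rewrite ge_min lexx orbT.
have s0 : 0 < s by rewrite divr_gt0.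
have sd1 : s < d1 by rewrite /s; lra.
have sd2 : s < d2 by rewrite /s; lra.
have [D1 D1e E1] := P1 s s0 sd1; have [D2 D2e E2] := P2 s s0 sd2.
have D12 : D1 = D2.
  apply: (mulfI (lt0r_neq0 s0)); apply: (mulfI (lt0r_neq0 s0)).
  rewrite -E1 -E2 [z + _ + _]addrAC; congr (_ + _).
  exact: addrAC.
by rewrite add0r; rewrite D12 in D1e; exact: close_common D1e D2e.
Qed.

End Smooth.
End DirectionalCalculus.
End Estimates.

(** * The Hessian and the Levi form *)

Section RealCoordinates.
Variables (R : realType) (n : nat).
Implicit Types (v w : 'rV[R]_(n + n)) (z : Cn R n) (g : Cn R n -> R).

Definition cplx_of v : Cn R n :=
  \row_(k < n) ((v ord0 (lshift n k) +i* v ord0 (rshift n k)) : Cx R).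

Definition real_of z : 'rV[R]_(n + n) :=
  row_mx (\row_(k < n) complex.Re (z ord0 k)) (\row_(k < n) complex.Im (z ord0 k)).

Lemma cplx_ofK v : real_of (cplx_of v) = v.
Proof.
rewrite -[RHS]hsubmxK; congr row_mx; apply/rowP => k; rewrite !mxE /=.
  by [].
by [].
Qed.

Lemma real_ofK z : cplx_of (real_of z) = z.
Proof.
apply/rowP => k; rewrite mxE /real_of row_mxEl row_mxEr !mxE.
by case: (z ord0 k).
Qed.

Lemma cplx_ofD v w : cplx_of (v + w) = cplx_of v + cplx_of w.
Proof. by apply/rowP => k; rewrite !mxE. Qed.

Lemma cplx_ofZ (c : R) v : cplx_of (c *: v) = (c%:C : Cx R) *: cplx_of v.
Proof.
apply/rowP => k; rewrite !mxE /= /GRing.mul /=.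
by rewrite !mul0r subr0 addr0.
Qed.

Lemma cplx_of0 : cplx_of 0 = 0.
Proof. by rewrite -(scale0r (0 : 'rV[R]_(n + n))) cplx_ofZ scale0r. Qed.

Lemma cplx_of_continuous : continuous cplx_of.
Proof.
move=> v; apply: matrix_continuous => i k.
rewrite (_ : (fun w => cplx_of w i k) = fun w : 'rV[R]_(n + n) =>
  (w ord0 (lshift n k) +i* w ord0 (rshift n k) : Cx R)); last first.
  by apply/funext => w; rewrite mxE.
by apply: complex_continuous; exact: coord_continuous.
Qed.

Lemma real_of_continuous : continuous real_of.
Proof.
move=> z; apply: row_mx_continuous; apply: matrix_continuous => i k.
  rewrite (_ : (fun t => _) = fun t : Cn R n => complex.Re (t ord0 k)).
    apply: (@continuous_comp _ _ _ (fun t : Cn R n => t ord0 k)).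
      exact: coord_continuous.
    exact: Re_continuous.
  by apply/funext => t; rewrite mxE.
rewrite (_ : (fun t => _) = fun t : Cn R n => complex.Im (t ord0 k)).
  apply: (@continuous_comp _ _ _ (fun t : Cn R n => t ord0 k)).
    exact: coord_continuous.
  exact: Im_continuous.
by apply/funext => t; rewrite mxE.
Qed.

Lemma rdir_lshift k : rdir R (lshift n k) = xdir R k.
Proof. by rewrite /rdir -[lshift n k]/(unsplit (inl k)) unsplitK. Qed.

Lemma rdir_rshift k : rdir R (rshift n k) = ydir R k.
Proof. by rewrite /rdir -[rshift n k]/(unsplit (inr k)) unsplitK. Qed.

Lemma cplx_of_sum v :
  cplx_of v = \sum_(j < n + n) ((v ord0 j)%:C : Cx R) *: rdir R j.
Proof.
rewrite big_split_ord /=.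
have split_sum (u : 'I_n -> Cx R) :
    \sum_(k < n) u k *: (delta_mx ord0 k : Cn R n) = \row_k u k.
  by rewrite [RHS]row_sum_delta; apply: eq_bigr => k _; rewrite mxE.
have -> : \sum_(k < n) ((v ord0 (lshift n k))%:C : Cx R) *: rdir R (lshift n k) =
    \row_k ((v ord0 (lshift n k))%:C : Cx R).
  by rewrite -split_sum; apply: eq_bigr => k _; rewrite rdir_lshift.
have -> : \sum_(k < n) ((v ord0 (rshift n k))%:C : Cx R) *: rdir R (rshift n k) =
    \row_k ('i * (v ord0 (rshift n k))%:C : Cx R).
  rewrite -split_sum; apply: eq_bigr => k _; rewrite rdir_rshift /ydir scalerA.
  by rewrite mulrC.
by apply/rowP => k; rewrite !mxE [LHS]complexE.
Qed.

Variables (O : set (Cn R n)) (oO : open O).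

Lemma rderive_cplx v g z : smooth_in O g -> O z ->
  rderive (cplx_of v) g z = \sum_(j < n + n) v ord0 j * rderive (rdir R j) g z.
Proof.
move=> sg Oz; rewrite cplx_of_sum.
elim/big_ind2 : _ => [|x a y b xa yb|j _]; last exact: (rderiveZ _ _ sg Oz).
  have -> : 0 = ((0 : R)%:C : Cx R) *: (0 : Cn R n) by rewrite scale0r.
  by rewrite (rderiveZ 0 0 sg Oz) mul0r.
by rewrite (rderiveD oO _ _ sg Oz) xa yb.
Qed.

Lemma hessian_sym g z : smooth_in O g -> O z -> (hessian g z)^T = hessian g z.
Proof. by move=> sg Oz; apply/matrixP => i j; rewrite !mxE; exact: (schwarz oO). Qed.

Lemma rderive2_hessian v w g z : smooth_in O g -> O z ->
  rderive (cplx_of v) (rderive (cplx_of w) g) z =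
  (v *m hessian g z *m w^T) ord0 ord0.
Proof.
move=> sg Oz; rewrite rderive_cplx//; last exact: smooth_rderive.
transitivity (\sum_(j < n + n) v ord0 j *
    \sum_(k < n + n) w ord0 k * hessian g z k j).
  apply: eq_bigr => j _; congr (_ * _).
  rewrite (schwarz oO _ _ sg Oz) rderive_cplx//; last exact: smooth_rderive.
  by apply: eq_bigr => k _; rewrite mxE.
rewrite mxE; under [RHS]eq_bigr => k _ do rewrite mxE mulr_suml.
rewrite exchange_big /=; apply: eq_bigr => j _; rewrite mulr_sumr.
apply: eq_bigr => k _; rewrite -{1}(hessian_sym sg Oz) ![_^T _ _]mxE.
by rewrite mulrCA mulrC.
Qed.

(** The Levi form is the mean of the real Hessian over the complex line. *)
Lemma levi_hessian v v' g z : cplx_of v' = 'i *: cplx_of v -> v != 0 ->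
  levi_positive g z ->
  0 < (v *m hessian g z *m v^T) ord0 ord0 + (v' *m hessian g z *m v'^T) ord0 ord0.
Proof.
move=> v'E v0 /(_ (cplx_of v)) L.
have w0 : cplx_of v != 0.
  apply: contra_neq v0 => e; rewrite -(cplx_ofK v) e.
  by rewrite -[RHS]cplx_ofK cplx_of0.
have v'l k : v' ord0 (lshift n k) = - v ord0 (rshift n k).
  have /rowP/(_ k) := v'E; rewrite !mxE => /(congr1 (@complex.Re R)) /= ->.
  by rewrite mul0r mul1r sub0r.
have v'r k : v' ord0 (rshift n k) = v ord0 (lshift n k).
  have /rowP/(_ k) := v'E; rewrite !mxE => /(congr1 (@complex.Im R)) /= ->.
  by rewrite mul0r mul1r add0r.
set H := hessian g z.
have leviE j k : levi_mx g z j k =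
    ((H (lshift n j) (lshift n k) + H (rshift n j) (rshift n k)) / 4) +i*
    ((H (lshift n j) (rshift n k) - H (rshift n j) (lshift n k)) / 4).
  by rewrite !mxE !rdir_lshift !rdir_rshift.
clearbody H.
have quadE (u : 'rV[R]_(n + n)) : (u *m H *m u^T) ord0 ord0 =
    \sum_(j < n) \sum_(k < n)
      (u ord0 (lshift n j) * H (lshift n j) (lshift n k) * u ord0 (lshift n k)
       + u ord0 (lshift n j) * H (lshift n j) (rshift n k) * u ord0 (rshift n k)
       + u ord0 (rshift n j) * H (rshift n j) (lshift n k) * u ord0 (lshift n k)
       + u ord0 (rshift n j) * H (rshift n j) (rshift n k) * u ord0 (rshift n k)).
  have sumE : (u *m H *m u^T) ord0 ord0 = \sum_(j < n + n) \sum_(k < n + n)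
      u ord0 j * H j k * u ord0 k.
    rewrite mxE; under eq_bigr => k _ do rewrite [(u *m H) _ _]mxE [u^T _ _]mxE mulr_suml.
    by rewrite exchange_big.
  rewrite sumE big_split_ord /= -big_split /=; apply: eq_bigr => j _.
  rewrite !big_split_ord /= -!big_split /=; apply: eq_bigr => k _; ring.
have := L w0; rewrite ltcE /= => /andP[_]; rewrite raddf_sum.
suff -> : \sum_(j < n) complex.Re (\sum_(k < n)
    levi_mx g z j k * cplx_of v ord0 j * conjc (cplx_of v ord0 k)) =
    ((v *m H *m v^T) ord0 ord0 + (v' *m H *m v'^T) ord0 ord0) / 4.
  by rewrite pmulr_lgt0.
rewrite !quadE -big_split /= mulr_suml; apply: eq_bigr => j _.
rewrite raddf_sum -big_split /= mulr_suml; apply: eq_bigr => k _.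
rewrite !v'l !v'r leviE !mxE /=.
move: (H (lshift n j) (lshift n k)) (H (lshift n j) (rshift n k))
  (H (rshift n j) (lshift n k)) (H (rshift n j) (rshift n k))
  (v ord0 (lshift n j)) (v ord0 (lshift n k))
  (v ord0 (rshift n j)) (v ord0 (rshift n k)) => pxx pxy pyx pyy aj ak bj bk.
by field.
Qed.

End RealCoordinates.

(** * Definite forms and second derivatives *)

Section DefiniteForms.
Variable R : realType.

Definition qform m (S : 'M[R]_m) (u : 'rV[R]_m) : R := (u *m S *m u^T) ord0 ord0.

Lemma qformE m (S : 'M[R]_m) u :
  qform S u = \sum_(j < m) \sum_(k < m) u ord0 j * S j k * u ord0 k.
Proof.
rewrite /qform mxE; under eq_bigr => k _ do rewrite [(u *m S) _ _]mxE [u^T _ _]mxE mulr_suml.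
by rewrite exchange_big.
Qed.

Lemma qformZ m (S : 'M[R]_m) (c : R) u : qform S (c *: u) = c ^+ 2 * qform S u.
Proof.
rewrite /qform linearZ /= -!scalemxAl -scalemxAr scalerA mxE.
by rewrite expr2.
Qed.

Lemma qform_continuous (T : topologicalType) m (S : T -> 'M[R]_m) (u : T -> 'rV[R]_m) x :
  {for x, continuous S} -> {for x, continuous u} ->
  {for x, continuous (fun t => qform (S t) (u t))}.
Proof.
move=> Sc uc.
rewrite (_ : (fun t => _) = fun t =>
  \sum_(j < m) \sum_(k < m) u t ord0 j * S t j k * u t ord0 k); last first.
  by apply/funext => t; rewrite qformE.
have uj j : {for x, continuous (fun t => u t ord0 j)}.
  exact: (continuous_comp uc (@coord_continuous _ _ _ ord0 j (u x))).
have Sjk j k : {for x, continuous (fun t => S t j k)}.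
  exact: (continuous_comp Sc (@coord_continuous _ _ _ j k (S x))).
have sum_cont (f : 'I_m -> T -> R) : (forall j, {for x, continuous (f j)}) ->
    {for x, continuous (fun t => \sum_(j < m) f j t)}.
  move=> fc; rewrite (_ : (fun t => _) = \sum_(j < m) f j); last first.
    by apply/funext => t; rewrite fct_sumE.
  elim/big_ind: _ => [|g g' gc gc'|j _]; last exact: fc.
    exact: (@cst_continuous _ _ (0 : R)).
  exact: continuousD.
apply: (sum_cont) => j; apply: (sum_cont) => k.
by apply: continuousM; [apply: continuousM; [exact: uj|exact: Sjk]|exact: uj].
Qed.

(** Positivity on the compact unit sphere is an open condition. *)
Lemma posdef_near (T : topologicalType) m (S : T -> 'M[R]_m) x :
  {for x, continuous S} -> (forall u, u != 0 -> 0 < qform (S x) u) ->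
  \forall y \near x, forall u, u != 0 -> 0 < qform (S y) u.
Proof.
move=> Sc pos; pose K := [set u : 'rV[R]_m | `|u| = 1].
have cK : compact K.
  apply: bounded_closed_compact.
    exists 1; split=> // e e1 u /= ->; exact: ltW.
  rewrite (_ : K = (fun u : 'rV[R]_m => `|u|) @^-1` [set 1]); last by [].
  apply: closed_comp => [u _|]; first exact: norm_continuous.
  exact: closed_eq.
have cov : \forall y \near x, K `<=` (fun u => 0 < qform (S y) u).
  move/compact_near_coveringP: cK; apply => u Ku.
  have u0 : u != 0 by rewrite -normr_eq0 Ku oner_eq0.
  have c : {for (u, x), continuous (fun q : 'rV[R]_m * T => qform (S q.2) q.1)}.
    apply: qform_continuous; last exact: cvg_fst.
    apply: (@continuous_comp _ _ _ (fun q : 'rV[R]_m * T => q.2)); first exact: cvg_snd.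
    exact: Sc.
  exact: (near_continuous c erefl (lt_nbhsr (pos u u0))).
apply: filterS cov => y Ky u u0.
have n0 : 0 < `|u| by rewrite normr_gt0.
have : 0 < qform (S y) (`|u|^-1 *: u).
  by apply: Ky; rewrite /K /= normrZ normfV normr_id mulVf// gt_eqF.
by rewrite qformZ pmulr_rgt0// exprn_gt0// invr_gt0.
Qed.

End DefiniteForms.

Section SecondDerivative.
Variable R : realType.
Variables (h h1 h2 : R -> R).
Hypothesis hd : forall s : R, 0 <= s <= 1 -> is_derive s 1 h (h1 s).
Hypothesis h1d : forall s : R, 0 <= s <= 1 -> is_derive s 1 h1 (h2 s).

Lemma mvt_unit (f f1 : R -> R) (a b : R) : 0 <= a -> a < b -> b <= 1 ->
  (forall s : R, 0 <= s <= 1 -> is_derive s 1 f (f1 s)) ->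
  exists c, [/\ a < c, c < b & f b - f a = f1 c * (b - a)].
Proof.
move=> a0 ab b1 fd.
have itv (r : R) : r \in `]a, b[ -> 0 <= r <= 1.
  rewrite in_itv /= => /andP[ar rb].
  by rewrite (le_trans a0 (ltW ar)) (le_trans (ltW rb) b1).
have [|r] := @MVT R f f1 a b ab (fun r rab => fd r (itv r rab)).
  apply: continuous_in_subspaceT => r; rewrite inE /= in_itv /= => /andP[ar rb].
  have r01 : 0 <= r <= 1 by rewrite (le_trans a0 ar) (le_trans rb b1).
  by have [/derivable1_diffP/differentiable_continuous] := fd r r01.
by rewrite in_itv /= => /andP[ar rb] E; exists r.
Qed.

Lemma second_derivative_pos : (forall s, 0 <= s <= 1 -> 0 < h2 s) -> h1 0 = 0 ->
  h 0 < h 1.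
Proof.
move=> pos h10; have [c [c0 c1 E]] := mvt_unit (lexx 0) ltr01 (lexx 1) hd.
have [d [d0 dc E1]] := mvt_unit (lexx 0) c0 (ltW c1) h1d.
have h1c : h1 c = h2 d * (c - 0) by rewrite -E1 h10 subr0.
rewrite -subr_gt0 E h1c !subr0 mulr1; apply: mulr_gt0 => //.
by apply: pos; rewrite (ltW d0) (ltW (lt_trans dc c1)).
Qed.

Lemma second_derivative_neg (t0 t : R) : (forall s, 0 <= s <= 1 -> h2 s < 0) ->
  t0 < h 0 -> t0 < h 1 -> 0 <= t <= 1 -> t0 < h t.
Proof.
move=> neg h0 h1' /andP[t_ge0 t_le1].
have [->//|t_neq0] := eqVneq t 0; have [->//|t_neq1] := eqVneq t 1.
have t_gt0 : 0 < t by rewrite lt0r t_neq0.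
have t_lt1 : t < 1 by rewrite lt_neqAle t_neq1.
rewrite ltNge; apply/negP => ht.
have [a [a0 at' Ea]] := mvt_unit (lexx 0) t_gt0 t_le1 hd.
have [b [tb b1 Eb]] := mvt_unit t_ge0 t_lt1 (lexx 1) hd.
have [c [ac cb Ec]] := mvt_unit (ltW a0) (lt_trans at' tb) (ltW b1) h1d.
have a_neg : h1 a < 0.
  rewrite -(pmulr_llt0 _ (_ : 0 < t - 0)) ?subr0//.
  by rewrite subr0 in Ea; rewrite -Ea subr_lt0; exact: le_lt_trans ht h0.
have b_pos : 0 < h1 b.
  rewrite -(pmulr_lgt0 _ (_ : 0 < 1 - t)) ?subr_gt0//.
  by rewrite -Eb subr_gt0; exact: le_lt_trans ht h1'.
have c01 : 0 <= c <= 1.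
  by rewrite (ltW (lt_trans a0 ac)) (ltW (lt_trans cb b1)).
have := neg c c01; rewrite -(pmulr_llt0 _ (_ : 0 < b - a)); last first.
  by rewrite subr_gt0 (lt_trans at').
rewrite -Ec; lra.
Qed.

End SecondDerivative.

(** * The local shape of a critical point *)

Lemma norm_row_mx_lt (R : realType) p k (u : 'rV[R]_p) (v : 'rV[R]_k) (r : R) :
  0 < r -> `|row_mx u v| < r <-> `|u| < r /\ `|v| < r.
Proof.
move=> r0; split=> [/(rV_norm_ltP _ r0) H|[/(rV_norm_ltP _ r0) Hu /(rV_norm_ltP _ r0) Hv]].
  split; apply/rV_norm_ltP => // j.
    by have := H (lshift k j); rewrite row_mxEl.
  by have := H (rshift p j); rewrite row_mxEr.
apply/rV_norm_ltP => // j; rewrite mxE.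
by case: (fintype.split j) => i; [exact: Hu|exact: Hv].
Qed.

Section SecondOrder.
Variables (R : realType) (n : nat) (O : set (Cn R n)).
Hypothesis oO : open O.
Implicit Types (g : Cn R n -> R) (z : Cn R n).

Definition rderive2 (v : 'rV[R]_(n + n)) g z :=
  rderive (cplx_of v) (rderive (cplx_of v) g) z.

Lemma rderive2E v g z : smooth_in O g -> O z -> rderive2 v g z = qform (hessian g z) v.
Proof. by move=> sg Oz; rewrite /rderive2 (rderive2_hessian oO). Qed.

(** The sign e lets the same statement serve the directions of increase and
those of decrease. *)
Lemma definite_near p (B : 'M[R]_(p, n + n)) (e : R) g z : smooth_in O g -> O z ->
  (forall u, u != 0 -> 0 < e * rderive2 (u *m B) g z) ->
  \forall y \near z, forall u, u != 0 -> 0 < e * rderive2 (u *m B) g y.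
Proof.
move=> sg Oz pos.
pose S y : 'M[R]_p := \matrix_(i, j)
  (e * rderive (cplx_of (row i B)) (rderive (cplx_of (row j B)) g) y).
have SE y u : O y -> qform (S y) u = e * rderive2 (u *m B) g y.
  move=> Oy; rewrite rderive2E// /qform.
  have -> : S y = e *: (B *m hessian g y *m B^T).
    apply/matrixP => i j; rewrite !mxE (rderive2_hessian oO _ _ sg Oy); congr (_ * _).
    rewrite -row_mul !mxE; apply: eq_bigr => k _.
    by rewrite !mxE.
  by rewrite -scalemxAr -scalemxAl mxE trmx_mul !mulmxA.
have Sc : {for z, continuous S}.
  apply: matrix_continuous => i j.
  rewrite (_ : (fun t => _) = fun y =>
    e * rderive (cplx_of (row i B)) (rderive (cplx_of (row j B)) g) y); last first.
    by apply/funext => t; rewrite mxE.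
  apply: continuousM; first exact: cst_continuous.
  by apply: (smooth_continuous _ Oz); do 2!apply: smooth_rderive.
have Spos u : u != 0 -> 0 < qform (S z) u by move=> u0; rewrite SE// pos.
apply: filterS2 (posdef_near Sc Spos) (near_open oO Oz) => y Sy Oy u u0.
by rewrite -SE// Sy.
Qed.

Variables (p k : nat) (Bp : 'M[R]_(p, n + n)) (Bk : 'M[R]_(k, n + n)).
Variables (g : Cn R n -> R) (z0 : Cn R n) (t0 : R).
Hypotheses (sg : smooth_in O g) (Oz0 : O z0).
Hypotheses (crit : gradient_zero g z0) (gz0 : g z0 = t0).

Definition chart_line (v : 'rV[R]_(p + k)) : Cn R n :=
  z0 + cplx_of (v *m col_mx Bp Bk).

Lemma chart_line_continuous : continuous chart_line.
Proof.
move=> v; apply: (@continuousD _ (Cn R n) _ (cst z0)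
  (fun v : 'rV[R]_(p + k) => cplx_of (v *m col_mx Bp Bk))).
  exact: cst_continuous.
apply: (@continuous_comp _ _ _ (fun v : 'rV[R]_(p + k) => v *m col_mx Bp Bk)).
  exact: mulmxr_cont.
exact: cplx_of_continuous.
Qed.

Lemma chart_lineD (v w : 'rV[R]_(p + k)) (s : R) :
  chart_line (v + s *: w) = chart_line v + (s%:C : Cx R) *: cplx_of (w *m col_mx Bp Bk).
Proof. by rewrite /chart_line mulmxDl -scalemxAl cplx_ofD cplx_ofZ addrA. Qed.

Lemma chart_line0 : chart_line 0 = z0.
Proof. by rewrite /chart_line mul0mx cplx_of0 addr0. Qed.

Definition split_definite z := [/\ O z,
  forall u, u != 0 -> 0 < rderive2 (u *m Bp) g z &
  forall v, v != 0 -> rderive2 (v *m Bk) g z < 0].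

Lemma split_definite_near : split_definite z0 ->
  exists2 r, 0 < r & forall v, `|v| < r -> split_definite (chart_line v).
Proof.
move=> [_ pos neg].
have pos1 : forall u, u != 0 -> 0 < 1 * rderive2 (u *m Bp) g z0.
  by move=> u u0; rewrite mul1r pos.
have neg1 : forall u, u != 0 -> 0 < -1 * rderive2 (u *m Bk) g z0.
  by move=> u u0; rewrite mulN1r oppr_gt0 neg.
have nO := near_open oO Oz0.
have np := definite_near sg Oz0 pos1.
have nn := definite_near sg Oz0 neg1.
have near_sd : \forall z \near z0, split_definite z.
  near=> z; split.
  - by near: z.
  - move=> u u0; rewrite -[X in _ < X]mul1r; move: u u0; near: z; exact: np.
  - move=> u u0; rewrite -oppr_gt0 -mulN1r; move: u u0; near: z; exact: nn.
have h : \forall v \near (0 : 'rV[R]_(p + k)), split_definite (chart_line v).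
  exact: (near_continuous (@chart_line_continuous 0) chart_line0 near_sd).
by have [r r0 rP] := nbhs0_ball h; exists r.
Unshelve. all: by end_near. Qed.

Variable r : R.
Hypotheses (r0 : 0 < r) (def : forall v, `|v| < r -> split_definite (chart_line v)).

Let up (u : 'rV[R]_p) : 'rV[R]_(p + k) := row_mx u 0.
Let down (v : 'rV[R]_k) : 'rV[R]_(p + k) := row_mx 0 v.

Let split_vec u v : up u + down v = row_mx u v.
Proof. by rewrite add_row_mx addr0 add0r. Qed.

Let scale_down (s : R) v : s *: down v = down (s *: v).
Proof. by rewrite scale_row_mx scaler0. Qed.

Let down_mul v : down v *m col_mx Bp Bk = v *m Bk.
Proof. by rewrite mul_row_col mul0mx add0r. Qed.

Let up_mul u : up u *m col_mx Bp Bk = u *m Bp.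
Proof. by rewrite mul_row_col mul0mx addr0. Qed.

Let scaled_norm m (v : 'rV[R]_m) (s : R) : 0 <= s <= 1 -> `|v| < r -> `|s *: v| < r.
Proof.
move=> /andP[s0 s1] vr; rewrite normrZ ger0_norm//.
by apply: le_lt_trans vr; rewrite ler_piMl.
Qed.

Let along_O (v w : 'rV[R]_(p + k)) (s : R) : `|v + s *: w| < r ->
  O (chart_line v + (s%:C : Cx R) *: cplx_of (w *m col_mx Bp Bk)).
Proof. by move=> vw; rewrite -chart_lineD; have [] := def vw. Qed.

Let line_derivatives (v w : 'rV[R]_(p + k)) (c := cplx_of (w *m col_mx Bp Bk)) :
  (forall s : R, 0 <= s <= 1 -> `|v + s *: w| < r) ->
  (forall s : R, 0 <= s <= 1 -> is_derive s 1 (along c g (chart_line v))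
     (along c (rderive c g) (chart_line v) s)) /\
  (forall s : R, 0 <= s <= 1 -> is_derive s 1 (along c (rderive c g) (chart_line v))
     (along c (rderive c (rderive c g)) (chart_line v) s)).
Proof.
move=> vw; split=> s s01.
  exact: (along_is_derive sg (along_O (vw s s01))).
exact: (along_is_derive (smooth_rderive c sg) (along_O (vw s s01))).
Qed.

Let along0 c h z : along c h z 0 = h z.
Proof. by rewrite /along scale0r addr0. Qed.

Let along1 c h z : along c h z 1 = h (z + c).
Proof. by rewrite /along scale1r. Qed.

(** Along the positive directions g has a strict minimum at the critical point,
and it is concave along the negative ones: it stays above t0 when v shrinks to
0. *)
Lemma saddle_local : saddle r [set v | `|v| < r /\ t0 < g (chart_line v)].
Proof.
have n0 m : `|0 : 'rV[R]_m| < r by rewrite normr0.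
have pos u : u != 0 -> `|u| < r -> t0 < g (chart_line (up u)).
  move=> u0 ur; set c := cplx_of (up u *m col_mx Bp Bk).
  have su (s : R) : 0 <= s <= 1 -> `|0 + s *: up u| < r.
    move=> s01; rewrite add0r scale_row_mx scaler0; apply/norm_row_mx_lt => //.
    by split=> //; exact: scaled_norm.
  have [d1 d2] := line_derivatives su; rewrite -/c chart_line0 in d1 d2.
  have := second_derivative_pos d1 d2.
  rewrite !along0 along1 gz0 /chart_line -/c; apply; last exact: crit.
  move=> s s01; have [_ P _] := def (su s s01).
  by have := P u u0; rewrite -up_mul /rderive2 chart_lineD chart_line0.
have neg v : `|v| < r -> g (chart_line (down v)) <= t0.
  move=> vr; have [->|v0] := eqVneq v 0.
    by rewrite /down row_mx0 chart_line0 gz0.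
  set c := cplx_of (down v *m col_mx Bp Bk).
  have sv (s : R) : 0 <= s <= 1 -> `|0 + s *: down v| < r.
    move=> s01; rewrite add0r scale_down; apply/norm_row_mx_lt => //.
    by split=> //; exact: scaled_norm.
  have [d1 d2] := line_derivatives sv; rewrite -/c chart_line0 in d1 d2.
  have := @second_derivative_pos R (fun s => - along c g z0 s)
    (fun s => - along c (rderive c g) z0 s)
    (fun s => - along c (rderive c (rderive c g)) z0 s).
  rewrite /= !along0 along1 ltrN2 gz0 /chart_line -/c => H; apply/ltW/H.
  - by move=> s s01; apply: is_deriveN; exact: d1.
  - by move=> s s01; apply: is_deriveN; exact: d2.
  - move=> s s01; rewrite oppr_gt0; have [_ _ P] := def (sv s s01).
    by have := P v v0; rewrite -down_mul /rderive2 chart_lineD chart_line0.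
  - by rewrite crit oppr0.
split=> //.
- rewrite openE => v [/= vr gv].
  have nv : \forall w \near v, `|w| < r by exact: (norm_continuous (lt_nbhsl vr)).
  have [Ov _ _] := def vr.
  have gc : {for v, continuous (g \o chart_line)}.
    apply: continuous_comp; first exact: chart_line_continuous.
    exact: (smooth_continuous sg Ov).
  exact: filterI nv (near_continuous gc erefl (lt_nbhsr gv)).
- move=> x [/= xr gx]; rewrite -[x]hsubmxK in xr gx.
  have [ur vr] := (norm_row_mx_lt _ _ r0).1 xr; split=> //.
  apply: contraTneq gx => ->; rewrite -leNgt; exact: neg.
- move=> x t [/= xr gx] t01; rewrite -[x]hsubmxK in xr gx.
  have [ur vr] := (norm_row_mx_lt _ _ r0).1 xr.
  set u := lsubmx x in xr gx ur *; set v := rsubmx x in xr gx vr *.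
  split=> /=; first by apply/norm_row_mx_lt => //; split=> //; exact: scaled_norm.
  have u0 : u != 0.
    by apply: contraTneq gx => ->; rewrite -leNgt; exact: neg.
  have [v0|v0] := eqVneq v 0; first by rewrite v0 scaler0; exact: pos.
  set c := cplx_of (down v *m col_mx Bp Bk).
  have sv (s : R) : 0 <= s <= 1 -> `|up u + s *: down v| < r.
    move=> s01; rewrite scale_down split_vec; apply/norm_row_mx_lt => //.
    by split=> //; exact: scaled_norm.
  have [d1 d2] := line_derivatives sv; rewrite -/c in d1 d2.
  have lineE (s : R) : along c g (chart_line (up u)) s =
      g (chart_line (row_mx u (s *: v))).
    by rewrite /along -chart_lineD scale_down split_vec.
  rewrite -lineE; apply: (second_derivative_neg d1 d2) => //.
  + move=> s s01; have [_ _ P] := def (sv s s01).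
    by have := P v v0; rewrite -down_mul /rderive2 chart_lineD.
  + by rewrite along0; exact: pos.
  + by rewrite lineE scale1r.
- move=> u u0 ur; split; last exact: pos.
  by apply/norm_row_mx_lt.
Qed.

End SecondOrder.

(** * Negative subspaces of the Hessian *)

Section QuadraticForms.
Variables (R : realType) (m : nat) (S : 'M[R]_m).
Implicit Types (u v w : 'rV[R]_m) (A : 'M[R]_m).

Definition bform u v : R := (u *m S *m v^T) ord0 ord0.

Lemma bformDl u v w : bform (u + v) w = bform u w + bform v w.
Proof. by rewrite /bform !mulmxDl mxE. Qed.

Lemma bformDr u v w : bform u (v + w) = bform u v + bform u w.
Proof. by rewrite /bform linearD /= mulmxDr mxE. Qed.

Lemma bformZr (c : R) u v : bform u (c *: v) = c * bform u v.
Proof. by rewrite /bform linearZ /= -scalemxAr mxE. Qed.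

Hypothesis Ss : S^T = S.

Lemma bformC u v : bform u v = bform v u.
Proof.
rewrite /bform -[in RHS]Ss.
have -> : v *m S^T *m u^T = (u *m S *m v^T)^T by rewrite !trmx_mul trmxK mulmxA.
by rewrite [RHS]mxE.
Qed.

Lemma qformD u v : qform S (u + v) = qform S u + 2 * bform u v + qform S v.
Proof.
rewrite -!/(bform _ _) -[qform S (u + v)]/(bform (u + v) (u + v)).
rewrite bformDl !bformDr [bform v u]bformC -![bform _ _ in RHS]/(bform _ _).
rewrite -[qform S u]/(bform u u) -[qform S v]/(bform v v); ring.
Qed.

Variable A : 'M[R]_m.
Hypotheses (Sunit : S \in unitmx) (negA : negative_on S A).
Hypothesis maxA : forall A', negative_on S A' -> (\rank A' <= \rank A)%N.

Definition form_orthogonal : 'M[R]_m := kermx (S *m A^T).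
Local Notation P := form_orthogonal.

Lemma orthogonalP u v : (u <= P)%MS -> (v <= A)%MS -> bform u v = 0.
Proof.
move=> /sub_kermxP uP /submxP[y ->].
by rewrite /bform trmx_mul mulmxA -[u *m S *m _]mulmxA uP mul0mx mxE.
Qed.

Lemma orthogonal_cap : (A :&: P = 0)%MS.
Proof.
apply/eqP/rowV0P => u; rewrite sub_capmx => /andP[uA uP].
apply/eqP/negPn/negP => u0; have := negA uA u0.
by rewrite -/(bform u u) orthogonalP// ltxx.
Qed.

Lemma orthogonal_rank : (\rank A + \rank P = m)%N.
Proof.
have e : \rank (S *m A^T) = \rank A.
  by rewrite -mxrank_tr trmx_mul trmxK Ss mxrankMfree ?row_free_unit.
by rewrite mxrank_ker e subnKC// rank_leq_row.
Qed.

Lemma orthogonal_full : row_full (A + P)%MS.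
Proof.
by rewrite /row_full (mxrank_disjoint_sum orthogonal_cap) orthogonal_rank.
Qed.

(** Otherwise the negative space could be enlarged. *)
Lemma orthogonal_ge0 u : (u <= P)%MS -> 0 <= qform S u.
Proof.
move=> uP; rewrite leNgt; apply/negP => qu.
have neg : negative_on S (A + u)%MS.
  move=> v /sub_addsmxP[[y1 y2] /= ->] v0.
  rewrite -/(qform S _); move: v0; set a := y1 *m A.
  rewrite [y2]mx11_scalar mul_scalar_mx; set c := y2 ord0 ord0 => v0.
  have aA : (a <= A)%MS by exact: submxMl.
  rewrite qformD bformZr [bform a u]bformC (orthogonalP uP aA) !mulr0 addr0 qformZ.
  have qa : qform S a <= 0.
    have [->|a0] := eqVneq a 0; first by rewrite /qform !mul0mx mxE.
    exact: ltW (negA aA a0).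
  have [c0|c0] := eqVneq c 0.
    rewrite c0 expr0n mul0r addr0; apply: (negA aA).
    by apply: contra_neq v0 => ->; rewrite c0 scale0r addr0.
  have : c ^+ 2 * qform S u < 0 by rewrite pmulr_rlt0// exprn_even_gt0.
  lra.
have := maxA neg; rewrite (geq_leqif (mxrank_leqif_sup (addsmxSl A u))).
rewrite addsmx_sub => /andP[_ uA].
have : (u <= A :&: P)%MS by rewrite sub_capmx uA.
rewrite orthogonal_cap submx0 => /eqP u0.
by move: qu; rewrite u0 /qform !mul0mx mxE ltxx.
Qed.

(** A vector of P where the form vanishes is orthogonal to P, since the form is
nonnegative there, and to A; nondegeneracy excludes it. *)
Lemma orthogonal_gt0 u : (u <= P)%MS -> u != 0 -> 0 < qform S u.
Proof.
move=> uP u0; rewrite lt_neqAle orthogonal_ge0// andbT eq_sym.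
apply: contra_neq u0 => qu.
have bP w : (w <= P)%MS -> bform u w = 0.
  move=> wP; apply/eqP/negPn/negP => b0.
  (* The value at w + t u is then -1. *)
  pose t := - (qform S w + 1) / (2 * bform u w).
  have : 0 <= qform S (w + t *: u).
    by apply: orthogonal_ge0; rewrite addmx_sub// scalemx_sub.
  rewrite qformD qformZ qu mulr0 addr0 bformZr [bform w u]bformC.
  have -> : qform S w + 2 * (t * bform u w) = -1 by rewrite /t; field.
  by rewrite oppr_ge0 ler10.
have uS : u *m S = 0.
  apply/rowP => j.
  have : bform u (delta_mx ord0 j) = 0.
    have : ((delta_mx ord0 j : 'rV[R]_m) <= A + P)%MS.
      by apply: submx_full; exact: orthogonal_full.
    move=> /sub_addsmxP[[y1 y2] /= ->].
    by rewrite bformDr (orthogonalP uP (submxMl _ _)) (bP _ (submxMl _ _)) addr0.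
  by rewrite /bform trmx_delta -colE [col _ _ _ _]mxE => ->; rewrite [RHS]mxE.
by rewrite -[u](mulmxK Sunit) uS mul0mx.
Qed.

End QuadraticForms.

Lemma exists_max_negative (R : realType) m (S : 'M[R]_m) :
  exists2 A, negative_on S A & forall A', negative_on S A' -> (\rank A' <= \rank A)%N.
Proof.
pose Q k := `[< exists2 A : 'M[R]_m, negative_on S A & \rank A = k >].
have Q0 : exists k, Q k.
  exists 0%N; apply/asboolP; exists 0; last exact: mxrank0.
  by move=> v; rewrite submx0 => ->.
have Qm k : Q k -> (k <= m)%N by move=> /asboolP[A _ <-]; exact: rank_leq_row.
have [k /asboolP[A nA rA] kmax] := ex_maxnP Q0 Qm.
exists A => // A' nA'; rewrite rA; apply: kmax.
by apply/asboolP; exists A'.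
Qed.

(** Multiplication by i in real coordinates, acting from the right. *)
Definition Jmx (R : realType) n : 'M[R]_(n + n) := block_mx 0 1%:M (- 1%:M) 0.

Lemma Jmx_sqr (R : realType) n : Jmx R n *m Jmx R n = - 1%:M.
Proof.
rewrite /Jmx mulmx_block !mul0mx !mulmx0 !mul1mx !mulmx1 !add0r !addr0.
by rewrite [in RHS]scalar_mx_block opp_block_mx oppr0.
Qed.

Lemma cplx_of_Jmx (R : realType) n (v : 'rV[R]_(n + n)) :
  cplx_of (v *m Jmx R n) = ('i : Cx R) *: cplx_of v.
Proof.
rewrite -{1}[v]hsubmxK mul_row_block !mulmx0 mulmx1 mulmxN mulmx1 addr0 add0r.
apply/rowP => k; rewrite !mxE.
have -> : fintype.split (lshift n k) = inl k :> 'I_n + 'I_n by exact: (unsplitK (inl k)).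
have -> : fintype.split (rshift n k) = inr k :> 'I_n + 'I_n by exact: (unsplitK (inr k)).
by rewrite !mxE /GRing.mul /= !mul0r !mul1r sub0r add0r.
Qed.

(** The sum of the values of the form at v and i v is positive, so these
vectors are not both negative directions: a negative space meets its product
with i only in 0. *)
Lemma negative_rank (R : realType) n (g : Cn R n -> R) z (A : 'M[R]_(n + n)) :
  levi_positive g z -> negative_on (hessian g z) A ->
  (A :&: A *m Jmx R n = 0)%MS /\ (\rank A <= n)%N.
Proof.
move=> L nA.
have cap0 : (A :&: A *m Jmx R n = 0)%MS.
  apply/eqP/rowV0P => u; rewrite sub_capmx => /andP[uA /submxP[y uE]].
  apply/eqP/negPn/negP => u0; pose v := y *m A.
  have uv : u = v *m Jmx R n by rewrite uE mulmxA.
  have v0 : v != 0 by apply: contra_neq u0; rewrite uv => ->; rewrite mul0mx.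
  have := levi_hessian _ v0 L; move=> /(_ u); rewrite uv cplx_of_Jmx => /(_ erefl).
  rewrite -uv; have := nA u uA u0; have := nA v (submxMl _ _) v0; lra.
split=> //.
have Jfree : row_free (Jmx R n).
  apply/row_freeP; exists (- Jmx R n).
  by rewrite mulmxN Jmx_sqr opprK.
have := mxrank_disjoint_sum cap0; rewrite (mxrankMfree _ Jfree) => e.
by have := rank_leq_row (A + A *m Jmx R n)%MS; rewrite e; lia.
Qed.

(** * Passage from charts to the manifold *)

Section LocalGeometry.
Variables (R : realType) (n : nat) (X : chartedSpace R n) (U : set X).
Variables (rho : X -> R) (t0 : R) (oU : open U) (sm : smooth_on U rho).
Implicit Types (x y : X) (a : chart R n X).

Definition chart_image a := cmap a @` (cdom a `&` U).

Lemma chart_imageP a z : chart_image a z ->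
  [/\ cdom a (cinv a z), U (cinv a z) & cmap a (cinv a z) = z].
Proof. by move=> [y [ay Uy] <-]; rewrite cmapK. Qed.

Lemma chart_image_open a : open (chart_image a).
Proof.
rewrite openE => z az; have [ay Uy yz] := chart_imageP az.
have rz : (cmap a @` cdom a) z by exists (cinv a z).
have nU : \forall z' \near z, U (cinv a z').
  apply: (near_continuous (cinv_continuous rz) erefl).
  exact: (near_open oU Uy).
apply: filterS2 nU (near_open (@crng_open _ _ _ a) rz) => z' Uz' [y' ay' yz'].
by exists y' => //; split=> //; rewrite -yz' cmapK in Uz'.
Qed.

Lemma chart_image_cont a z : chart_image a z -> {for z, continuous (cinv a)}.
Proof.
move=> az; have [ay _ yz] := chart_imageP az.
by apply: cinv_continuous; exists (cinv a z).
Qed.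

Lemma rho_continuous x : U x -> {for x, continuous rho}.
Proof.
move=> Ux; have [a aA ax] := atlas_cover x.
have gc : {for cmap a x, continuous (rho \o cinv a)}.
  by apply: (smooth_continuous (sm aA)); exists x.
have c : {for x, continuous ((rho \o cinv a) \o cmap a)}.
  exact: (continuous_comp (cmap_continuous ax) gc).
have e : ((rho \o cinv a) \o cmap a) x = rho x by rewrite /= cmapK.
move=> B rB; have cB := near_continuous c e rB.
by apply: filterS2 (near_cdom ax) cB => y ay /=; rewrite cmapK.
Qed.

Lemma superlevel_open : open (superlevel U rho t0).
Proof.
rewrite openE => x [Ux rx].
have h := near_continuous (rho_continuous Ux) erefl (lt_nbhsr rx).
exact: filterI (near_open oU Ux) h.
Qed.

Section InChart.
Variables (a : chart R n X) (x : X) (aA : atlas a) (ax : cdom a x) (Ux : U x).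
Let g := rho \o cinv a.

(** The sets W are taken in real coordinates around the point and carried to
the manifold by the chart. *)
Lemma locally_simply_connected_chart m (L : 'rV[R]_m -> Cn R n)
    (Li : Cn R n -> 'rV[R]_m) : continuous L -> continuous Li ->
    cancel L Li -> cancel Li L -> L 0 = cmap a x ->
  (forall Q : set 'rV[R]_m, nbhs (0 : 'rV[R]_m) Q -> exists W : set 'rV[R]_m, [/\ open W, W 0, W `<=` Q &
    let E := W `&` [set v | t0 < g (L v)] in
    [/\ E !=set0, H0_trivial E & H1_trivial E]]) ->
  locally_simply_connected_at (superlevel U rho t0) x.
Proof.
move=> Lc Lic LK LiK L0 good V nV.
have Ox : chart_image a (cmap a x) by exists x.
have nO : \forall v \near (0 : 'rV[R]_m), chart_image a (L v).
  apply: (near_continuous (Lc 0) L0).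
  exact: (near_open (@chart_image_open a) Ox).
have nV' : \forall v \near (0 : 'rV[R]_m), V (cinv a (L v)).
  apply: (near_continuous (Lc 0) L0 (P := fun z => V (cinv a z))).
  exact: (near_continuous (cinv_continuous_at ax) (cmapK ax)).
have [W [oW W0 WQ [[p Ep] H0 H1]]] := good _ (filterI nO nV').
pose W1 : set X := [set y | cdom a y /\ W (Li (cmap a y))].
have phic y : cdom a y -> {for y, continuous (fun y => Li (cmap a y))}.
  by move=> ay; apply: (continuous_comp (cmap_continuous ay)); exact: Lic.
have W1P y : W1 y -> [/\ chart_image a (cmap a y), U y & V y].
  move=> [ay Wy]; have [Oy Vy] := WQ _ Wy; rewrite LiK in Oy.
  rewrite LiK cmapK// in Vy; have [_ Uy _] := chart_imageP Oy.
  by rewrite cmapK// in Uy.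
have psiP v : W v -> [/\ chart_image a (L v), W1 (cinv a (L v)) &
    cmap a (cinv a (L v)) = L v].
  move=> Wv; have [Ov _] := WQ _ Wv; have [ay Uy e] := chart_imageP Ov.
  by split=> //; split=> //; rewrite e LK.
pose E := W `&` [set v | t0 < g (L v)].
have psic v : W v -> {for v, continuous (fun v => cinv a (L v))}.
  move=> /psiP[Ov _ _]; apply: (continuous_comp (Lc v)).
  exact: chart_image_cont.
have oE : open E.
  rewrite openE => v [Wv gv]; apply: filterI.
    exact: (near_open oW Wv).
  have [Ov _ _] := psiP v Wv.
  have gc : {for L v, continuous g} := smooth_continuous (sm aA) Ov.
  have gLc : {for v, continuous (g \o L)} by apply: continuous_comp => //; exact: Lc.
  exact: (near_continuous gLc erefl (lt_nbhsr gv)).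
have oW1 : open W1.
  rewrite openE => y [ay Wy]; apply: filterI; first exact: near_cdom.
  exact: (near_continuous (phic y ay) erefl (near_open oW Wy)).
have oWG : open (W1 `&` superlevel U rho t0).
  by apply: openI => //; exact: superlevel_open.
have phiE y : (W1 `&` superlevel U rho t0) y -> E (Li (cmap a y)).
  by move=> [[ay Wy] [_ ry]]; split=> //=; rewrite LiK /g /= cmapK.
have psiE v : E v -> (W1 `&` superlevel U rho t0) (cinv a (L v)).
  by move=> [Wv gv]; have [_ Wy _] := psiP v Wv; have [_ Uy _] := W1P _ Wy.
have phiK y : (W1 `&` superlevel U rho t0) y -> cinv a (L (Li (cmap a y))) = y.
  by move=> [[ay _] _]; rewrite LiK cmapK.
have phic' y : (W1 `&` superlevel U rho t0) y ->
    {for y, continuous (fun y => Li (cmap a y))} by move=> [[ay _] _]; exact: phic.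
have psic' v : E v -> {for v, continuous (fun v => cinv a (L v))}.
  by move=> [Wv _]; exact: psic.
exists W1; split=> //.
- by split=> //; rewrite -L0 LK.
- by move=> y /W1P[].
split; first by exists (cinv a (L p)); exact: psiE.
- exact: (H0_trivial_transport phiE psiE phiK psic').
- exact: (H1_trivial_transport phiE psiE phiK oWG phic' psic').
Qed.

End InChart.
End LocalGeometry.

(** * Regular points of the level *)

Lemma min_segment (R : realType) (a b t : R) : 0 <= t -> t <= 1 ->
  Num.min a b <= a + t * (b - a).
Proof.
move=> t0 t1; rewrite ge_min; have [ab|/ltW ba] := leP a b.
  by rewrite lerDl mulr_ge0 ?subr_ge0.
apply/orP; right; rewrite -subr_ge0.
have -> : a + t * (b - a) - b = (1 - t) * (a - b) by ring.
by rewrite mulr_ge0 ?subr_ge0.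
Qed.

Section FlowBox.
Variables (R : realType) (n : nat) (O : set (Cn R n)) (g : Cn R n -> R).
Variables (z0 w0 : Cn R n) (t0 : R).
Hypotheses (oO : open O) (sg : smooth_in O g) (Oz0 : O z0) (gz0 : g z0 = t0).
Hypothesis w0g : 0 < rderive w0 g z0.

Let L (v : 'rV[R]_(n + n)) : Cn R n := z0 + cplx_of v.
Let w := real_of w0.

Lemma translate_continuous : continuous L.
Proof.
move=> v; apply: (@continuousD _ (Cn R n) _ (cst z0) (fun v => cplx_of v)).
  exact: cst_continuous.
exact: cplx_of_continuous.
Qed.

Let LD v (s : R) : L (v + s *: w) = L v + (s%:C : Cx R) *: w0.
Proof. by rewrite /L cplx_ofD cplx_ofZ real_ofK addrA. Qed.

Let w_neq0 : exists j, w ord0 j != 0.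
Proof.
apply: contrapT => /forallNP w0j.
have w00 : w0 = ((0 : R)%:C : Cx R) *: w0.
  have -> : w0 = 0; last by rewrite scaler0.
  rewrite -[w0]real_ofK -/w; have -> : w = 0; last by rewrite cplx_of0.
  by apply/rowP => j; rewrite [RHS]mxE; apply/eqP/negPn/negP; exact: w0j.
by move: w0g; rewrite w00 (rderiveZ _ _ sg Oz0) mul0r ltxx.
Qed.

(** As g increases in the direction w, the part of a box around 0 where g is
large consists of half lines in this direction, cut by the box. If the box is
thin enough, g is large on its whole slice at height h / 2, so this part
contracts to the slice, and the slice to its center. *)
Lemma flow_box (Q : set 'rV[R]_(n + n)) : nbhs (0 : 'rV[R]_(n + n)) Q ->
  exists W : set 'rV[R]_(n + n), [/\ open W, W 0, W `<=` Q &
    let E := W `&` [set v | t0 < g (L v)] in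
    [/\ E !=set0, H0_trivial E & H1_trivial E]].
Proof.
move=> nQ; have L0 : L 0 = z0 by rewrite /L cplx_of0 addr0.
have nO : \forall v \near (0 : 'rV[R]_(n + n)), O (L v).
  exact: (near_continuous (@translate_continuous 0) L0 (near_open oO Oz0)).
have nD : \forall v \near (0 : 'rV[R]_(n + n)), 0 < rderive w0 g (L v).
  apply: (near_continuous (@translate_continuous 0) L0 (P := fun z => 0 < rderive w0 g z)).
  exact: (smooth_continuous (smooth_rderive w0 sg) Oz0 (lt_nbhsr w0g)).
have [d d0 dP] := nbhs0_ball (filterI nQ (filterI nO nD)).
have [j wj] := w_neq0.
pose l (v : 'rV[R]_(n + n)) := v ord0 j / w ord0 j.
pose q v := v - l v *: w.
have lD v (s : R) : l (v + s *: w) = l v + s.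
  by rewrite /l [(v + _) _ _]mxE [(s *: w) _ _]mxE mulrDl mulfK.
have lq v : l (q v) = 0 by rewrite /q -scaleNr lD subrr.
have qE v : v = q v + l v *: w by rewrite subrK.
have qD v (s : R) : q (v + s *: w) = q v.
  by rewrite /q lD scalerDl opprD addrACA subrr addr0.
have qq v : q (q v) = q v by rewrite {1}/q lq scale0r subr0.
have lc : continuous l.
  move=> v; apply: (@continuousM _ _ (fun v : 'rV[R]_(n + n) => v ord0 j) (cst _)).
    exact: coord_continuous.
  exact: cst_continuous.
have qc : continuous q.
  move=> v; apply: (@continuousB _ 'rV[R]_(n + n) _ (fun v => v) (fun v => l v *: w)).
    exact: cvg_id.
  by apply: continuousZr_tmp; exact: lc.
(* Displacements by at most 3 h along w and d / 4 across it stay in the ball of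
radius d. *)
pose h := d / (4 * (`|w| + 1)).
have w1 : 0 < `|w| + 1 by rewrite ltr_wpDl.
have h0 : 0 < h by rewrite divr_gt0// mulr_gt0.
have hh : `|h / 2| = h / 2 by rewrite gtr0_norm// divr_gt0.
have hd u (s : R) : `|u| < d / 4 -> `|s| <= 3 * h -> `|u + s *: w| < d.
  move=> ud sh; apply: le_lt_trans (ler_normD _ _) _; rewrite normrZ.
  have : `|s| * `|w| <= 3 * h * (`|w| + 1).
    by apply: ler_pM => //; rewrite lerDl.
  have -> : 3 * h * (`|w| + 1) = 3 / 4 * d by rewrite /h; field; rewrite gt_eqF.
  by move: ud; lra.
have incr u s1 s2 : `|u| < d / 4 -> `|s1| < h -> `|s2| < h -> s1 <= s2 ->
    g (L (u + s1 *: w)) <= g (L (u + s2 *: w)).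
  rewrite !ltr_norml => ud /andP[a1 b1] /andP[a2 b2] s12.
  have bound r : `|r| <= `|s2 - s1| -> `|u + s1 *: w + r *: w| < d.
    rewrite (@ger0_norm _ (s2 - s1)) ?subr_ge0// ler_norml => /andP[r1 r2].
    by rewrite -addrA -scalerDl; apply: hd => //; rewrite ler_norml; apply/andP; split; lra.
  have along_O r : `|r| <= `|s2 - s1| ->
      O (L (u + s1 *: w) + (r%:C : Cx R) *: w0).
    by move=> rs; rewrite -LD; have [_ [Or _]] := dP _ (bound r rs).
  have [r rs E] := mvt_along sg along_O.
  have [_ [_ Dr]] := dP _ (bound r rs); rewrite LD in Dr.
  rewrite -subr_ge0 (_ : L (u + s2 *: w) = L (u + s1 *: w) + ((s2 - s1)%:C : Cx R) *: w0).
    by rewrite E mulr_ge0 ?subr_ge0// ltW.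
  by rewrite -LD -addrA -scalerDl subrKC.
have L1c : {for (0 : 'rV[R]_(n + n)), continuous (fun u : 'rV[R]_(n + n) => g (L (u + (h / 2) *: w)))}.
  apply: (@continuous_comp _ _ _ (fun u : 'rV[R]_(n + n) => L (u + (h / 2) *: w)) g).
    apply: (@continuous_comp _ _ _ (fun u : 'rV[R]_(n + n) => u + (h / 2) *: w) L).
      apply: (@continuousD _ 'rV[R]_(n + n) _ (fun u => u)); first exact: cvg_id.
      exact: cst_continuous.
    exact: translate_continuous.
  apply: (smooth_continuous sg); rewrite add0r.
  have n0 : `|(0 : 'rV[R]_(n + n))| < d / 4 by rewrite normr0 divr_gt0.
  have := @hd 0 (h / 2) n0; rewrite add0r => H.
  have /H /dP[_ []//] : `|h / 2| <= 3 * h.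
  by rewrite hh; lra.
have top0 : t0 < g (L (h / 2 *: w)).
  have bound r : `|r| <= `|h / 2| -> `|r *: w| < d.
    rewrite hh => rh.
    have n0 : `|(0 : 'rV[R]_(n + n))| < d / 4 by rewrite normr0 divr_gt0.
    have := @hd 0 r n0; rewrite add0r; apply; lra.
  have along_O r : `|r| <= `|h / 2| -> O (L 0 + (r%:C : Cx R) *: w0).
    by move=> rs; rewrite -LD add0r; have [_ [Or _]] := dP _ (bound r rs).
  have [r rs E] := mvt_along sg along_O.
  have [_ [_]] := dP _ (bound r rs); rewrite -[r *: w]add0r LD => Dr.
  rewrite -[h / 2 *: w]add0r LD -subr_gt0 -gz0 -[in X in _ - X]L0 E mulr_gt0// divr_gt0//.
have ntop : \forall u \near (0 : 'rV[R]_(n + n)), t0 < g (L (u + h / 2 *: w)).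
  by apply: (near_continuous L1c _ (lt_nbhsr top0)); rewrite add0r.
have [e e0 eP] := nbhs0_ball ntop.
pose eta := Num.min e (d / 4).
have eta0 : 0 < eta by rewrite lt_min e0 divr_gt0.
have etaP (u : 'rV[R]_(n + n)) : `|u| < eta -> `|u| < e /\ `|u| < d / 4.
  by rewrite lt_min => /andP.
pose W : set 'rV[R]_(n + n) := [set v | `|l v| < h /\ `|q v| < eta].
have oW : open W.
  rewrite openE => v [vl vq]; apply: filterI.
    have c : {for v, continuous (fun v => `|l v|)}.
      by apply: (continuous_comp (lc v)); exact: norm_continuous.
    exact: (near_continuous c erefl (lt_nbhsl vl)).
  have c : {for v, continuous (fun v => `|q v|)}.
    by apply: (continuous_comp (qc v)); exact: norm_continuous.
  exact: (near_continuous c erefl (lt_nbhsl vq)).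
have WP v : W v -> `|v| < d.
  move=> [vl /etaP[_ vq]]; rewrite (qE v); apply: hd => //; lra.
pose E := W `&` [set v | t0 < g (L v)].
have oE : open E.
  rewrite openE => v [Wv gv]; apply: filterI.
    exact: (near_open oW Wv).
  have [_ [Ov _]] := dP _ (WP v Wv).
  have c : {for v, continuous (fun v => g (L v))}.
    apply: (@continuous_comp _ _ _ L g); first exact: translate_continuous.
    exact: (smooth_continuous sg Ov).
  exact: (near_continuous c erefl (lt_nbhsr gv)).
pose T v := q v + h / 2 *: w.
have Tc : continuous T.
  move=> v; apply: (@continuousD _ 'rV[R]_(n + n) _ q (cst _)); first exact: qc.
  exact: cst_continuous.
have slice u (s : R) : q u = u -> `|u| < eta -> `|s| < h -> t0 < g (L (u + s *: w)) ->
    E (u + s *: w).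
  move=> qu ue sh gu; split=> //; split; last by rewrite qD qu.
  by rewrite lD -[u]qu lq add0r.
have h2 : `|h / 2| < h by rewrite hh; lra.
have ET v : E v -> segment_in E (T v) v.
  move=> [[vl vq] gv] t /andP[t00 t1].
  have -> : T v + t *: (v - T v) = q v + (h / 2 + t * (l v - h / 2)) *: w.
    rewrite /T {2}(qE v) opprD addrACA subrr add0r -scaleNr -scalerDl scalerA -addrA.
    by rewrite -scalerDl.
  have [qe qd] := etaP _ vq.
  have := @convex_norm R R h _ _ t _ h2 vl; rewrite /GRing.scale /= t00 t1.
  have := min_segment (h / 2) (l v) t00 t1.
  set s := _ + _ => between /(_ isT) sh.
  apply: slice => //.
  move: between; rewrite ge_min => /orP[m|m].
    exact: lt_le_trans (eP _ qe) (incr _ _ _ qd h2 sh m).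
  apply: lt_le_trans (incr _ _ _ qd vl sh m).
  by rewrite -qE.
have Ep v : E v -> segment_in E (h / 2 *: w) (T v).
  move=> [[vl vq] gv] t /andP[t00 t1].
  have -> : h / 2 *: w + t *: (T v - h / 2 *: w) = t *: q v + h / 2 *: w.
    by rewrite /T addrK addrC.
  have qt : `|t *: q v| < eta.
    rewrite normrZ ger0_norm//; apply: le_lt_trans vq.
    by rewrite ler_piMl.
  apply: slice => //.
    by rewrite {1}/q {1}/l mxE -mulrA -/(l _) lq mulr0 scale0r subr0.
  exact: eP (etaP _ qt).1.
exists W; split=> //.
- by split; rewrite ?/q /l mxE mul0r ?scale0r ?subr0 normr0.
- by move=> v /WP/dP[].
split.
- exists (h / 2 *: w); rewrite -[_ *: w]add0r; apply: slice => //.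
  + by rewrite /q /l mxE mul0r scale0r subr0.
  + by rewrite normr0.
  + by rewrite add0r.
- exact: (segments_contraction_H0 (E := E) ET Ep).
- by apply: (segments_contraction_H1 (E := E) oE _ ET Ep) => v _; exact: Tc.
Qed.

End FlowBox.

(** * Critical points of the level *)

Section SaddleBox.
Variables (R : realType) (n p k : nat) (O : set (Cn R n)) (g : Cn R n -> R).
Variables (z0 : Cn R n) (t0 : R) (Bp : 'M[R]_(p, n + n)) (Bk : 'M[R]_(k, n + n)).
Local Notation B := (col_mx Bp Bk).
Local Notation L := (chart_line Bp Bk z0).
Hypotheses (Bfree : row_free B) (Bfull : row_full B).

Definition chart_line_inv (z : Cn R n) : 'rV[R]_(p + k) :=
  real_of (z - z0) *m pinvmx B.

Lemma chart_line_inv_continuous : continuous chart_line_inv.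
Proof.
move=> z; apply: (@continuous_comp _ _ _ (fun z : Cn R n => real_of (z - z0))
  (fun v : 'rV[R]_(n + n) => v *m pinvmx B)); last exact: mulmxr_cont.
apply: (@continuous_comp _ _ _ (fun z : Cn R n => z - z0) (@real_of R n)).
  apply: (@continuousB _ (Cn R n) _ (fun z => z)); first exact: cvg_id.
  exact: cst_continuous.
exact: real_of_continuous.
Qed.

Lemma chart_lineK : cancel L chart_line_inv.
Proof.
move=> v; rewrite /chart_line_inv /chart_line [z0 + _]addrC addrK cplx_ofK.
by rewrite -mulmxA mulmxVp// mulmx1.
Qed.

Lemma chart_line_invK : cancel chart_line_inv L.
Proof.
move=> z; rewrite /chart_line_inv /chart_line -mulmxA mulVpmx// mulmx1 real_ofK.
by rewrite subrKC.
Qed.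

Hypotheses (oO : open O) (sg : smooth_in O g) (Oz0 : O z0) (gz0 : g z0 = t0).
Hypotheses (crit : gradient_zero g z0) (p3 : (3 <= p)%N).
Hypothesis def : split_definite O Bp Bk g z0.

Lemma saddle_box (Q : set 'rV[R]_(p + k)) : nbhs (0 : 'rV[R]_(p + k)) Q ->
  exists W : set 'rV[R]_(p + k), [/\ open W, W 0, W `<=` Q &
    let E := W `&` [set v | t0 < g (L v)] in
    [/\ E !=set0, H0_trivial E & H1_trivial E]].
Proof.
move=> /nbhs0_ball[d d0 dP].
have [r r0 rP] := split_definite_near oO sg Oz0 def.
pose s := Num.min d r; have s0 : 0 < s by rewrite lt_min d0.
have sP v : `|v| < s -> split_definite O Bp Bk g (L v).
  by rewrite lt_min => /andP[_]; exact: rP.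
have sE := saddle_local sg crit gz0 s0 sP.
have [th th1] := unit_vector R (ltn_trans (isT : (0 < 2)%N) p3).
exists [set v | `|v| < s]; split.
- rewrite openE => v vs; exact: (norm_continuous (lt_nbhsl vs)).
- by rewrite /= normr0.
- by move=> v /=; rewrite lt_min => /andP[/dP].
split; last exact: (saddle_H1 sE p3 th1).
  exists (row_mx ((s / 2) *: th) 0); case: sE => _ _ _ _ /(_ ((s / 2) *: th)); apply.
    have th0 : th != 0 by rewrite -normr_eq0 th1 oner_eq0.
    by rewrite scaler_eq0 (negbTE th0) gt_eqF// divr_gt0.
  by rewrite normrZ th1 mulr1 gtr0_norm ?divr_gt0//; lra.
exact: (saddle_H0 sE p3 th1).
Qed.

End SaddleBox.

Section LevelPoints.
Variables (R : realType) (n : nat) (X : chartedSpace R n) (U : set X).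
Variables (rho : X -> R) (t0 : R) (oU : open U) (sm : smooth_on U rho).
Variables (x : X) (Ux : U x) (rx : rho x = t0).

(** Some directional derivative is nonzero in some chart, and reversing the
direction makes it positive. *)
Lemma noncritical_locally_simply_connected : ~ critical rho x ->
  locally_simply_connected_at (superlevel U rho t0) x.
Proof.
move=> ncrit.
have [a [aA ax [w0 w0g]]] : exists a, [/\ atlas a, cdom a x &
    exists w, 0 < rderive w (rho \o cinv a) (cmap a x)].
  apply: contrapT => no; apply: ncrit => a aA ax w.
  have Oz : chart_image U a (cmap a x) by exists x.
  apply/eqP/negPn/negP => w0; apply: no; exists a; split=> //.
  have [wp|wn] := ltP 0 (rderive w (rho \o cinv a) (cmap a x)); first by exists w.
  exists (((-1 : R)%:C : Cx R) *: w); rewrite (rderiveZ _ _ (sm aA) Oz) mulN1r oppr_gt0.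
  by rewrite lt_neqAle w0.
have Oz : chart_image U a (cmap a x) by exists x.
have e : (rho \o cinv a) (cmap a x) = t0 by rewrite /= cmapK.
apply: (@locally_simply_connected_chart _ _ _ _ _ t0 oU sm a x aA ax Ux _
  (fun v => cmap a x + cplx_of v) (fun z => real_of (z - cmap a x))).
- exact: translate_continuous.
- move=> z; apply: (@continuous_comp _ _ _ (fun z : Cn R n => z - cmap a x) (@real_of R n)).
    apply: (@continuousB _ (Cn R n) _ (fun z => z)); first exact: cvg_id.
    exact: cst_continuous.
  exact: real_of_continuous.
- by move=> v; rewrite [cmap a x + _]addrC addrK cplx_ofK.
- by move=> z; rewrite real_ofK subrKC.
- by rewrite cplx_of0 addr0.
exact: (flow_box (chart_image_open oU (a := a)) (sm aA) Oz e w0g).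
Qed.

(** The Hessian is negative on A and positive on its orthogonal. *)
Lemma split_definite_orthogonal a : atlas a -> cdom a x -> 
  let S := hessian (rho \o cinv a) (cmap a x) in
  S \in unitmx -> forall A, negative_on S A ->
  (forall A', negative_on S A' -> (\rank A' <= \rank A)%N) ->
  split_definite (chart_image U a) (row_base (form_orthogonal S A)) (row_base A)
    (rho \o cinv a) (cmap a x).
Proof.
move=> aA ax S Su A negA maxA.
have Oz : chart_image U a (cmap a x) by exists x.
have oO := chart_image_open oU (a := a).
have Ss : S^T = S := hessian_sym oO (sm aA) Oz.
have base0 m (M : 'M[R]_m) (u : 'rV[R]_(\rank M)) : u != 0 -> u *m row_base M != 0.
  apply: contra_neq => e; have := row_base_free M => /row_free_inj; apply.
  by rewrite e mul0mx.
have baseS m (M : 'M[R]_m) (u : 'rV[R]_(\rank M)) : (u *m row_base M <= M)%MS.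
  by apply: submx_trans (submxMl _ _) _; rewrite eq_row_base.
split=> // u u0; rewrite (rderive2E oO _ (sm aA) Oz) -/S.
  by apply: (orthogonal_gt0 Ss Su negA maxA); [exact: baseS|exact: base0].
by apply: negA; [exact: baseS|exact: base0].
Qed.

Lemma orthogonal_base m (S A : 'M[R]_m) : S^T = S -> S \in unitmx -> negative_on S A ->
  row_free (col_mx (row_base (form_orthogonal S A)) (row_base A)) /\
  row_full (col_mx (row_base (form_orthogonal S A)) (row_base A)).
Proof.
move=> Ss Su negA.
have rk : \rank (col_mx (row_base (form_orthogonal S A)) (row_base A)) = m.
  rewrite -addsmxE (adds_eqmx (eq_row_base _) (eq_row_base _)) addsmxC.
  exact/eqP/(orthogonal_full Ss Su negA).
split; last by rewrite /row_full rk.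
by rewrite /row_free rk addnC (orthogonal_rank Ss A Su).
Qed.

(** The index is at most n, which leaves at least 3 positive directions if n is
at least 3, or if n = 2 and the index is at most 1. *)
Lemma critical_locally_simply_connected : critical rho x -> strictly_psh_on U rho ->
  nondegenerate_at rho x -> (3 <= n)%N \/ n = 2%N /\ ~ morse_index rho x 2 ->
  locally_simply_connected_at (superlevel U rho t0) x.
Proof.
move=> crit psh nondeg nI.
have [a [aA ax p3]] : exists a, [/\ atlas a, cdom a x &
    forall A, negative_on (hessian (rho \o cinv a) (cmap a x)) A ->
     (forall A', negative_on (hessian (rho \o cinv a) (cmap a x)) A' ->
       (\rank A' <= \rank A)%N) -> (\rank A + 3 <= n + n)%N].
  case: nI => [n3|[n2 nidx]].
    have [a aA ax] := atlas_cover x; exists a; split=> // A negA _.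
    have [_ An] := negative_rank (psh x a Ux aA ax) negA; lia.
  apply: contrapT => no; apply: nidx => a aA ax.
  have [A negA maxA] := exists_max_negative (hessian (rho \o cinv a) (cmap a x)).
  have [_ An] := negative_rank (psh x a Ux aA ax) negA.
  have [A2|A2] := eqVneq (\rank A) 2%N; first by split; [exists A|rewrite -A2].
  exfalso; apply: no; exists a; split=> // A' negA' _.
  by have := maxA _ negA'; lia.
set S := hessian _ _ in p3.
have [A negA maxA] := exists_max_negative S.
have {}p3 := p3 A negA maxA.
have Oz : chart_image U a (cmap a x) by exists x.
have oO := chart_image_open oU (a := a).
have Ss : S^T = S := hessian_sym oO (sm aA) Oz.
have Su : S \in unitmx := nondeg a aA ax.
have [Bfree Bfull] := orthogonal_base Ss Su negA.
have e : (rho \o cinv a) (cmap a x) = t0 by rewrite /= cmapK.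
have rkP := orthogonal_rank Ss A Su.
apply: (@locally_simply_connected_chart _ _ _ _ _ t0 oU sm a x aA ax Ux _
  (chart_line (row_base (form_orthogonal S A)) (row_base A) (cmap a x))
  (chart_line_inv (cmap a x) (row_base (form_orthogonal S A)) (row_base A))).
- exact: chart_line_continuous.
- exact: chart_line_inv_continuous.
- exact: chart_lineK.
- exact: chart_line_invK.
- exact: chart_line0.
have P3 : (3 <= \rank (form_orthogonal S A))%N by lia.
move=> Q nQ.
have := saddle_box oO (sm aA) Oz e (crit a aA ax) P3
  (split_definite_orthogonal aA ax Su negA maxA) nQ.
exact.
Qed.

End LevelPoints.

(** * Extension near the whole level *)

Section Extensions.
Variables (R : realType) (n : nat) (X : complexManifold R n).
Variables (U G S : set X) (N : lineBundle U) (H : cochain X (Cx R)).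
Hypotheses (oG : open G) (GU : G `<=` U) (HN : is_logarithm N G H).

Lemma extension_of_log_extension gam (f : cidx H -> X -> Cx R) F B F' :
  set_frames (N := N) gam ->
  (forall i x, ccov H i x -> hol_eq x (f i) (F x)) ->
  (forall i j x, ccov H i x -> ccov H j x -> cval H i j x = f i x - f j x) ->
  S `<=` B -> log_extension gam G F B F' ->
  exists H', is_extension U G H S B H' /\ is_logarithm N (G `|` B) H'.
Proof.
move=> gamP fF HE SB [oB BU F'P F'F].
have oGB : open (G `|` B) by exact: openU.
have GBU : G `|` B `<=` U by move=> y [/GU|/BU].
have [H' [logH' resH']] := structure_cochain gamP (@cm_countable _ _ X) oGB GBU F'P.
exists H'; split=> //; split=> //; first by case: logH'.
have [H1 _] := HN.
apply: (resH' G H f oG _ H1 HE); first by move=> y; left.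
move=> i x ix; have Gx : G x by have [_ <- _ _] := H1; exists i.
exact: hol_eq_trans (fF i x ix) (hol_eq_sym (F'F x Gx)).
Qed.

Lemma extension_near_compact : compact S -> S `<=` U ->
  (forall x, S x -> locally_simply_connected_at G x) ->
  exists (B : set X) (H' : cochain X (Cx R)),
    is_extension U G H S B H' /\ is_logarithm N (G `|` B) H'.
Proof.
move=> cS SU good.
have [gam [f [F [gamP FP fF HE]]]] := logarithm_structure oG GU HN.
have [B [F' [SB BF']]] := extend_to_neighborhood gamP
  (@cm_hausdorff _ _ X) oG FP cS SU good.
by exists B; apply: extension_of_log_extension gamP fF HE SB BF'.
Qed.

End Extensions.

Lemma logarithm_extends_near_level (R : realType) (n : nat) (X : complexManifold R n)
    (U : set X) (rho : X -> R) (t0 : R) (N : lineBundle U) (H : cochain X (Cx R)) :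
  open U -> smooth_on U rho -> strictly_psh_on U rho -> morse_on U rho ->
  compact (level U rho t0) -> is_logarithm N (superlevel U rho t0) H ->
  (3 <= n)%N \/
     n = 2%N /\ (forall x, level U rho t0 x -> critical rho x -> ~ morse_index rho x 2) ->
   exists (B : set X) (H' : cochain X (Cx R)),
     is_extension U (superlevel U rho t0) H (level U rho t0) B H' /\
     is_logarithm N (superlevel U rho t0 `|` B) H'.
Proof.
move=> oU sm psh morse cS HN nI.
apply: extension_near_compact => //.
- exact: superlevel_open.
- by move=> x [].
- by move=> x [].
move=> x [Ux rx]; have [crit|ncrit] := pselect (critical rho x); last first.
  exact: noncritical_locally_simply_connected.
apply: critical_locally_simply_connected => //; first exact: morse.
by case: nI => [|[n2 nidx]]; [left|right; split=> //; exact: nidx].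
Qed.

(** * Complex linear coordinates and holomorphic maps *)

Section ComplexLinear.
Variables (R : realType) (n : nat) (B : 'M[R]_(n + n)).

Definition linear_part (z : Cn R n) : Cn R n := cplx_of (real_of z *m B).

Lemma linear_part_continuous : continuous linear_part.
Proof.
move=> z; apply: (@continuous_comp _ _ _ (fun z => real_of z *m B) (@cplx_of R n)).
  apply: (@continuous_comp _ _ _ (@real_of R n) (fun v => v *m B)).
    exact: real_of_continuous.
  exact: mulmxr_cont.
exact: cplx_of_continuous.
Qed.

Hypothesis JB : Jmx R n *m B = B *m Jmx R n.

Lemma real_ofD (z w : Cn R n) : real_of (z + w) = real_of z + real_of w.
Proof. by rewrite -{1}[z]real_ofK -{1}[w]real_ofK -cplx_ofD cplx_ofK. Qed.

Lemma real_of_iZ (z : Cn R n) : real_of (('i : Cx R) *: z) = real_of z *m Jmx R n.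
Proof. by rewrite -{1}[z]real_ofK -cplx_of_Jmx cplx_ofK. Qed.

Lemma real_of_rZ (c : R) (z : Cn R n) : real_of ((c%:C : Cx R) *: z) = c *: real_of z.
Proof. by rewrite -{1}[z]real_ofK -cplx_ofZ cplx_ofK. Qed.

(** A real linear map that commutes with multiplication by i is complex linear.
*)
Lemma linear_partP : linear linear_part.
Proof.
have cE (c : Cx R) (z : Cn R n) :
    c *: z = ((complex.Re c)%:C : Cx R) *: z + ((complex.Im c)%:C : Cx R) *: (('i : Cx R) *: z).
  by rewrite scalerA -scalerDl mulrC -complexE.
move=> c z w; rewrite {1}/linear_part cE !real_ofD !real_of_rZ real_of_iZ.
rewrite !mulmxDl -!scalemxAl -mulmxA JB mulmxA !cplx_ofD !cplx_ofZ cplx_of_Jmx.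
by rewrite -cE.
Qed.

Lemma linear_part_differentiable (z : Cn R n) : differentiable linear_part z.
Proof.
pose f : {linear Cn R n -> Cn R n} :=
  HB.pack linear_part (GRing.isLinear.Build _ _ _ _ linear_part linear_partP).
exact: (@linear_differentiable _ _ _ f z linear_part_continuous).
Qed.

End ComplexLinear.

Lemma holomorphic_map_cont (R : realType) (n m : nat) (X : chartedSpace R n)
    (Y : chartedSpace R m) (V : set X) (f : X -> Y) x :
  open V -> holomorphic_map V f -> V x -> {for x, continuous f}.
Proof.
move=> oV [fc _] Vx; move: fc.
by rewrite (continuous_open_subspace _ oV); apply; rewrite inE.
Qed.

Section HolomorphicMaps.
Variables (R : realType) (n m : nat) (X : chartedSpace R n) (Y : chartedSpace R m).

Lemma hol_germ_pullback (V : set X) (f : X -> Y) (h : Y -> Cx R) x : open V ->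
  holomorphic_map V f -> V x -> hol_germ h (f x) -> hol_germ (h \o f) x.
Proof.
move=> oV fhol Vx hx; have [_ fd] := fhol.
have fcy y : V y -> {for y, continuous f} := holomorphic_map_cont oV fhol.
have nh : \forall y \near x, holomorphic_at h (f y) by exact: fcy hx.
apply: filterS2 nh (near_open oV Vx) => y hy Vy a aA ay.
have [b bA by_] := atlas_cover (f y).
have d1 := fd y a b Vy aA ay bA by_.
have d2 := hy b bA by_.
have yE : (cmap b \o f \o cinv a) (cmap a y) = cmap b (f y) by rewrite /= cmapK.
rewrite -yE in d2; apply: (differentiable_near _ (differentiable_comp d1 d2)).
have nb : \forall w \near y, cdom b (f w) by exact: fcy (near_cdom by_).
have := near_continuous (cinv_continuous_at ay) (cmapK ay) nb.
by apply: filterS => z zb /=; rewrite cmapK.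
Qed.

End HolomorphicMaps.

(** * Splitting integer cocycles *)

Section Pullback.
Variables (S T : topologicalType) (f : S -> T).

Lemma same_germ_pullback x a b : {for x, continuous f} ->
  same_germ (f x) a b -> same_germ x (a \o f) (b \o f).
Proof. by move=> fc ab; exact: fc ab. Qed.

Lemma int_structure_pullback (E : set S) (G : set T) m :
  (forall x, E x -> {for x, continuous f}) ->
  (forall x, E x -> G (f x)) -> open E -> int_structure G m ->
  int_structure E (fun x => m (f x) \o f).
Proof.
move=> fc fE oE mG x Ex.
have nm : \forall y \near x, same_germ (f y) (m (f x)) (m (f y)).
  exact: fc Ex _ (mG _ (fE _ Ex)).
apply: filterS2 nm (near_open oE Ex) => y my Ey.
exact: same_germ_pullback (fc _ Ey) my.
Qed.

End Pullback.

(** The values of the cocycle at the pairs of an arbitrary index and one chosen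
at each point split it by functions on the whole space. *)
Lemma int_cocycle_split (T : topologicalType) (G : set T) (c : cochain T int) :
  H1 (Zsheaf T) G c -> exists (al : cidx c -> T -> int) (m : T -> T -> int),
  [/\ forall i j x, ccov c i x -> ccov c j x -> cval c i j x = al i x - al j x,
      forall i x, ccov c i x -> same_germ x (al i) (m x) &
      int_structure G m].
Proof.
move=> [/= oc cG cl cm].
have [k kP] : {k : T -> option (cidx c) & forall x,
    if k x is Some j then ccov c j x else ~ G x}.
  apply: (choice (P := fun x k => if k is Some j then ccov c j x else ~ G x)) => x.
  have [Gx|nG] := pselect (G x); last by exists None.
  by move: Gx; rewrite -cG => -[j _ jx]; exists (Some j).
have cGx i x : ccov c i x -> G x by move=> ix; rewrite -cG; exists i.
pose al i y := if k y is Some j then cval c i j y else 0.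
pose m x := if k x is Some j then al j else fun=> 0.
have alE i j x : ccov c i x -> ccov c j x -> cval c i j x = al i x - al j x.
  move=> ix jx; rewrite /al; move: (kP x); case: (k x) => [p px|/(_ (cGx _ _ ix))//].
  by rewrite -(cm i j p x ix jx px) addrK.
have al_eq i j x : ccov c i x -> ccov c j x -> same_germ x (al i) (al j).
  move=> ix jx; apply: filterS3 (cl i j x (conj ix jx)) (near_open (oc i) ix) (near_open (oc j) jx).
  by move=> y + iy jy; rewrite !alE.
have al_m i x : ccov c i x -> same_germ x (al i) (m x).
  move=> ix; rewrite /m; move: (kP x); case: (k x) => [p px|/(_ (cGx _ _ ix))//].
  exact: al_eq.
exists al, m; split=> // x Gx.
have [j kx jx] : exists2 j, k x = Some j & ccov c j x.
  by move: (kP x); case: (k x) => [j|//]; exists j.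
apply: filterS (near_open (oc j) jx) => y jy.
by rewrite /m kx; exact: al_m.
Qed.

Lemma same_germ_interval (R : realType) (b h : R -> int) (s t : R) : s <= t ->
  (forall r : R, s <= r <= t -> same_germ r b h) -> b t - h t = b s - h s.
Proof.
move=> st bh.
have lc : locally_constant [set r | s <= r <= t] (fun r => b r - h r) by move=> r /bh.
apply/esym; apply: (@locally_constant_segment R R _ _ s t lc) => r /andP[r0 r1].
rewrite /= /GRing.scale /=; apply/andP; split.
  by rewrite lerDl mulr_ge0// subr_ge0.
have -> : t = s + 1 * (t - s) by rewrite mul1r subrKC.
by rewrite lerD2l addrAC subrr add0r mul1r ler_piMl// subr_ge0.
Qed.

(** * The monodromy of the generator on the punctured box *)

Section StandardBox.
Variable R : realType.
Local Notation C2 := (CnSpace R 2).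
Implicit Types (z : Cn R 2) (v : 'rV[R]_(2 + 2)).

Lemma K2P z : @K2 R z <-> `|real_of z| < 1.
Proof.
split=> [zK|/rV_norm_ltP-/(_ ltr01) zK j].
  apply/rV_norm_ltP => // j; rewrite mxE.
  by case: (fintype.split j) => i; rewrite mxE; have [] := zK i.
have := zK (lshift 2 j); have := zK (rshift 2 j).
by rewrite /real_of row_mxEl row_mxEr !mxE.
Qed.

Lemma K2_open : open (@K2 R).
Proof.
rewrite openE => z /K2P z1.
have nc : {for z, continuous (fun z : Cn R 2 => `|real_of z|)}.
  apply: (@continuous_comp _ _ _ (@real_of R 2)); first exact: real_of_continuous.
  exact: norm_continuous.
have := near_continuous nc erefl (lt_nbhsl z1).
by apply: filterS => w /K2P.
Qed.

Definition punctured_box : set 'rV[R]_(2 + 2) :=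
  [set v | `|v| < 1 /\ lsubmx v != 0].

Lemma DsetP z : @Dset R z <-> punctured_box (real_of z).
Proof.
split=> [[/K2P zK z0]|[/K2P zK z0]]; split=> //.
  apply/eqP => /rowP z00; apply: z0 => j.
  by have := z00 j; rewrite /real_of row_mxKl !mxE.
move=> z00; move/eqP: z0; apply; apply/rowP => j.
by rewrite /real_of row_mxKl !mxE; exact: z00.
Qed.

Lemma saddle_punctured_box : saddle 1 punctured_box.
Proof.
split=> //.
- rewrite openE => v [v1 v0]; apply: filterI.
    exact: (norm_continuous (lt_nbhsl v1)).
  have c : {for v, continuous (fun v : 'rV[R]_(2 + 2) => `|lsubmx v|)}.
    apply: (continuous_comp (@continuous_lsubmx _ _ _ _ v)); exact: norm_continuous.
  have l0 : 0 < `|lsubmx v| by rewrite normr_gt0.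
  have := near_continuous c erefl (lt_nbhsr l0).
  by apply: filterS => w; rewrite /= normr_gt0.
- move=> v [v1 v0]; split=> //; move: v1; rewrite -{1}[v]hsubmxK.
  by move=> /norm_row_mx_lt-/(_ ltr01)[].
- move=> v t [v1 v0] /andP[t0 t1]; rewrite -[v]hsubmxK in v1.
  have [lv rv] := (norm_row_mx_lt _ _ ltr01).1 v1.
  split; last by rewrite row_mxKl.
  apply/norm_row_mx_lt => //; split=> //; rewrite normrZ ger0_norm//.
  by apply: le_lt_trans rv; rewrite ler_piMl.
- move=> u u0 u1; split; last by rewrite row_mxKl.
  by apply/norm_row_mx_lt => //; rewrite normr0.
Qed.

Lemma slit_right (E : set 'rV[R]_(2 + 2)) v : E v -> lsubmx v != 0 ->
  0 <= lsubmx v ord0 ord0 -> slit E (e1 R) v.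
Proof.
move=> Ev v0 v1; split=> //=; apply: contra_neq v0 => e.
have := congr1 (fun u : 'rV[R]_2 => u ord0 ord0) e; rewrite !mxE mulr1.
move=> e0.
have : 0 <= `|lsubmx v| by [].
move: v1 e0; rewrite mxE => v1 e0 n0; apply/eqP; rewrite -normr_eq0; apply/eqP.
by move: v1 e0 n0; lra.
Qed.

Lemma slit_left (E : set 'rV[R]_(2 + 2)) v : E v ->
  lsubmx v ord0 ord0 < 0 -> slit E (- e1 R) v.
Proof.
move=> Ev v1; split=> //=; apply/eqP => e.
have := congr1 (fun u : 'rV[R]_2 => u ord0 ord0) e; rewrite !mxE mulrN1.
have : 0 <= `|lsubmx v| by [].
by move: v1; rewrite mxE; lra.
Qed.

Let loop (t : R) : 'rV[R]_(2 + 2) := real_of (@Cloop R t).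

Let loop_left t : lsubmx (loop t) ord0 ord0 = cos (2 * pi * t) / Num.sqrt 2.
Proof. by rewrite /loop /real_of row_mxKl !mxE. Qed.

Let loop_height t : height (loop t) = sin (2 * pi * t) / Num.sqrt 2.
Proof. by rewrite /height /loop /real_of row_mxKl !mxE. Qed.

Let sqrt2 : 0 < (Num.sqrt 2)^-1 :> R.
Proof. by rewrite invr_gt0 sqrtr_gt0. Qed.

Let Cloop_continuous : continuous (@Cloop R).
Proof.
move=> t; apply: matrix_continuous => i j.
rewrite (_ : (fun t => _) = fun t => ((if j == ord0 then cos (2 * pi * t)
   else sin (2 * pi * t)) / Num.sqrt 2)%:C : Cx R); last first.
  by apply/funext => s; rewrite mxE.
apply: (@continuous_comp _ _ _ (fun t => (if j == ord0 then cos (2 * pi * t)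
   else sin (2 * pi * t)) / Num.sqrt 2) (fun a : R => a%:C : Cx R)); last first.
  exact: real_complex_continuous.
have mc : {for t, continuous (fun t : R => 2 * pi * t)}.
  by apply: continuousM; [exact: cst_continuous|exact: cvg_id].
apply: continuousM; last exact: cst_continuous.
case: (j == ord0).
  by apply: (continuous_comp mc); exact: continuous_cos.
by apply: (continuous_comp mc); exact: continuous_sin.
Qed.

Let loop_continuous : continuous loop.
Proof.
move=> t; apply: (continuous_comp (@Cloop_continuous t)); exact: real_of_continuous.
Qed.

Let Cloop01 : @Cloop R 1 = @Cloop R 0.
Proof.
have e : 2 * pi * 1 = pi *+ 2 :> R by rewrite mulr1 mulr_natl.
by apply/rowP => j; rewrite !mxE e cos2pi sin2pi mulr0 cos0 sin0.
Qed.

Let cos_right (t : R) : 0 <= t <= 1 / 4 \/ 3 / 4 <= t <= 1 -> 0 <= cos (2 * pi * t).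
Proof.
have p0 := pi_gt0 R; case=> /andP[t1 t2].
  have a1 : 0 <= pi * t by rewrite mulr_ge0// ltW.
  have a2 : 0 <= pi * (1 / 4 - t) by rewrite mulr_ge0 ?subr_ge0// ltW.
  by apply: cos_ge0_pihalf; apply/andP; split; lra.
have -> : cos (2 * pi * t) = cos (2 * pi * (t - 1)).
  by rewrite -[in RHS]cosD2pi; congr cos; ring.
have a1 : 0 <= pi * (t - 3 / 4) by rewrite mulr_ge0 ?subr_ge0// ltW.
have a2 : 0 <= pi * (1 - t) by rewrite mulr_ge0 ?subr_ge0// ltW.
by apply: cos_ge0_pihalf; apply/andP; split; lra.
Qed.

Let cos_left (t : R) : 1 / 4 < t -> t < 3 / 4 -> cos (2 * pi * t) < 0.
Proof.
move=> t1 t2; have -> : cos (2 * pi * t) = - cos (2 * pi * t - pi).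
  by rewrite -[in LHS](subrK pi (2 * pi * t)) cosDpi.
have p0 := pi_gt0 R.
have a1 : 0 < pi * (t - 1 / 4) by rewrite mulr_gt0 ?subr_gt0.
have a2 : 0 < pi * (3 / 4 - t) by rewrite mulr_gt0 ?subr_gt0.
by rewrite oppr_lt0; apply: cos_gt0_pihalf; apply/andP; split; lra.
Qed.

Variables (A : cochain C2 int) (al : cidx A -> C2 -> int) (m : C2 -> C2 -> int).
Variable j : int.
Hypothesis AE : forall i i' z, ccov A i z -> ccov A i' z ->
  cval A i i' z = al i z - al i' z.
Hypothesis alm : forall i z, ccov A i z -> same_germ z (al i) (m z).
Hypothesis AD : forall i z, ccov A i z -> @Dset R z.
Hypothesis mj : has_jump punctured_box (fun v w => m (cplx_of v) (cplx_of w)) j.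

(** The function b continues f along the circle, through g + j on the left
half, and arrives at f + j. On each piece of the subdivision b differs by a
constant from the function that splits the cocycle there, so the sum telescopes
to the total increment of b. *)
Lemma loop_pairing_jump p : loop_pairing A (@Cloop R) p -> p = j.
Proof.
move=> [k [s [i [[s0 s1] smono ii cov ->]]]].
have [f [g [fP gP fg_gt fg_lt]]] := mj.
pose b (t : R) : int := if t < 1 / 4 then f (loop t) else
  if t < 3 / 4 then g (loop t) + j else f (loop t) + j.
have boxP q t : ccov A q (@Cloop R t) -> punctured_box (loop t).
  by move=> /AD/DsetP.
have along_germ (h : 'rV[R]_(2 + 2) -> int) (c : int) q t : ccov A q (@Cloop R t) ->
    same_germ (loop t) h (fun w => m (cplx_of (loop t)) (cplx_of w)) ->
    (\forall r \near t, h (loop r) + c = b r) -> same_germ t b (fun r => al q (@Cloop R r)).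
  move=> tq hm hb.
  have h1 := same_germ_pullback (@loop_continuous t) hm.
  have h2 := same_germ_pullback (@Cloop_continuous t) (alm tq).
  have h3 : same_germ t (h \o loop) (al q \o @Cloop R).
    apply: same_germ_trans h1 _; apply: same_germ_sym; apply: filterS h2 => r /=.
    by rewrite /loop !real_ofK.
  apply: (same_germ_eql hb).
  apply: same_germ_trans h3; apply: same_germ_sym; exact: same_germ_addr.
have near_height t x : height (loop t) = x -> forall P : R -> Prop,
    (\forall y \near x, P y) -> \forall r \near t, P (height (loop r)).
  move=> tx P Px; apply: (@near_continuous _ _ (fun r => height (loop r)) t x P _ tx Px).
  apply: (@continuous_comp _ _ _ loop (@height R 2)); first exact: loop_continuous.
  apply: (@continuous_comp _ _ _ (fun v : 'rV[R]_(2 + 2) => lsubmx v)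
    (fun u : 'rV[R]_2 => u ord0 ord_max)); first exact: continuous_lsubmx.
  exact: coord_continuous.
have near_box t : punctured_box (loop t) -> \forall r \near t, punctured_box (loop r).
  move=> bt; apply: (near_continuous (@loop_continuous t) erefl).
  by apply: open_nbhs_nbhs; split=> //; have [] := saddle_punctured_box.
have b_germ q t : 0 <= t <= 1 -> ccov A q (@Cloop R t) ->
    same_germ t b (fun r => al q (@Cloop R r)).
  move=> /andP[t0 t1] tq; have bt := boxP _ _ tq; have [_ l0] := bt.
  have right_f : 0 <= cos (2 * pi * t) ->
      same_germ (loop t) f (fun w => m (cplx_of (loop t)) (cplx_of w)).
    by move=> ct; apply/fP/slit_right; rewrite ?loop_left ?mulr_ge0// ltW.
  have [t14|t14|t14] := ltgtP t (1 / 4).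
  - have ct : 0 <= cos (2 * pi * t) by apply: cos_right; left; lra.
    apply: (along_germ f 0 _ _ tq (right_f ct)).
    by apply: filterS (lt_nbhsl t14) => r rt; rewrite /b rt addr0.
  - have [t34|t34|t34] := ltgtP t (3 / 4).
    + apply: (along_germ g j _ _ tq).
        by apply/gP/slit_left; rewrite ?loop_left ?pmulr_llt0//; exact: cos_left.
      apply: filterS2 (lt_nbhsl t34) (lt_nbhsr t14) => r r1 r2.
      by rewrite /b r1 ltNge (ltW r2).
    + have ct : 0 <= cos (2 * pi * t) by apply: cos_right; right; lra.
      apply: (along_germ f j _ _ tq (right_f ct)).
      by apply: filterS (lt_nbhsr t34) => r rt; rewrite /b !ltNge (ltW rt) (ltW (lt_trans _ rt))//; lra.
    + have ct : 0 <= cos (2 * pi * t) by apply: cos_right; right; lra.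
      apply: (along_germ f j _ _ tq (right_f ct)).
      have st : height (loop t) < 0.
        rewrite loop_height pmulr_llt0// t34.
        have -> : 2 * pi * (3 / 4) = pi / 2 + pi :> R by field.
        by rewrite sinDpi sin_pihalf; lra.
      apply: filterS3 (near_height _ _ erefl _ (lt_nbhsl st)) (near_box _ bt) (lt_nbhsr t14).
      move=> r hr br r2; rewrite /b ltNge (ltW r2) /=.
      by case: ifP => // _; rewrite fg_lt.
  - have ct : 0 <= cos (2 * pi * t) by apply: cos_right; left; lra.
    apply: (along_germ f 0 _ _ tq (right_f ct)).
    have st : 0 < height (loop t).
      rewrite loop_height pmulr_lgt0// t14.
      have -> : 2 * pi * (1 / 4) = pi / 2 :> R by field.
      by rewrite sin_pihalf; lra.
    have t34 : t < 3 / 4 by lra.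
    apply: filterS3 (near_height _ _ erefl _ (lt_nbhsr st)) (near_box _ bt) (lt_nbhsl t34).
    move=> r hr br r2; rewrite /b r2 addr0.
    by case: ifP => // _; rewrite fg_gt.
have sle q q' : (q <= q')%N -> (q' <= k.+1)%N -> s q <= s q'.
  elim: q' => [|q' IH]; first by rewrite leqn0 => /eqP->.
  rewrite leq_eqVlt => /orP[/eqP->//|]; rewrite ltnS => qq' qk.
  exact: le_trans (IH qq' (ltnW qk)) (smono _ qk).
have s01 q : (q <= k.+1)%N -> 0 <= s q <= 1.
  by move=> qk; rewrite -s0 -s1 !sle.
have cov_end q : (q <= k)%N -> ccov A (i q) (@Cloop R (s q)) /\
    ccov A (i q) (@Cloop R (s q.+1)).
  by move=> qk; split; apply: cov => //; rewrite lexx ?andbT smono.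
have cov_next q : (q <= k)%N -> ccov A (i q.+1) (@Cloop R (s q.+1)).
  rewrite leq_eqVlt => /orP[/eqP->|qk]; last exact: (cov_end q.+1 qk).1.
  by rewrite ii s1 Cloop01 -s0; exact: (cov_end 0%N _).1.
(* The terms of the pairing are the increments of Phi. *)
pose Phi q := b (s q) - al (i q) (@Cloop R (s q)).
rewrite (eq_big_nat _ _ (F2 := fun q => Phi q.+1 - Phi q)); last first.
  move=> q /andP[_]; rewrite ltnS => qk.
  have [c1 c2] := cov_end q qk.
  rewrite (AE c2 (cov_next q qk)).
  have e : b (s q.+1) - al (i q) (@Cloop R (s q.+1)) = Phi q.
    apply: (@same_germ_interval R b (fun r => al (i q) (@Cloop R r))); first exact: smono.
    move=> r rq; apply: b_germ; last exact: cov rq.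
    have /andP[r1 _] := s01 q (leqW qk); have /andP[_ r2] := s01 q.+1 qk.
    by have /andP[r3 r4] := rq; rewrite (le_trans r1 r3) (le_trans r4 r2).
  by rewrite -e /Phi; ring.
rewrite telescope_sumr// /Phi ii s0 s1 Cloop01 /b.
have -> : (1 < 1 / 4 :> R) = false by lra.
have -> : (1 < 3 / 4 :> R) = false by lra.
have -> : (0 < 1 / 4 :> R) by lra.
by rewrite /loop Cloop01; ring.
Qed.

End StandardBox.

(** * Coordinates at a critical point of index two *)

Section ComplexSplitting.
Variables (R : realType) (n : nat) (O : set (Cn R n)) (g : Cn R n -> R) (z0 : Cn R n).
Hypotheses (oO : open O) (sg : smooth_in O g) (Oz0 : O z0).
Hypothesis L : levi_positive g z0.
Variable Bk : 'M[R]_(n, n + n).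
Hypothesis neg : forall v, v != 0 -> rderive2 (v *m Bk) g z0 < 0.

(** The product of Bk with - i, so that the real linear map with rows Bp and Bk
sends x + i y to a complex linear expression in it. *)
Definition turned : 'M[R]_(n, n + n) := - (Bk *m Jmx R n).
Local Notation Bp := turned.
Local Notation B := (col_mx Bp Bk).

Lemma turned_commute : Jmx R n *m B = B *m Jmx R n.
Proof.
rewrite [Jmx R n *m _]mul_block_col mul_col_mx !mul0mx !mul1mx add0r addr0 mulNmx mul1mx.
by rewrite /turned opprK mulNmx -mulmxA Jmx_sqr mulmxN mulmx1 opprK.
Qed.

Lemma rderive2N v : rderive2 (- v) g z0 = rderive2 v g z0.
Proof.
rewrite !(rderive2E oO _ sg Oz0) /qform mulNmx linearN /= mulNmx mulmxN.
by rewrite opprK.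
Qed.

(** If v is a negative direction, i v is a positive one by the Levi condition.
*)
Lemma turned_pos u : u != 0 -> 0 < rderive2 (u *m Bp) g z0.
Proof.
move=> u0; have ng := neg u0.
have uB0 : u *m Bk != 0.
  apply: contraTneq ng => ->; rewrite (rderive2E oO _ sg Oz0).
  by rewrite /qform !mul0mx mxE ltxx.
have := levi_hessian (cplx_of_Jmx (u *m Bk)) uB0 L.
rewrite /turned mulmxN rderive2N mulmxA; move: ng.
rewrite !(rderive2E oO _ sg Oz0) /qform; lra.
Qed.

Lemma turned_free : row_free B.
Proof.
apply/inj_row_free => v; rewrite -[v]hsubmxK mul_row_col => /eqP.
rewrite addr_eq0 => /eqP e.
have [u0|u0] := eqVneq (lsubmx v) 0; last first.
  have := turned_pos u0; rewrite e rderive2N.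
  have [w0|w0] := eqVneq (rsubmx v) 0; last by move/lt_trans/(_ (neg w0)); rewrite ltxx.
  by rewrite w0 mul0mx (rderive2E oO _ sg Oz0) /qform !mul0mx mxE ltxx.
have [w0|w0] := eqVneq (rsubmx v) 0; first by rewrite u0 w0 row_mx0.
have := neg w0; rewrite -rderive2N -e u0 mul0mx.
by rewrite (rderive2E oO _ sg Oz0) /qform !mul0mx mxE ltxx.
Qed.

End ComplexSplitting.

Section SaddleChart.
Variables (R : realType) (X : chartedSpace R 2) (U : set X).
Variables (rho : X -> R) (t0 : R) (oU : open U) (sm : smooth_on U rho).
Variables (c : X) (Uc : U c) (rc : rho c = t0).
Hypotheses (psh : strictly_psh_on U rho) (crit : critical rho c).
Hypothesis idx : morse_index rho c 2.
Local Notation C2 := (CnSpace R 2).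

(** Let l1, l2 span the negative plane at c. Over the complex numbers - i l1
and - i l2 are a basis of C^2; in the corresponding coordinates the real parts
run along positive directions and the imaginary parts along negative ones, and
the standard box is the unit ball of the maximum norm. *)
Lemma saddle_chart (Q : set X) : nbhs c Q -> exists V (phi : X -> C2) (psi : C2 -> X),
  [/\ open V, V c, V `<=` Q `&` U, biholomorphism V (@K2 R) phi psi &
      saddle 1 [set v : 'rV[R]_(2 + 2) | `|v| < 1 /\ t0 < rho (psi (cplx_of v))]].
Proof.
move=> nQ; have [a aA ac] := atlas_cover c.
set g := rho \o cinv a; pose O := chart_image U a; pose z0 := cmap a c.
have oO : open O := chart_image_open oU (a := a).
have Oz0 : O z0 by exists c.
have sg : smooth_in O g := sm aA.
have Lg : levi_positive g z0 := psh Uc aA ac.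
have [[A negA rA] _] := idx aA ac.
have [Bk0 neg] : exists Bk0 : 'M[R]_(2, 2 + 2),
    forall v, v != 0 -> rderive2 (v *m Bk0) g z0 < 0.
  suff [Bk0 Bfree BA] : exists2 Bk0 : 'M[R]_(2, 2 + 2), row_free Bk0 & (Bk0 <= A)%MS.
    exists Bk0 => v v0; rewrite (rderive2E oO _ sg Oz0); apply: negA.
      exact: submx_trans (submxMl _ _) BA.
    by apply: contra_neq v0 => e; apply: (row_free_inj Bfree); rewrite e mul0mx.
  have : (row_base A <= A)%MS by rewrite eq_row_base.
  move: (row_base A) (row_base_free A); rewrite rA => Bk0 Bfree BA.
  by exists Bk0.
pose Bp0 := turned Bk0.
have def0 : split_definite O Bp0 Bk0 g z0.
  by split; [exact: Oz0|exact: (turned_pos oO sg Oz0 Lg neg)|exact: neg].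
have [r1 r10 r1P] := split_definite_near oO sg Oz0 def0.
have nQ' : \forall v \near (0 : 'rV[R]_(2 + 2)), Q (cinv a (chart_line Bp0 Bk0 z0 v)).
  apply: (near_continuous (@chart_line_continuous _ _ _ _ Bp0 Bk0 z0 0)
    (chart_line0 _ _ _) (P := fun z => Q (cinv a z))).
  exact: (near_continuous (cinv_continuous_at ac) (cmapK ac)).
have [r2 r20 r2P] := nbhs0_ball nQ'.
pose r := Num.min r1 r2; have r0 : 0 < r by rewrite lt_min r10.
have rr (v : 'rV[R]_(2 + 2)) : `|v| < 1 -> `|r *: v| < r1 /\ `|r *: v| < r2.
  move=> v1; apply/andP; rewrite -lt_min -/r normrZ gtr0_norm//.
  by rewrite -[X in _ < X]mulr1 ltr_pM2l.
pose Bk := r *: Bk0; pose Bp := turned Bk; pose B := col_mx Bp Bk.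
have BpE : Bp = r *: Bp0 by rewrite /Bp /turned -scalemxAl scalerN.
have lineE v : chart_line Bp Bk z0 v = chart_line Bp0 Bk0 z0 (r *: v).
  by rewrite /chart_line BpE /Bk -scale_col_mx -scalemxAr scalemxAl.
(* Scaling the basis by r turns the ball of radius r into the unit ball. *)
have def v : `|v| < 1 -> split_definite O Bp Bk g (chart_line Bp Bk z0 v).
  move=> v1; rewrite lineE; have [Or pr nr] := r1P _ (rr v v1).1.
  have s0 u : u != 0 -> r *: u != 0 :> 'rV[R]_2.
    by move=> u0; rewrite scaler_eq0 negb_or u0 gt_eqF.
  split; first exact: Or.
    by move=> u u0; rewrite BpE -scalemxAr scalemxAl; exact/pr/s0.
  by move=> u u0; rewrite -scalemxAr scalemxAl; exact/nr/s0.
have negB v : v != 0 -> rderive2 (v *m Bk) g z0 < 0.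
  move=> v0; rewrite -scalemxAr scalemxAl; apply: neg.
  by rewrite scaler_eq0 negb_or v0 gt_eqF.
have Bu : (B : 'M[R]_(2 + 2)) \in unitmx.
  by rewrite -row_free_unit; exact: (turned_free oO sg Oz0 Lg negB).
have JB : Jmx R 2 *m B = B *m Jmx R 2 := turned_commute Bk.
have JBi : Jmx R 2 *m invmx B = invmx B *m Jmx R 2.
  by rewrite -[LHS]mul1mx -(mulVmx Bu) -mulmxA [B *m _]mulmxA -JB -!mulmxA mulmxV// mulmx1.
pose aff (z : Cn R 2) := z0 + linear_part B z.
pose affi (z : Cn R 2) := linear_part (invmx B) (z - z0).
have affE z : aff z = chart_line Bp Bk z0 (real_of z) by [].
have affK z : affi (aff z) = z.
  rewrite /affi /aff [z0 + _]addrC addrK /linear_part cplx_ofK -mulmxA mulmxV//.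
  by rewrite mulmx1 real_ofK.
have affiK z : aff (affi z) = z.
  rewrite /affi /aff /linear_part cplx_ofK -mulmxA mulVmx// mulmx1 real_ofK.
  by rewrite subrKC.
have aff_diff z : differentiable aff z.
  apply: (@differentiableD _ _ _ (fun=> z0)); first exact: differentiable_cst.
  exact: linear_part_differentiable.
have affi_diff z : differentiable affi z.
  apply: (@differentiable_comp _ _ _ _ (fun z => z - z0) (linear_part (invmx B))).
    by apply: (@differentiableB _ _ _ id (fun=> z0)); [|exact: differentiable_cst].
  exact: linear_part_differentiable.
pose psi (z : C2) : X := cinv a (aff z).
pose phi (y : X) : C2 := affi (cmap a y).
have KO z : @K2 R z -> [/\ O (aff z), Q (psi z) & `|real_of z| < 1].
  move=> /K2P z1; have [b1 b2] := rr _ z1; split=> //.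
    by have [] := def _ z1.
  by rewrite /psi affE lineE; exact: r2P.
pose V : set X := [set y | cdom a y /\ @K2 R (phi y)].
have KV z : @K2 R z -> V (psi z) /\ phi (psi z) = z.
  move=> zK; have [Oz Qz z1] := KO z zK; have [ay Uy yz] := chart_imageP Oz.
  have e : phi (psi z) = z by rewrite /phi /psi yz affK.
  by split=> //; split=> //; rewrite e.
have VK y : V y -> psi (phi y) = y.
  by move=> [ay yK]; rewrite /psi /phi affiK cmapK.
have phic y : cdom a y -> {for y, continuous phi}.
  move=> ay; apply: (continuous_comp (cmap_continuous ay)).
  exact: differentiable_continuous.
have oK := @K2_open R.
have psic z : @K2 R z -> {for z, continuous psi}.
  move=> zK; have [Oz _ _] := KO z zK.
  apply: (@continuous_comp _ _ _ aff (cinv a)); last exact: chart_image_cont Oz.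
  exact: differentiable_continuous.
have oV : open V.
  rewrite openE => y [ay yK]; apply: filterI; first exact: near_cdom.
  exact: (near_continuous (phic y ay) erefl (near_open oK yK)).
exists V, phi, psi; split=> //.
- split=> //; apply/K2P; rewrite /phi (_ : affi _ = 0).
    by rewrite /real_of; apply/rV_norm_ltP => // j; rewrite mxE; case: (fintype.split j) => i;
      rewrite !mxE /= normr0.
  rewrite /affi subrr /linear_part (_ : real_of 0 = 0) ?mul0mx ?cplx_of0//.
  by rewrite -cplx_of0 cplx_ofK.
- move=> y Vy; rewrite -(VK y Vy); have [Oz Qz _] := KO _ Vy.2; split=> //.
  by have [_ Uy _] := chart_imageP Oz.
- split=> [y Vy|z /KV[]||]; [by split; [exact: Vy.2|exact: VK]|by []| |].
  + split.
      rewrite (continuous_open_subspace _ oV) => y; rewrite inE => -[ay _].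
      exact: phic.
    move=> y b b' [ay yK] bA by_ -> _ /=.
    apply: (@differentiable_comp _ _ _ _ (cmap a \o cinv b) affi).
      exact: (atlas_compat bA aA by_ ay).
    exact: affi_diff.
  + split.
      by rewrite (continuous_open_subspace _ oK) => z; rewrite inE; exact: psic.
    move=> z b' b zK -> _ bA bz /=.
    apply: (@differentiable_comp _ _ _ _ aff (cmap b \o cinv a)); first exact: aff_diff.
    have [Oz _ _] := KO z zK; have [ay _ yz] := chart_imageP Oz.
    by have := atlas_compat aA bA ay bz; rewrite yz.
have e0 : g z0 = t0 by rewrite /g /= /z0 cmapK.
have sE := saddle_local sg (crit aA ac) e0 ltr01 def.
rewrite (_ : [set v | _] = [set v | `|v| < 1 /\ t0 < g (chart_line Bp Bk z0 v)])//.
by apply/seteqP; split=> v /=; rewrite /psi affE cplx_ofK.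
Qed.

End SaddleChart.

(** * The obstruction at a critical point of index two *)

Lemma H1_eq_refl (R : realType) (n : nat) (X : chartedSpace R n) (G : set X) c :
  H1 (Osheaf X) G c -> H1_eq (Osheaf X) G c c.
Proof.
move=> [oc cG _ _]; exists (cidx c), (ccov c), id, id, (fun _ _ => 0).
split; [exact: oc|exact: cG|by []| |].
  by move=> j x a _ _ _; exact: differentiable_cst.
by move=> j k x jx kx; rewrite /= add0r subr0.
Qed.

Lemma jmap_H1 (R : realType) (n : nat) (X : chartedSpace R n) (G : set X) r c :
  H1 (Zsheaf X) G c -> H1 (Osheaf X) G (jmap R (scale_class r c)).
Proof.
move=> [/= oc cG cl cm]; split; [exact: oc|exact: cG| |]; last first.
  by move=> i j k x ix jx kx; rewrite /= -rmorphD /= -mulrDr cm.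
move=> i j; apply/holomorphicE; first by apply: openI; exact: oc.
move=> x xij; apply: hol_germ_near (hol_germ_cst (r * cval c i j x)%:~R x).
by apply: filterS (cl i j x xij) => y e; rewrite /= e.
Qed.

Section PartTwo.
Variables (R : realType) (X : complexManifold R 2) (U : set X).
Variables (rho : X -> R) (t0 : R) (N : lineBundle U) (H : cochain X (Cx R)).
Local Notation C2 := (CnSpace R 2).
Local Notation G := (superlevel U rho t0).
Hypotheses (oU : open U) (sm : smooth_on U rho) (psh : strictly_psh_on U rho).
Hypothesis HN : is_logarithm N G H.
Variable c : X.
Hypotheses (cS : level U rho t0 c) (crit : critical rho c) (idx : morse_index rho c 2).
Hypothesis no_ext : ~ exists (B : set X) (H' : cochain X (Cx R)),
  is_extension U G H [set c] B H'.
Variable A : cochain C2 int.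
Hypotheses (AH : H1 (Zsheaf C2) (@Dset R) A) (AC : loop_pairing A (@Cloop R) 1).

(** On the saddle formed by the points of the box above the level, H is an
integer structure with some jump r around the plane x = 0. The class A has jump
1, so that H and r A differ there by a trivial structure. If r were 0, the
structure of H itself would be trivial, and H would extend to V. *)
Lemma logarithm_near_saddle : exists (V : set X) (phi : X -> C2) (psi : C2 -> X),
  [/\ open V, V c, V `<=` U, biholomorphism V (@K2 R) phi psi &
   let Kplus := @K2 R `&` psi @^-1` G in
   Kplus `<=` @Dset R /\
   exists (H' : cochain C2 (Cx R)) (r : int),
     [/\ r != 0, H1 (Osheaf C2) (@Dset R) H',
         H1_eq (Osheaf C2) Kplus (res_class Kplus H') (pullback psi Kplus H) &
         H1_eq (Osheaf C2) (@Dset R) H' (jmap R (scale_class r A))]].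
Proof.
have oG : open G by exact: superlevel_open.
have GU : G `<=` U by move=> y [].
have [Uc rc] := cS.
have [gam [f [F [gamP FP fF HE]]]] := logarithm_structure oG GU HN.
have [l lc] : exists l, lcov N l c.
  by have := Uc; rewrite -{1}(lcov_cover N) => -[l _ lc]; exists l.
have [V [phi [psi [oV Vc VQU bi sE]]]] := saddle_chart oU sm Uc rc psh crit idx (near_lcov lc).
have Vl : V `<=` lcov N l by move=> y /VQU[].
have VU : V `<=` U by move=> y /VQU[].
have [lg [m [lgP mP mS]]] := log_integer_structure gamP oG FP oV Vl.
have [phiV psiK phi_hol psi_hol] := bi.
have oK := @K2_open R.
have psic z : @K2 R z -> {for z, continuous psi}.
  exact: holomorphic_map_cont.
have phic y : V y -> {for y, continuous phi} by exact: holomorphic_map_cont.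
set E := [set v | _] in sE.
pose psi' (v : 'rV[R]_(2 + 2)) : X := psi (cplx_of v).
pose phi' y : 'rV[R]_(2 + 2) := real_of (phi y).
have EK v : E v -> @K2 R (cplx_of v) by move=> [v1 _]; apply/K2P; rewrite cplx_ofK.
have psi'E v : E v -> (V `&` G) (psi' v).
  move=> Ev; have [Vv _] := psiK _ (EK v Ev); split=> //; split; first exact: VU.
  by case: Ev.
have KE z : (@K2 R `&` psi @^-1` G) z -> E (real_of z).
  by move=> [/K2P z1 [_ rz]]; split=> //; rewrite real_ofK.
have psi'c v : E v -> {for v, continuous psi'}.
  move=> Ev; apply: continuous_comp; first exact: cplx_of_continuous.
  exact/psic/EK.
have oE : open E by case: sE.
have mHS : int_structure E (fun v => m (psi' v) \o psi').
  exact: (int_structure_pullback psi'c psi'E oE mS).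
have [r jH] := saddle_jump sE mHS.
have [al [mA [alE alm mAS]]] := int_cocycle_split AH.
have mAS' : int_structure (punctured_box (R := R)) (fun v => mA (cplx_of v) \o cplx_of (n := 2)).
  apply: (int_structure_pullback _ _ _ mAS).
  - by move=> v _; exact: cplx_of_continuous.
  - by move=> v bv; apply/DsetP; rewrite cplx_ofK.
  - by have [] := saddle_punctured_box R.
have [j jA] := saddle_jump (@saddle_punctured_box R) mAS'.
have AD i z : ccov A i z -> @Dset R z by have [_ <- _ _] := AH; exists i.
have j1 := loop_pairing_jump alE alm AD jA AC.
have Ebox : E `<=` punctured_box (R := R).
  move=> v Ev; split; first by case: Ev.
  by have [_ _ Eu _ _] := sE; have [] := Eu v Ev.
rewrite -j1 in jA; have [hh hhP] := same_jump sE jH (has_jump_sub Ebox jA).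
exists V, phi, psi; split=> // Kplus.
have KD : Kplus `<=` @Dset R by move=> z /KE/Ebox/DsetP.
split=> //; exists (jmap R (scale_class r A)), r; split.
- apply/eqP => r0; apply: no_ext.
  pose k y := hh (phi' y).
  have phi'c y : V y -> {for y, continuous phi'}.
    by move=> Vy; apply: continuous_comp; [exact: phic|exact: real_of_continuous].
  have phi'K y : V y -> psi' (phi' y) = y.
    by move=> Vy; rewrite /psi' /phi' real_ofK; have [] := phiV y Vy.
  have kP y : (V `&` G) y -> same_germ y k (m y).
    move=> [Vy Gy]; have Ey : E (phi' y).
      have [Ky e] := phiV y Vy; apply: KE; split=> //=.
      by rewrite e.
    have := same_germ_pullback (phi'c y Vy) (hhP _ Ey).
    apply: filterS2 (near_open oV Vy) => w Vw.
    by rewrite /= r0 !mul0r !subr0 !phi'K.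
  have [fN fF0] := extend_over_trivialised gamP oV Vl lgP mP kP.
  have ext := log_extension_over oG FP oV VU fN fF0.
  have [|H' [ext' _]] := @extension_of_log_extension _ _ _ _ _ [set c] _ _ oG GU HN
    _ _ _ _ _ gamP fF HE _ ext; first by move=> y ->.
  by exists V, H'.
- exact: jmap_H1.
- have oKp : open Kplus.
    rewrite openE => z [Kz Gz]; apply: filterI.
      exact: (near_open oK Kz).
    exact: (near_continuous (psic z Kz) erefl (near_open oG Gz)).
  have [[oH covH _ _] _] := HN; have [oA covA _ _] := AH.
  pose W (ik : cidx A * cidx H) := Kplus `&` (ccov A ik.1 `&` psi @^-1` ccov H ik.2).
  have oW ik : open (W ik).
    rewrite openE => z [Kz [iz kz]]; apply: filterI.
      exact: (near_open oKp Kz).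
    apply: filterI; first exact: (near_open (oA ik.1) iz).
    exact: (near_continuous (psic z Kz.1) erefl (near_open (oH ik.2) kz)).
  (* Near each point of the saddle f is lg plus integers, modulo holomorphic
  functions, and hh is the difference of these integers and of r al. *)
  exists (cidx A * cidx H)%type, W, fst, snd, (fun ik z =>
    (r * al ik.1 z)%:~R - f ik.2 (psi z) + lg (psi z) + (hh (real_of z))%:~R).
  split; [exact: oW| | | |].
  + apply/seteqP; split=> z; first by move=> [ik _ []].
    move=> Kz; have := KD _ Kz; rewrite -covA => -[i _ iz].
    by have : G (psi z) := Kz.2; rewrite -covH => -[k _ kz]; exists (i, k).
  + by move=> ik z [Kz [iz kz]].
  + move=> [i k]; apply/holomorphicE; [exact: oW|move=> z [Kz [/= iz kz]]].
    have VGz : (V `&` G) (psi z) by split; [have [] := psiK z Kz.1|exact: Kz.2].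
    have fm := hol_eq_trans (fF k _ kz) (hol_eq_sym (mP _ VGz)).
    have fm' := hol_germ_pullback oK psi_hol Kz.1 fm.
    have e1 := same_germ_pullback (@real_of_continuous R 2 z) (hhP _ (KE _ Kz)).
    have e2 := alm i z iz.
    pose d (w : C2) : int := r * al i w + hh (real_of w) - m (psi z) (psi w).
    have dc : \forall w \near z, d w = d z.
      apply: filterS2 e1 e2 => w; rewrite /= /psi' !real_ofK /d.
      move=> h1 h2.
      have -> : al i w = al i z - mA z z + mA z w by rewrite -h2 subrK.
      move: h1; set x1 := m _ _; set x2 := m _ _; set x3 := mA z w; set x4 := mA z z.
      by move=> h1; lia.
    apply: hol_germ_near (hol_germD (hol_germN fm') (hol_germ_cst (d z)%:~R z)).
    apply: filterS dc => w <-; rewrite /d /= rmorphB rmorphD /=; ring.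
  + move=> [i k] [i' k'] z [Kz [/= iz kz]] [_ [/= iz' kz']].
    by rewrite alE// HE// mulrBr rmorphB /=; ring.
- by apply: H1_eq_refl; exact: jmap_H1.
Qed.

End PartTwo.

Theorem corollary4p1 (R : realType) (n : nat) (X : complexManifold R n)
    (U : set X) (rho : X -> R) (t0 : R) (N : lineBundle U)
    (H : cochain X (Cx R))
    (n_ge2 : (2 <= n)%N)
    (U_domain : is_domain U)
    (rho_smooth : smooth_on U rho)
    (rho_spsh : strictly_psh_on U rho)
    (rho_morse : morse_on U rho)
    (Sigma_connected : connected (level U rho t0))
    (Sigma_compact : compact (level U rho t0))
    (Sigma_critical :
       level U rho t0 `&` [set x | critical rho x] = set0 \/
       exists c, level U rho t0 `&` [set x | critical rho x] = [set c])
    (H_log : is_logarithm N (superlevel U rho t0) H) :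
  ((3 <= n)%N \/
     n = 2%N /\ (forall x, level U rho t0 x -> critical rho x ->
                   ~ morse_index rho x 2) ->
   exists (B : set X) (H' : cochain X (Cx R)),
     is_extension U (superlevel U rho t0) H (level U rho t0) B H' /\
     is_logarithm N (superlevel U rho t0 `|` B) H')
  /\
  (forall c : X, level U rho t0 c -> critical rho c ->
     n = 2%N -> morse_index rho c 2 ->
     ~ (exists (B : set X) (H' : cochain X (Cx R)),
          is_extension U (superlevel U rho t0) H [set c] B H') ->
   forall A : cochain (CnSpace R 2) int,
     H1 (Zsheaf (CnSpace R 2)) (@Dset R) A -> loop_pairing A (@Cloop R) 1 ->
   exists (V : set X) (phi : X -> CnSpace R 2) (psi : CnSpace R 2 -> X),
     [/\ open V, V c, V `<=` U, biholomorphism V (@K2 R) phi psi &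
      let Kplus := @K2 R `&` psi @^-1` superlevel U rho t0 in
      Kplus `<=` @Dset R /\
      exists (H' : cochain (CnSpace R 2) (Cx R)) (r : int),
        [/\ r != 0, H1 (Osheaf (CnSpace R 2)) (@Dset R) H',
            H1_eq (Osheaf (CnSpace R 2)) Kplus
              (res_class Kplus H') (pullback psi Kplus H) &
            H1_eq (Osheaf (CnSpace R 2)) (@Dset R)
              H' (jmap R (scale_class r A))]]).
Proof.
have oU : open U by have [] := U_domain.
split=> [nI|]; first exact: (logarithm_extends_near_level oU rho_smooth rho_spsh rho_morse Sigma_compact H_log nI).
move=> c cS crit n2 idx no_ext A AH AC; subst n.
exact: (logarithm_near_saddle oU rho_smooth rho_spsh H_log cS crit idx no_ext AH AC).
Qed.
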